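(* Let $H\in(0,1)$ and, for $\lambda<\lambda^*$, let $(\mathbf{x}_t)_{t\ge0}$ be a solution in $\mathbb{R}^2$ of $$\mathrm{d}\mathbf{x}_t=M(\lambda)\mathbf{x}_t\,\mathrm{d}t+\Sigma\,\mathrm{d}\mathbf{W}^H_t ,$$ where $M(\lambda)\in\mathbb{R}^{2\times2}$ has complex conjugate eigenvalues $\zeta_1(\lambda)=A(\lambda)+iB(\lambda)=\overline{\zeta_2(\lambda)}$, and let $Q:=\Sigma\Sigma^{\mathrm T}$. For any $\tau\ge0$ and any $j_1,j_2\in\{1,2\}$, $$V_\infty(\tau)\left[\mathbf{e}^*_{j_1}(\lambda),\mathbf{e}^*_{j_2}(\lambda)\right]=\left(-\zeta_{j_1}(\lambda)-\overline{\zeta_{j_2}(\lambda)}\right)^{-1}H\left\langle\mathbf{e}^*_{j_2}(\lambda),Q\,\mathbf{e}^*_{j_1}(\lambda)\right\rangle P(\zeta_{j_1}(\lambda),\zeta_{j_2}(\lambda),H,\tau).$$ If moreover $\Sigma$ is not the null matrix, then, as $\lambda\to\lambda^*$, $$\left|V_\infty(\tau)[\mathbf{v}_1,\mathbf{v}_2]\right|\asymp|A(\lambda)|^{-1}$$ for almost every $\tau\ge0$ and any $\mathbf{v}_1,\mathbf{v}_2\in\mathbb{R}^2$ such that $$e^{-iB(\lambda^* )\tau}\langle\mathbf{e}^*_1(\lambda^* ),Q\mathbf{e}^*_1(\lambda^* )\rangle\,\overline{\langle\mathbf{v}_1,\mathbf{e}_1(\lambda^* )\rangle}\,\langle\mathbf{v}_2,\mathbf{e}_1(\lambda^*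 )\rangle+e^{iB(\lambda^* )\tau}\langle\mathbf{e}^*_2(\lambda^* ),Q\mathbf{e}^*_2(\lambda^* )\rangle\,\overline{\langle\mathbf{v}_1,\mathbf{e}_2(\lambda^* )\rangle}\,\langle\mathbf{v}_2,\mathbf{e}_2(\lambda^* )\rangle\ne0.$$
   Context: Setting. $A,B:(-\infty,\lambda^*]\to\mathbb{R}$ are continuous, $A(\lambda)<0$ for $\lambda<\lambda^*$, $A(\lambda^* )=0$, and $B(\lambda)\ne0$ for all $\lambda\le\lambda^*$. For $\lambda\le\lambda^*$ the matrix $M(\lambda)\in\mathbb{R}^{2\times2}$ has eigenvalues $A(\lambda)\pm iB(\lambda)$, with eigenvectors in $\mathbb{C}^2$, continuous in $\lambda\le\lambda^*$: $M\mathbf{e}_1=(A+iB)\mathbf{e}_1$, $M\mathbf{e}_2=(A-iB)\mathbf{e}_2$, $M^{\mathrm T}\mathbf{e}_1^*=(A-iB)\mathbf{e}_1^*$, $M^{\mathrm T}\mathbf{e}_2^*=(A+iB)\mathbf{e}_2^*$ (all depending on $\lambda$), normalized so that $\langle\mathbf{e}_{j}(\lambda),\mathbf{e}_{k}^*(\lambda)\rangle=\delta_{jk}$. $\Sigma\in\mathbb{R}^{2\times2}$ has non-negative real spectrum. $\langle\mathbf{w}_1,\mathbf{w}_2\rangle:=\mathbf{w}_1^{\mathrm T}\overline{\mathbf{w}_2}$. $(\mathbf{W}^H_t)_{t\ge0}$ is a fractional Brownian motion in $\mathbb{R}^2$ with Hurst index $H$: a centered Gaussian process with $\mathbb{E}[\mathbf{W}^H_t(\mathbf{W}^H_s)^{\mathrm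 T}]=\tfrac12(t^{2H}+s^{2H}-|t-s|^{2H})I$. Solutions satisfy $\mathbf{x}_t=\mathbf{x}_0+\int_0^tM(\lambda)\mathbf{x}_s\,\mathrm{d}s+\Sigma\mathbf{W}^H_t$ with deterministic $\mathbf{x}_0\in\mathbb{R}^2$. For $\mathbf{w}_1,\mathbf{w}_2\in\mathbb{C}^2$, $V_t(\tau)[\mathbf{w}_1,\mathbf{w}_2]=\mathbb{E}\big[\langle\mathbf{x}_t,\mathbf{w}_1\rangle\overline{\langle\mathbf{x}_{t+\tau},\mathbf{w}_2\rangle}\big]-\mathbb{E}[\langle\mathbf{x}_t,\mathbf{w}_1\rangle]\,\mathbb{E}\big[\overline{\langle\mathbf{x}_{t+\tau},\mathbf{w}_2\rangle}\big]$ and $V_\infty(\tau)[\mathbf{w}_1,\mathbf{w}_2]=\lim_{t\to\infty}V_t(\tau)[\mathbf{w}_1,\mathbf{w}_2]$. For $\alpha,\beta\in\mathbb{C}$ with negative real part and $\tau\ge0$, $$P(\alpha,\beta,H,\tau):=e^{\overline{\beta}\tau}(-\overline{\beta})^{-2H+1}\Gamma(2H)+e^{-\alpha\tau}(-\alpha)^{-2H+1}\Gamma(2H,-\alpha\tau)+e^{\overline{\beta}\tau}\,\overline{\beta}^{\,-2H+1}\gamma(2H,\overline{\beta}\tau),$$ where $z^q:=\exp(q\log|z|+i\,q\arg z)$ with principal argument, and for $s>0$: $\Gamma(s)=\int_0^\infty w^{s-1}e^{-w}\mathrm{d}w$; $\Gamma(s,z)=\int_z^{e^{i\arg z}\infty}w^{s-1}e^{-w}\mathrm{d}w$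 along a ray for $\mathrm{Re}\,z>0$, with $\Gamma(s,0)=\Gamma(s)$; $\gamma(s,z)=\int_0^zw^{s-1}e^{-w}\mathrm{d}w$ along the straight segment. $|b_1(\lambda)|\asymp|b_2(\lambda)|$ means $0<\liminf_{\lambda\to\lambda^*}|b_1/b_2|\le\limsup_{\lambda\to\lambda^*}|b_1/b_2|<\infty$, with $\lambda\to\lambda^*$ from below.
   Formalization: The fractional Brownian motion is additionally assumed to have almost surely continuous sample paths; with only the Gaussian law prescribed, a non-measurable modification of the noise can change the law of the pathwise solution and so the covariance. *)

(* Defs.v *)
From HB Require Import structures.
From mathcomp Require Import all_boot all_order all_algebra.
From mathcomp Require Import complex.
From mathcomp Require Import all_classical all_reals all_analysis.
Import Order.TTheory GRing.Theory Num.Theory.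
Import numFieldNormedType.Exports.

Set Implicit Arguments.
Unset Strict Implicit.
Unset Printing Implicit Defensive.

Local Open Scope classical_set_scope.
Local Open Scope ring_scope.
Local Open Scope complex_scope.

Local Notation Re := complex.Re.
Local Notation Im := complex.Im.

Section ComplexAnalysis.
Variable R : realType.
Local Notation C := R[i].

Definition cabs (z : C) : R := ComplexField.Normc.normc z.

Definition cexp (z : C) : C :=
  (expR (Re z))%:C * (cos (Im z) +i* sin (Im z)).

(* Principal argument, in ]-pi, pi] for z != 0. *)
Definition carg (z : C) : R :=
  if 0 <= Im z then acos (Re z / cabs z) else - acos (Re z / cabs z).

Definition cpow (z : C) (q : R) : C :=
  cexp ((q * ln (cabs z)) +i* (q * carg z)).

Definition cintegral (d : measure_display) (T : measurableType d)
    (mu : {measure set T -> \bar R}) (D : set T) (f : T -> C) : C :=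
  (\int[mu]_(x in D) Re (f x)) +i* (\int[mu]_(x in D) Im (f x)).

Definition Gamma (s : R) : R :=
  \int[lebesgue_measure]_(w in `]0, +oo[) (w `^ (s - 1) * expR (- w)).

(* The form w^(s-1) e^(-w) dw pulled back along w = u z, with u real: u from 1
   to +oo describes the ray from z to e^(i arg z) oo, and u from 0 to 1 the
   segment from 0 to z. *)
Definition gamma_form (s : R) (z : C) (u : R) : C :=
  cpow (u%:C * z) (s - 1) * cexp (- (u%:C * z)) * z.

Definition upper_Gamma (s : R) (z : C) : C :=
  if z == 0 then (Gamma s)%:C
  else cintegral lebesgue_measure `[1, +oo[ (gamma_form s z).

Definition lower_gamma (s : R) (z : C) : C :=
  cintegral lebesgue_measure `[0, 1] (gamma_form s z).

Definition Pcov (alpha beta : C) (H tau : R) : C :=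
  let b := conjc beta in
    cexp (b * tau%:C) * cpow (- b) (- 2 * H + 1) * (Gamma (2 * H))%:C
  + cexp (- alpha * tau%:C) * cpow (- alpha) (- 2 * H + 1)
      * upper_Gamma (2 * H) (- alpha * tau%:C)
  + cexp (b * tau%:C) * cpow b (- 2 * H + 1)
      * lower_gamma (2 * H) (b * tau%:C).

Definition mxC (m n : nat) (A : 'M[R]_(m, n)) : 'M[C]_(m, n) :=
  map_mx (real_complex R) A.

Definition cdot (n : nat) (w1 w2 : 'cV[C]_n) : C :=
  (w1^T *m map_mx conjc w2) 0 0.

(* The index 0 : 'I_2 stands for j = 1 and the other one for j = 2. *)
Definition zeta (A B : R -> R) (l : R) (j : 'I_2) : C :=
  if j == 0 then A l +i* B l else A l -i* B l.

(* |b1| and |b2| are of the same order as l tends to ls from below. *)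
Definition asymp_left (ls : R) (b1 b2 : R -> R) : Prop :=
  let r := fun l => (`| b1 l / b2 l |)%:E in
  [/\ (0 < limf_einf r ls^'-)%E,
      (limf_einf r ls^'- <= limf_esup r ls^'-)%E
    & (limf_esup r ls^'- < +oo)%E].

End ComplexAnalysis.

Section Processes.
Variables (R : realType) (d : measure_display) (T : measurableType d).
Variable P : probability T R.
Local Notation C := R[i].

(* normal_prob m s is not the Dirac mass at m when s = 0, hence the separate
   degenerate case. *)
Definition gaussian_rv (X : T -> R) : Prop :=
  measurable_fun [set: T] X /\
  exists m : R,
    {ae P, forall w, X w = m} \/
    exists2 s : R, 0 < s &
      forall A, measurable A -> P (X @^-1` A) = normal_prob m s A.

(* Every finite linear combination of the coordinates X t i is Gaussian. *)
Definition gaussian_process (X : R -> T -> 'cV[R]_2) : Prop :=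
  forall (n : nat) (t : 'I_n -> R) (c : 'I_n -> 'I_2 -> R),
    (forall k, 0 <= t k) ->
    gaussian_rv (fun w => \sum_(k < n) \sum_(i < 2) c k i * X (t k) w i 0).

(* As usual for a fractional Brownian motion, the sample paths are almost surely
   continuous. *)
Definition fBm (H : R) (W : R -> T -> 'cV[R]_2) : Prop :=
  [/\ gaussian_process W,
      forall (t : R) i, 0 <= t -> ('E_P[fun w => (W t w i 0)%R] = 0)%E,
      forall (t s : R) i j, 0 <= t -> 0 <= s ->
        'E_P[fun w => ((W t w *m (W s w)^T) i j)%R]%E =
        ((((t `^ (2 * H) + s `^ (2 * H) - `|t - s| `^ (2 * H)) / 2)%:M
           : 'M[R]_2) i j)%:E
    & {ae P, forall w, forall i : 'I_2,
        {within `[0, +oo[, continuous (fun t : R => W t w i 0)}}].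

(* As the noise is additive, dx = M x dt + S dW is the pathwise equation
   x_t = x_0 + \int_0^t M x_s ds + S W_t. *)
Definition solution (M S : 'M[R]_2) (W : R -> T -> 'cV[R]_2)
    (x0 : 'cV[R]_2) (x : R -> T -> 'cV[R]_2) : Prop :=
  (forall (t : R) i, 0 <= t -> measurable_fun [set: T] (fun w => x t w i 0)) /\
  {ae P, forall w, forall t : R, 0 <= t ->
     (forall i, lebesgue_measure.-integrable `[0, t]
        (EFin \o (fun s : R => (M *m x s w) i 0))) /\
     x t w = x0
       + \col_i (\int[lebesgue_measure]_(s in `[0, t]) ((M *m x s w) i 0))
       + S *m W t w}.

Definition cexpectation (X : T -> C) : C :=
  fine ('E_P[fun w => Re (X w)])%E +i* fine ('E_P[fun w => Im (X w)])%E.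

Definition Vt (x : R -> T -> 'cV[R]_2) (tau : R) (w1 w2 : 'cV[C]_2) (t : R)
    : C :=
  cexpectation (fun w =>
    cdot (mxC (x t w)) w1 * conjc (cdot (mxC (x (t + tau) w)) w2))
  - cexpectation (fun w => cdot (mxC (x t w)) w1)
    * cexpectation (fun w => conjc (cdot (mxC (x (t + tau) w)) w2)).

(* R[i]^o carries the usual topology of the complex plane. *)
Definition Vinf (x : R -> T -> 'cV[R]_2) (tau : R) (w1 w2 : 'cV[C]_2) : C :=
  lim ((Vt x tau w1 w2 t : C^o) @[t --> +oo]).

End Processes.

(* Main.v *)
Require Import Defs.
From HB Require Import structures.
From mathcomp Require Import all_boot all_order all_algebra.
From mathcomp Require Import complex.
From mathcomp Require Import all_classical all_reals all_analysis.
From mathcomp Require Import measurable_realfun ring lra.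
Import Order.TTheory GRing.Theory Num.Theory.
Import numFieldNormedType.Exports.
Set Implicit Arguments.
Unset Strict Implicit.
Unset Printing Implicit Defensive.
Local Open Scope classical_set_scope.
Local Open Scope ring_scope.
Local Open Scope complex_scope.
Local Notation Re := complex.Re.
Local Notation Im := complex.Im.

(** Let s = 2H. Pairing the equation with a left eigenvector of M(l) for the eigenvalue
    z makes it scalar, u' = z u + w' with w a component of the noise, so that
    u(t) = e^(zt) u(0) + relax z w t (langevin_path), where relax is the variation of
    constants formula freed of the derivative of w by parts. Expectation commutes with
    relax (expectation_relaxed), hence the covariance of two such components is a
    matrix element of Q times the double relaxation relax2 of the scalar covariance
    (|v|^s + |w|^s - |v - w|^s) / 2 (relaxed_ccov, Vt_relax2).

    This double relaxation is elementary up to the truncated Laplace transform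
    tlap p t, the integral of e^(-pv) v^s over [0, t] (relax2E). For large t the terms
    with a decaying exponential vanish and the others converge (cvg_relax2). On the
    other side, an integration by parts and a rotation of the ray of integration turn
    the gamma functions of P into the same Laplace transforms: s Gamma(s) z^(1-s) is
    z^2 times the Laplace transform of v^s at z, because z^(s+1) times the latter does
    not depend on z (lap_rotation), and the two incomplete functions give its truncated
    versions (upper_term, lower_term). The two sides then agree (PcovE,
    cvg_relax2_Pcov), and the first claim follows as the es_j are dual to the e_j.

    For the second claim the test vectors are expanded in the basis es, and the
    stationary covariance becomes a sum of four terms (VinfE) whose weights are
    continuous up to ls. The terms with two different eigenvalues remain bounded. Those
    with twice the same eigenvalue carry the factor 1 / (2|A|). As P has a limit on the
    imaginary axis (cvg_Pcov), the covariance multiplied by |A| converges to the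
    expression assumed nonzero, times the constant
    H Gamma(s) |B(ls)|^(1-s) cos((1-s) pi/2), up to a rearrangement of the factors;
    this constant is not 0, since |1 - s| < 1. *)

(** * Complex-valued functions of a real variable *)

Section ComplexParts.
Variable R : realType.
Local Notation C := R[i].
Implicit Types z w : C.

Lemma Re_D z w : Re (z + w) = Re z + Re w. Proof. by case: z w => [? ?] []. Qed.
Lemma Im_D z w : Im (z + w) = Im z + Im w. Proof. by case: z w => [? ?] []. Qed.
Lemma Re_N z : Re (- z) = - Re z. Proof. by case: z. Qed.
Lemma Im_N z : Im (- z) = - Im z. Proof. by case: z. Qed.
Lemma Re_B z w : Re (z - w) = Re z - Re w. Proof. by rewrite Re_D Re_N. Qed.
Lemma Im_B z w : Im (z - w) = Im z - Im w. Proof. by rewrite Im_D Im_N. Qed.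
Lemma Re_M z w : Re (z * w) = Re z * Re w - Im z * Im w.
Proof. by case: z w => [? ?] []. Qed.
Lemma Im_M z w : Im (z * w) = Re z * Im w + Im z * Re w.
Proof. by case: z w => [? ?] []. Qed.
Lemma Re_conj z : Re (conjc z) = Re z. Proof. by case: z. Qed.
Lemma Im_conj z : Im (conjc z) = - Im z. Proof. by case: z. Qed.
Definition ReImE := (Re_B, Im_B, Re_D, Im_D, Re_N, Im_N, Re_M, Im_M, Re_conj, Im_conj).

Lemma complex_eq z w : Re z = Re w -> Im z = Im w -> z = w.
Proof. by case: z w => [? ?] [? ?] /= -> ->. Qed.

Lemma cabsE z : cabs z = Num.sqrt (Re z ^+ 2 + Im z ^+ 2).
Proof. by case: z. Qed.

Lemma cabs_ge0 z : 0 <= cabs z. Proof. by rewrite cabsE sqrtr_ge0. Qed.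

Lemma cabsM z w : cabs (z * w) = cabs z * cabs w.
Proof. exact: ComplexField.Normc.normcM. Qed.

Lemma cabsD z w : cabs (z + w) <= cabs z + cabs w.
Proof. exact: le_normcD. Qed.

Lemma cabs_real (r : R) : cabs r%:C = `|r|.
Proof. by rewrite cabsE /= expr0n /= addr0 sqrtr_sqr. Qed.

Lemma normc_cabs z : `|z| = (cabs z)%:C.
Proof. by case: z. Qed.

Lemma ler_Re_cabs z : `|Re z| <= cabs z.
Proof. by rewrite cabsE -sqrtr_sqr ler_sqrt ?lerDl ?addr_ge0 ?sqr_ge0. Qed.

Lemma ler_Im_cabs z : `|Im z| <= cabs z.
Proof. by rewrite cabsE -sqrtr_sqr ler_sqrt ?lerDr ?addr_ge0 ?sqr_ge0. Qed.

Lemma ler_cabs z : cabs z <= `|Re z| + `|Im z|.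
Proof.
rewrite {1}(_ : z = (Re z)%:C + (Im z)%:C * 'i); last first.
  by apply: complex_eq; rewrite !ReImE /=; lra.
rewrite (le_trans (cabsD _ _))// cabsM !cabs_real (_ : cabs 'i = 1) ?mulr1//.
by rewrite cabsE /= expr0n expr1n add0r sqrtr1.
Qed.

Lemma cabs_sqr z : cabs z ^+ 2 = Re z ^+ 2 + Im z ^+ 2.
Proof. by rewrite cabsE sqr_sqrtr// addr_ge0 ?sqr_ge0. Qed.

Lemma cabs_eq0 z : (cabs z == 0) = (z == 0).
Proof.
apply/eqP/eqP => [|->]; first exact: ComplexField.Normc.eq0_normc.
by rewrite -(rmorph0 (real_complex R)) cabs_real normr0.
Qed.

Lemma cabs_gt0 z : (0 < cabs z) = (z != 0).
Proof. by rewrite lt_def cabs_ge0 andbT cabs_eq0. Qed.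

Lemma cexp0 : cexp (0 : C) = 1.
Proof. by rewrite /cexp /= expR0 cos0 sin0 mul1r. Qed.

Lemma cexpD z w : cexp (z + w) = cexp z * cexp w.
Proof.
rewrite /cexp; apply: complex_eq;
  rewrite !ReImE /= expRD cosD sinD; ring.
Qed.

Lemma cexpN z : cexp (- z) * cexp z = 1.
Proof. by rewrite -cexpD addNr cexp0. Qed.

Lemma cexp_neq0 z : cexp z != 0.
Proof.
apply/eqP => h; have := cexpN z; rewrite h mulr0 => /eqP.
by rewrite eq_sym oner_eq0.
Qed.

Lemma cexp_real (r : R) : cexp r%:C = (expR r)%:C.
Proof. by rewrite /cexp /= cos0 sin0 mulr1. Qed.

Lemma Re_cexp z : Re (cexp z) = expR (Re z) * cos (Im z).
Proof. by rewrite /cexp Re_M /=; ring. Qed.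

Lemma Im_cexp z : Im (cexp z) = expR (Re z) * sin (Im z).
Proof. by rewrite /cexp Im_M /=; ring. Qed.

Lemma cabs_cexp z : cabs (cexp z) = expR (Re z).
Proof.
rewrite cabsE Re_cexp Im_cexp !exprMn -mulrDr cos2Dsin2 mulr1 sqrtr_sqr.
by rewrite ger0_norm// expR_ge0.
Qed.

Lemma cexp_conj z : cexp (conjc z) = conjc (cexp z).
Proof.
apply: complex_eq; rewrite ?(Re_conj, Im_conj) ?(Re_cexp, Im_cexp).
  by rewrite Re_conj Im_conj cosN.
by rewrite Re_conj Im_conj sinN mulrN.
Qed.

End ComplexParts.

Section ComplexTopology.
Variable R : realType.
Local Notation C := R[i].
Context {T : Type} {F : set_system T} {FF : Filter F}.
Implicit Types f g : T -> C.

(** The norm of R[i] takes its values in R[i]; this brings convergence back to the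
    real-valued modulus. *)
Lemma cvgC_cabs f (l : C) :
  ((f t : C^o) @[t --> F] --> (l : C^o)) <-> (cabs (f t - l) @[t --> F] --> (0 : R)).
Proof.
split => h.
- apply/cvgrPdist_lt => e e0.
  have e0' : 0 < e%:C by rewrite ltcR.
  move/cvgrPdist_lt : h => /(_ _ e0'); apply: filterS => t.
  rewrite sub0r normrN (ger0_norm (cabs_ge0 _)) -[l - f t]opprB normrN normc_cabs.
  by rewrite ltcR.
- apply/cvgrPdist_lt => e e0.
  have [eI eR] : Im e = 0 /\ 0 < Re e.
    by move: e0; rewrite ltcE => /andP[/eqP /= <- ->].
  have -> : e = (Re e)%:C by apply: complex_eq.
  move/cvgrPdist_lt : h => /(_ _ eR); apply: filterS => t.
  rewrite sub0r normrN (ger0_norm (cabs_ge0 _)) -[l - f t]opprB normrN [X in _ -> X < _]normc_cabs.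
  by rewrite ltcR.
Qed.

Lemma cvgC_parts f (l : C) :
  ((f t : C^o) @[t --> F] --> (l : C^o)) <->
  (Re (f t) @[t --> F] --> Re l) /\ (Im (f t) @[t --> F] --> Im l).
Proof.
rewrite cvgC_cabs; split => [h|[hR hI]].
- split; apply/cvgrPdist_lt => e e0;
    move/cvgrPdist_lt : h => /(_ _ e0); apply: filterS => t;
    rewrite sub0r normrN (ger0_norm (cabs_ge0 _)); apply: le_lt_trans;
    rewrite distrC; [rewrite -Re_B; exact: ler_Re_cabs
                    |rewrite -Im_B; exact: ler_Im_cabs].
- have h : `|Re (f t) - Re l| + `|Im (f t) - Im l| @[t --> F] --> (0 : R).
    rewrite -[0]addr0; apply: cvgD.
    + rewrite -(normr0 R) -(subrr (Re l)); apply: cvg_norm; apply: cvgB => //; exact: cvg_cst.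
    + rewrite -(normr0 R) -(subrr (Im l)); apply: cvg_norm; apply: cvgB => //; exact: cvg_cst.
  apply: (@squeeze_cvgr _ _ _ _ (cst 0) (fun t => `|Re (f t) - Re l| + `|Im (f t) - Im l|)).
  + by apply: nearW => t; rewrite /= cabs_ge0/= -Re_B -Im_B ler_cabs.
  + exact: cvg_cst.
  + exact: h.
Qed.

Lemma cvgC_real (f : T -> R) (l : R) :
  f t @[t --> F] --> l -> ((f t)%:C : C^o) @[t --> F] --> (l%:C : C^o).
Proof. by move=> h; apply/cvgC_parts; split => //=; exact: cvg_cst. Qed.

Lemma cvgC_cexp f (l : C) :
  ((f t : C^o) @[t --> F] --> (l : C^o)) ->
  ((cexp (f t) : C^o) @[t --> F] --> (cexp l : C^o)).
Proof.
move=> /cvgC_parts[hR hI]; apply/cvgC_parts.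
rewrite Re_cexp Im_cexp; split.
- under eq_cvg do rewrite Re_cexp.
  apply: cvgM; first by apply: continuous_cvg => //; exact: continuous_expR.
  by apply: continuous_cvg => //; exact: continuous_cos.
- under eq_cvg do rewrite Im_cexp.
  apply: cvgM; first by apply: continuous_cvg => //; exact: continuous_expR.
  by apply: continuous_cvg => //; exact: continuous_sin.
Qed.

Lemma cvgC_cabsE f (l : C) :
  ((f t : C^o) @[t --> F] --> (l : C^o)) -> cabs (f t) @[t --> F] --> cabs l.
Proof.
move=> /cvgC_parts[hR hI]; rewrite cabsE.
under eq_cvg do rewrite cabsE.
apply: continuous_cvg; first exact: sqrt_continuous.
by apply: cvgD; rewrite expr2; under eq_cvg do rewrite expr2; apply: cvgM.
Qed.

Lemma cvgCD f g (l k : C) : (f t : C^o) @[t --> F] --> (l : C^o) ->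
  (g t : C^o) @[t --> F] --> (k : C^o) -> (f t + g t : C^o) @[t --> F] --> (l + k : C^o).
Proof. by move=> hf hg; exact: (@cvgD _ C^o _ _ _ _ _ _ _ hf hg). Qed.

Lemma cvgCB f g (l k : C) : (f t : C^o) @[t --> F] --> (l : C^o) ->
  (g t : C^o) @[t --> F] --> (k : C^o) -> (f t - g t : C^o) @[t --> F] --> (l - k : C^o).
Proof. by move=> hf hg; exact: (@cvgB _ C^o _ _ _ _ _ _ _ hf hg). Qed.

Lemma cvgCM f g (l k : C) : (f t : C^o) @[t --> F] --> (l : C^o) ->
  (g t : C^o) @[t --> F] --> (k : C^o) -> (f t * g t : C^o) @[t --> F] --> (l * k : C^o).
Proof. by move=> hf hg; exact: (cvgM hf hg). Qed.

Lemma cvgC_cst (k : C) : (k : C^o) @[t --> F] --> (k : C^o).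
Proof. exact: cvg_cst. Qed.

Lemma cvgCMl f (k l : C) : (f t : C^o) @[t --> F] --> (l : C^o) ->
  (k * f t : C^o) @[t --> F] --> (k * l : C^o).
Proof. exact/cvgCM/cvgC_cst. Qed.

Lemma cvgC_conj f (l : C) :
  ((f t : C^o) @[t --> F] --> (l : C^o)) ->
  ((conjc (f t) : C^o) @[t --> F] --> (conjc l : C^o)).
Proof.
move=> /cvgC_parts[hR hI]; apply/cvgC_parts; rewrite !ReImE; split.
- by under eq_cvg do rewrite Re_conj.
- by under eq_cvg do rewrite Im_conj; apply: cvgN.
Qed.

End ComplexTopology.

Arguments cvgC_cst {R T F FF} k.
Arguments cvgCMl {R T F FF f} k {l}.

(* The exponential is a product of complex numbers: kept opaque, it is not split by
   the rewriting rules for products. *)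
Local Opaque cexp.

(** * Derivatives and primitives *)

Section RealDerivatives.
Variable R : realType.
Implicit Types f g : R -> R.
Notation mu := (@lebesgue_measure R).

Lemma is_derive_continuous f x l : is_derive x (1 : R) f l -> {for x, continuous f}.
Proof.
by move=> h; apply/differentiable_continuous/derivable1_diffP; case: h.
Qed.

Lemma is_derive_val f (x l l' : R) : is_derive x (1 : R) f l -> l = l' ->
  is_derive x (1 : R) f l'.
Proof. by move=> h <-. Qed.

Lemma derive0_eq f (a b : R) : a <= b ->
  (forall x, a <= x <= b -> is_derive x (1 : R) f 0) -> f b = f a.
Proof.
rewrite le_eqVlt => /predU1P[->//|ab h].
have h' x : x \in `[a, b] -> is_derive x (1 : R) f 0 by rewrite in_itv; exact: h.
have [x _] := @MVT _ f (fun=> 0) a b ab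
  (fun x xab => h' x (subset_itv_oo_cc xab))
  (derivable_within_continuous (fun x xab => @ex_derive _ _ _ _ _ _ _ (h' x xab))).
by rewrite mul0r => /eqP; rewrite subr_eq0 => /eqP.
Qed.

(** Unlike the integral from a fixed left end, this is a primitive of a continuous
    function on the whole line, so that it can be differentiated at 0 as well. *)
Definition prim f (r : R) : R :=
  if 0 <= r then \int[mu]_(x in `[0, r]) f x else - \int[mu]_(x in `[r, 0]) f x.

Lemma continuous_integrable f (a b : R) : continuous f ->
  mu.-integrable `[a, b] (EFin \o f).
Proof.
move=> cf; apply: continuous_compact_integrable; first exact: segment_compact.
exact: continuous_subspaceT.
Qed.

Lemma prim0 f : prim f 0 = 0.
Proof. by rewrite /prim lexx set_itv1 Rintegral_set1. Qed.

Lemma primE f (a r : R) : continuous f -> a < 0 -> a < r ->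
  prim f r = \int[mu]_(x in `[a, r]) f x - \int[mu]_(x in `[a, 0]) f x.
Proof.
move=> cf a0 ar; rewrite /prim; case: ifPn => [r0|]; last rewrite -ltNge => r0.
- rewrite (_ : \int[mu]_(x in `[0, r]) f x = \int[mu]_(x in `]0, r]) f x); last first.
    rewrite Rintegral_itv_obnd_cbnd//.
    by apply: integrableS (continuous_integrable 0 r cf) => //; exact: subset_itv_oc_cc.
  apply/esym; apply: (@Rintegral_itvB R f (BLeft a) (BRight r) 0).
  + exact: continuous_integrable.
  + by rewrite bnd_simp ltW.
  + by rewrite bnd_simp.
- rewrite (_ : \int[mu]_(x in `[r, 0]) f x = \int[mu]_(x in `]r, 0]) f x); last first.
    rewrite Rintegral_itv_obnd_cbnd//.
    by apply: integrableS (continuous_integrable r 0 cf) => //; exact: subset_itv_oc_cc.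
  apply/eqP; rewrite eqr_oppLR opprB; apply/eqP/esym.
  apply: (@Rintegral_itvB R f (BLeft a) (BRight 0) r).
  + exact: continuous_integrable.
  + by rewrite bnd_simp ltW.
  + by rewrite bnd_simp ltW.
Qed.

(** Near x, the function prim f differs by a constant from the integral with a left
    end below both x and 0, to which the fundamental theorem of calculus applies. *)
Lemma is_derive_prim f x : continuous f -> is_derive x (1 : R) (prim f) (f x).
Proof.
move=> cf; set a := - `|x| - 1.
have a0 : a < 0 by rewrite /a; have := normr_ge0 x; lra.
have ax : a < x by rewrite /a; have := ler_norm (- x); rewrite normrN; lra.
pose F y := \int[mu]_(t in `[a, y]) f t.
have [dF F'] : derivable F x 1 /\ derive1 F x = f x.
  apply: (@continuous_FTC1_closed R f a x (x + 1)) => //; first by rewrite ltrDl.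
  - exact: continuous_integrable.
  - exact: cf.
have iF : is_derive x (1 : R) F (f x).
  by rewrite -F' derive1E; exact: derivableP.
have dF0 : is_derive x (1 : R) (F - cst (F 0)) (f x - 0) by exact: is_deriveB.
rewrite subr0 in dF0.
apply: (@near_eq_is_derive _ _ _ (fun y => F y - F 0)) dF0.
near=> y; rewrite (@primE f a)//.
 by near: y; exact: lt_nbhsr.
Unshelve. all: by end_near. Qed.

End RealDerivatives.

Section ComplexDerivatives.
Variable R : realType.
Local Notation C := R[i].
Implicit Types (f g F G : R -> C) (c l : C).
Notation mu := (@lebesgue_measure R).

(** R[i] is normed over itself: the derivative along the real line is taken
    componentwise. *)
Definition cder f (x : R) l : Prop :=
  is_derive x (1 : R) (fun t => Re (f t)) (Re l) /\
  is_derive x (1 : R) (fun t => Im (f t)) (Im l).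

Definition ccont f := forall x : R, (f t : C^o) @[t --> x] --> (f x : C^o).

Lemma cder_eq f x l l' : cder f x l -> l = l' -> cder f x l'.
Proof. by move=> h <-. Qed.

Lemma cder_cst c x : cder (fun=> c) x 0.
Proof. by split => /=; exact: is_derive_cst. Qed.

Lemma cderD f g x l l' : cder f x l -> cder g x l' ->
  cder (fun t => f t + g t) x (l + l').
Proof.
move=> [h1 h2] [h3 h4]; split; rewrite ?Re_D ?Im_D.
- have -> : (fun t => Re (f t + g t)) = (fun t => Re (f t)) + (fun t => Re (g t)).
    by apply/funext => t; rewrite Re_D.
  exact: is_deriveD.
- have -> : (fun t => Im (f t + g t)) = (fun t => Im (f t)) + (fun t => Im (g t)).
    by apply/funext => t; rewrite Im_D.
  exact: is_deriveD.
Qed.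

Lemma is_deriveM_eq (f g : R -> R) (x df dg : R) :
  is_derive x (1 : R) f df -> is_derive x (1 : R) g dg ->
  is_derive x (1 : R) (fun t => f t * g t) (f x * dg + g x * df).
Proof. by move=> h1 h2; exact: (@is_deriveM R R^o f g x 1 df dg h1 h2). Qed.

Lemma cderM f g x l l' : cder f x l -> cder g x l' ->
  cder (fun t => f t * g t) x (l * g x + f x * l').
Proof.
move=> [h1 h2] [h3 h4]; split.
- have -> : (fun t => Re (f t * g t)) =
    (fun t => Re (f t) * Re (g t)) - (fun t => Im (f t) * Im (g t)).
    by apply/funext => t; rewrite Re_M.
  apply: (is_derive_val (is_deriveB (is_deriveM_eq h1 h3) (is_deriveM_eq h2 h4))).
  rewrite !ReImE; ring.
- have -> : (fun t => Im (f t * g t)) =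
    (fun t => Re (f t) * Im (g t)) + (fun t => Im (f t) * Re (g t)).
    by apply/funext => t; rewrite Im_M.
  apply: (is_derive_val (is_deriveD (is_deriveM_eq h1 h4) (is_deriveM_eq h2 h3))).
  rewrite !ReImE; ring.
Qed.

Lemma cderMl c f x l : cder f x l -> cder (fun t => c * f t) x (c * l).
Proof. by move=> h; apply: cder_eq (cderM (cder_cst c x) h) _; rewrite mul0r add0r. Qed.

Lemma cderN f x l : cder f x l -> cder (fun t => - f t) x (- l).
Proof.
move=> h; have := cderMl (-1) h; rewrite mulN1r.
by under [fun t => -1 * f t]funext do rewrite mulN1r.
Qed.

Lemma cderB f g x l l' : cder f x l -> cder g x l' ->
  cder (fun t => f t - g t) x (l - l').
Proof. by move=> h1 h2; apply: cderD => //; exact: cderN. Qed.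

Lemma cder_real (f : R -> R) (x l : R) : is_derive x (1 : R) f l ->
  cder (fun t => (f t)%:C) x l%:C.
Proof. by move=> h; split => //=; exact: is_derive_cst. Qed.

Lemma cder_comp f (g : R -> R) (x dg : R) l :
  is_derive x (1 : R) g dg -> cder f (g x) l -> cder (fun t => f (g t)) x (dg%:C * l).
Proof.
move=> hg [h1 h2]; split.
- rewrite Re_M /= mul0r subr0 mulrC.
  exact: (@is_derive1_comp R (fun t => Re (f t)) g x _ _ h1 hg).
- rewrite Im_M /= mul0r addr0 mulrC.
  exact: (@is_derive1_comp R (fun t => Im (f t)) g x _ _ h2 hg).
Qed.

Lemma is_derive_affine (a b x : R) : is_derive x (1 : R) (fun t => a * t + b) a.
Proof.
have -> : (fun t => a * t + b) = (a *: id) + cst b by [].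
by apply: is_derive_val; rewrite /GRing.scale /= mulr1 addr0.
Qed.

Lemma cder_cexp (f : R -> C) x l : cder f x l ->
  cder (fun t => cexp (f t)) x (l * cexp (f x)).
Proof.
move=> [h1 h2]; split.
- have -> : (fun t => Re (cexp (f t))) =
     (fun t => expR (Re (f t)) * cos (Im (f t))).
    by apply/funext => t; rewrite Re_cexp.
  apply: (is_derive_val (is_deriveM_eq
    (@is_derive1_comp R expR (fun t => Re (f t)) x _ _ (is_derive_expR _) h1)
    (@is_derive1_comp R (@cos R) (fun t => Im (f t)) x _ _ (is_derive_cos _) h2))).
  by rewrite /comp Re_M Re_cexp Im_cexp /=; ring.
- have -> : (fun t => Im (cexp (f t))) =
     (fun t => expR (Re (f t)) * sin (Im (f t))).
    by apply/funext => t; rewrite Im_cexp.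
  apply: (is_derive_val (is_deriveM_eq
    (@is_derive1_comp R expR (fun t => Re (f t)) x _ _ (is_derive_expR _) h1)
    (@is_derive1_comp R (@sin R) (fun t => Im (f t)) x _ _ (is_derive_sin _) h2))).
  by rewrite /comp Im_M Re_cexp Im_cexp /=; ring.
Qed.

Lemma cder_expM c x : cder (fun t => cexp (c * t%:C)) x (c * cexp (c * x%:C)).
Proof.
apply: cder_cexp; apply: cder_eq (cderMl c (cder_real (is_derive_id x 1))) _.
by rewrite mulr1.
Qed.

Lemma cder_cont f x l : cder f x l -> (f t : C^o) @[t --> x] --> (f x : C^o).
Proof.
by move=> [/is_derive_continuous h1 /is_derive_continuous h2]; apply/cvgC_parts.
Qed.

Lemma ccont_Re f : ccont f -> continuous (fun t => Re (f t)).
Proof. by move=> cf x; have /cvgC_parts[] := cf x. Qed.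

Lemma ccont_Im f : ccont f -> continuous (fun t => Im (f t)).
Proof. by move=> cf x; have /cvgC_parts[] := cf x. Qed.

Lemma ccont_cst c : ccont (fun=> c).
Proof. by move=> x; exact: cvg_cst. Qed.

Lemma ccontM f g : ccont f -> ccont g -> ccont (fun t => f t * g t).
Proof. by move=> cf cg x; exact: (cvgM (cf x) (cg x)). Qed.

Lemma ccontD f g : ccont f -> ccont g -> ccont (fun t => f t + g t).
Proof. by move=> cf cg x; exact: (@cvgD _ C^o _ _ _ _ _ _ _ (cf x) (cg x)). Qed.

Lemma ccont_real (f : R -> R) : continuous f -> ccont (fun t => (f t)%:C).
Proof. by move=> cf x; apply: cvgC_real; exact: cf. Qed.

Lemma ccont_expM c : ccont (fun t => cexp (c * t%:C)).
Proof. by move=> x; apply: cder_cont; exact: cder_expM. Qed.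

Lemma cder0_eq f (a b : R) : a <= b -> (forall x, a <= x <= b -> cder f x 0) -> f b = f a.
Proof.
move=> ab h; apply: complex_eq.
- by apply: (derive0_eq (f := fun t => Re (f t)) ab) => x /h[].
- by apply: (derive0_eq (f := fun t => Im (f t)) ab) => x /h[].
Qed.

Definition cprim f (r : R) : C :=
  prim (fun t => Re (f t)) r +i* prim (fun t => Im (f t)) r.

Lemma cprim_0 f : cprim f 0 = 0.
Proof. by rewrite /cprim !prim0. Qed.

Lemma cder_cprim f x : ccont f -> cder (cprim f) x (f x).
Proof.
by move=> cf; split => /=; apply: is_derive_prim; [exact: ccont_Re|exact: ccont_Im].
Qed.

Lemma cprimE f (t : R) : 0 <= t -> cprim f t = cintegral mu `[0, t] f.
Proof. by move=> t0; rewrite /cprim /prim t0. Qed.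

(** The difference between F and the primitive has a vanishing derivative. *)
Lemma cprim_unique f F (t : R) : ccont f -> 0 <= t ->
  (forall x, 0 <= x <= t -> cder F x (f x)) -> cprim f t = F t - F 0.
Proof.
move=> cf t0 h.
have := @cder0_eq (fun x => F x - cprim f x) 0 t t0.
rewrite cprim_0 subr0 => <-; first by rewrite opprB addrC subrK.
by move=> x xt; rewrite -(subrr (f x)); apply: cderB; [exact: h|exact: cder_cprim].
Qed.

Lemma cder0_cst f (a b : R) : (forall x, cder f x 0) -> f b = f a.
Proof.
move=> h; case: (leP a b) => [ab|/ltW ba]; first exact: cder0_eq.
by apply/esym; exact: cder0_eq.
Qed.

Lemma cprim_uniqueT f F (t : R) : ccont f ->
  (forall x, cder F x (f x)) -> cprim f t = F t - F 0.
Proof.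
move=> cf h.
have := @cder0_cst (fun x => F x - cprim f x) 0 t.
rewrite cprim_0 subr0 => <-; first by rewrite opprB addrC subrK.
by move=> x; rewrite -(subrr (f x)); apply: cderB; [exact: h|exact: cder_cprim].
Qed.

Lemma cprimD f g (t : R) : ccont f -> ccont g ->
  cprim (fun x => f x + g x) t = cprim f t + cprim g t.
Proof.
move=> cf cg.
rewrite (@cprim_uniqueT _ (fun x => cprim f x + cprim g x)).
- by rewrite !cprim_0 addr0 subr0.
- exact: ccontD.
- by move=> x; apply: cderD; exact: cder_cprim.
Qed.

Lemma cprimM c f (t : R) : ccont f -> cprim (fun x => c * f x) t = c * cprim f t.
Proof.
move=> cf; rewrite (@cprim_uniqueT _ (fun x => c * cprim f x)).
- by rewrite cprim_0 mulr0 subr0.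
- exact/ccontM/cf/ccont_cst.
- by move=> x; apply: cderMl; exact: cder_cprim.
Qed.

End ComplexDerivatives.

(** * Relaxation of the fractional covariance *)

Section Relaxation.
Variable R : realType.
Local Notation C := R[i].
Implicit Types (f g h : R -> C) (c : C).
Notation mu := (@lebesgue_measure R).

Lemma cexpNV (z : C) : cexp (- z) = (cexp z)^-1.
Proof. by apply: (mulIf (cexp_neq0 z)); rewrite cexpN mulVf// cexp_neq0. Qed.

Lemma real_complexD (x y : R) : (x + y)%:C = x%:C + y%:C.
Proof. exact: rmorphD. Qed.
Lemma real_complexB (x y : R) : (x - y)%:C = x%:C - y%:C.
Proof. exact: rmorphB. Qed.
Lemma real_complexM (x y : R) : (x * y)%:C = x%:C * y%:C.
Proof. exact: rmorphM. Qed.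

Lemma cexp_lin c (x y : R) : cexp (c * (x - y)%:C) = cexp (c * x%:C) / cexp (c * y%:C).
Proof. by rewrite real_complexB mulrBr cexpD cexpNV. Qed.

(** The value at time t of the solution of u' = c u + h' with u(0) = h(0), after
    an integration by parts that removes the derivative of h. *)
Definition relax c h (t : R) : C :=
  h t + c * cexp (c * t%:C) * cprim (fun v => cexp (- c * v%:C) * h v) t.

Lemma ccont_expm c h : ccont h -> ccont (fun v : R => cexp (- c * v%:C) * h v).
Proof. by move=> ch; exact: (ccontM (@ccont_expM R (- c)) ch). Qed.

Lemma relaxD c f g t : ccont f -> ccont g ->
  relax c (fun v => f v + g v) t = relax c f t + relax c g t.
Proof.
move=> cf cg; rewrite /relax.
under [X in cprim X]funext do rewrite mulrDr.
by rewrite cprimD; [ring|exact: ccont_expm|exact: ccont_expm].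
Qed.

Lemma relaxZ c k f t : ccont f -> relax c (fun v => k * f v) t = k * relax c f t.
Proof.
move=> cf; rewrite /relax.
under [X in cprim X]funext do rewrite mulrCA.
by rewrite cprimM; [ring|exact: ccont_expm].
Qed.

Lemma relax1 c t : relax c (fun=> 1) t = cexp (c * t%:C).
Proof.
rewrite /relax; under [X in cprim X]funext do rewrite mulr1.
have -> : c * cexp (c * t%:C) * cprim (fun v : R => cexp (- c * v%:C)) t
        = cexp (c * t%:C) * - cprim (fun v : R => - c * cexp (- c * v%:C)) t.
  by rewrite cprimM; [ring|exact: ccont_expM].
rewrite (@cprim_uniqueT _ _ (fun v => cexp (- c * v%:C))); last 2 first.
- by apply: ccontM; [exact: ccont_cst|exact: ccont_expM].
- by move=> x; exact: cder_expM.
rewrite mulr0 cexp0 mulNr cexpNV; field; exact: cexp_neq0.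
Qed.

End Relaxation.

Section FractionalKernel.
Variable R : realType.
Local Notation C := R[i].
Variable s : R.
Hypothesis s_gt0 : 0 < s.
Implicit Types (f g h : R -> C) (c p a b : C).

Definition phi (v : R) : R := `|v| `^ s.

Lemma phiE v : phi v = `|v| `^ s. Proof. by []. Qed.

Lemma phi_ge0 v : 0 <= phi v. Proof. exact: powR_ge0. Qed.

Lemma phi0 : phi 0 = 0. Proof. by rewrite /phi normr0 powR0// gt_eqF. Qed.

Lemma phiN v : phi (- v) = phi v. Proof. by rewrite /phi normrN. Qed.

Lemma phi_mono (x y : R) : 0 <= x -> x <= y -> phi x <= phi y.
Proof.
move=> x0 xy; have y0 := le_trans x0 xy.
by rewrite /phi !ger0_norm// ge0_ler_powR// ltW.
Qed.

Lemma is_derive_phi (x : R) : 0 < x -> is_derive x (1 : R) phi (s * x `^ (s - 1)).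
Proof.
move=> x0; apply: (@near_eq_is_derive _ _ _ (fun y => y `^ s)) (is_derive1_powR _ x0).
near=> y.
have y0 : 0 < y by near: y; exact: lt_nbhsr.
by rewrite /phi ger0_norm// ltW.
Unshelve. all: by end_near. Qed.

Lemma phi_cont : continuous phi.
Proof.
move=> x; rewrite /continuous_at.
have [x0|x0|->] := ltgtP x 0.
- have -> : phi = phi \o -%R by apply/funext => y /=; rewrite phiN.
  apply: continuous_comp; first exact: opp_continuous.
  by apply: is_derive_continuous; apply: is_derive_phi; rewrite oppr_gt0.
- by apply: is_derive_continuous; apply: is_derive_phi.
- rewrite phi0; apply/cvgrPdist_lt => e e0.
  have d0 : 0 < e `^ s^-1 by exact: powR_gt0.
  near=> t.
  have td : `|t| < e `^ s^-1.
    near: t; have := @nbhsx_ballx _ _ (0 : R) _ d0.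
    by apply: filterS => t; rewrite /ball /= sub0r normrN.
  rewrite sub0r normrN (ger0_norm (phi_ge0 _)).
  have -> : e = (e `^ s^-1) `^ s by rewrite -powRrM mulVf ?gt_eqF// powRr1// ltW.
  by apply: gt0_ltr_powR => //; rewrite nnegrE// ltW.
Unshelve. all: by end_near. Qed.

Lemma ccont_phi : ccont (fun v => (phi v)%:C).
Proof. by apply: ccont_real; exact: phi_cont. Qed.

(** The Laplace transform of phi truncated at time r; lap below is its limit for
    large r. The complete and incomplete gamma functions are all expressed through
    these two. *)
Definition tlap p (r : R) : C := cprim (fun v => cexp (- p * v%:C) * (phi v)%:C) r.

Lemma tlapE p r : tlap p r = cprim (fun v => cexp (- p * v%:C) * (phi v)%:C) r.
Proof. by []. Qed.

Lemma cder_tlap p r : cder (tlap p) r (cexp (- p * r%:C) * (phi r)%:C).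
Proof. by apply: cder_cprim; apply: ccont_expm; exact: ccont_phi. Qed.

Lemma tlap0 p : tlap p 0 = 0. Proof. exact: cprim_0. Qed.

Lemma ccont_tlap p : ccont (tlap p).
Proof. by move=> x; exact: cder_cont (cder_tlap p x). Qed.

Lemma is_derive_opp_shift (t x : R) : is_derive x (1 : R) (fun v => t - v) (-1).
Proof.
have := is_derive_affine (-1) t x.
by under [fun _ => -1 * _ + _]funext do rewrite mulN1r addrC.
Qed.

Lemma is_derive_shiftB (t x : R) : is_derive x (1 : R) (fun v => v - t) 1.
Proof.
have := is_derive_affine 1 (- t) x.
by under [fun _ => 1 * _ + _]funext do rewrite mul1r.
Qed.

Lemma ccont_phi_opp t : ccont (fun w => (phi (t - w))%:C).
Proof.
apply: ccont_real => y.
apply: (@continuous_comp _ _ _ (fun w => t - w) phi); last exact: phi_cont.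
by apply: is_derive_continuous; exact: is_derive_opp_shift.
Qed.

Lemma tlapN p r : tlap p (- r) = - tlap (- p) r.
Proof.
have := @cder0_cst _ (fun x => tlap p (0 - x) + tlap (- p) x) 0 r.
rewrite !sub0r oppr0 !tlap0 addr0 => /(_ _)/eqP; rewrite addr_eq0 => h; apply/eqP/h.
move=> x.
have := cderD (@cder_comp _ _ _ _ _ _ (is_derive_opp_shift 0 x) (cder_tlap p (0 - x)))
  (cder_tlap (- p) x).
move=> /cder_eq; apply.
rewrite !sub0r phiN (_ : - p * (- x)%:C = - - p * x%:C); last first.
  by rewrite [(- x)%:C]rmorphN; ring.
rewrite rmorphN rmorph1; ring.
Qed.

(** A shift of the integration variable by v turns the integral into an increment of
    tlap b, whose part at negative times is given by tlapN. *)
Lemma relax_phi b (v x : R) :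
  relax b (fun y => (phi (v - y))%:C) x =
  (phi (v - x))%:C + b * (cexp (b * x%:C) / cexp (b * v%:C) *
     (tlap (- b) v + tlap b (x - v))).
Proof.
rewrite /relax; congr (_ + _); rewrite -!mulrA; congr (_ * (_ * _)).
rewrite (@cprim_uniqueT _ _ (fun y => (cexp (b * v%:C))^-1 * tlap b (y - v))).
- by rewrite sub0r tlapN; field; rewrite !cexp_neq0.
- exact/ccont_expm/ccont_phi_opp.
- move=> y.
  apply: cder_eq (cderMl _ (cder_comp (is_derive_shiftB v y) (cder_tlap b (y - v)))) _.
  rewrite mul1r !mulNr !cexpNV cexp_lin -phiN opprB; field.
  by rewrite !cexp_neq0.
Qed.

(** The memory part of relax_phi, as a function of v. *)
Definition memory b (t v : R) : C :=
  cexp (b * t%:C) / cexp (b * v%:C) * (tlap (- b) v + tlap b (t - v)).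

Local Opaque tlap phi cprim.

Lemma cder_memory b (t v : R) :
  cder (memory b t) v (- b * memory b t v + cexp (b * t%:C) * (phi v)%:C - (phi (t - v))%:C).
Proof.
rewrite /memory.
have h1 : cder (fun y => cexp (b * t%:C) / cexp (b * y%:C)) v
     (- b * (cexp (b * t%:C) / cexp (b * v%:C))).
  under [fun _ => _ / _]funext do rewrite -cexpNV -mulNr.
  by apply: cder_eq (cderMl _ (cder_expM (- b) v)) _; rewrite (mulNr b v%:C) cexpNV; ring.
have h2 := cderD (cder_tlap (- b) v)
  (cder_comp (is_derive_opp_shift t v) (cder_tlap b (t - v))).
apply: cder_eq (cderM h1 h2) _.
rewrite !mulNr !opprK !cexpNV cexp_lin rmorphN rmorph1; field.
by rewrite !cexp_neq0.
Qed.

Lemma ccont_memory b t : ccont (memory b t).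
Proof. by move=> x; exact: cder_cont (cder_memory b t x). Qed.

(** By cder_memory, the derivative of e^(-av) memory(v) is - (a + b) times the
    integrand plus two integrands whose primitives are known. *)
Lemma cprim_memory a b (t t' : R) :
  (a + b) * cprim (fun v => cexp (- a * v%:C) * memory b t' v) t =
  memory b t' 0 - cexp (- a * t%:C) * memory b t' t + cexp (b * t'%:C) * tlap a t
  - cexp (- a * t'%:C) * (tlap (- a) t' - tlap (- a) (t' - t)).
Proof.
rewrite -cprimM; last by apply: ccont_expm; exact: ccont_memory.
rewrite (@cprim_uniqueT _ _ (fun v => - (cexp (- a * v%:C) * memory b t' v)
   + cexp (b * t'%:C) * tlap a v + cexp (- a * t'%:C) * tlap (- a) (t' - v))).
- by rewrite !tlap0 !subr0 !mulr0 cexp0; ring.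
- by apply: ccontM; [exact: ccont_cst|apply: ccont_expm; exact: ccont_memory].
- move=> v; apply: cder_eq.
    apply: cderD; first apply: cderD.
    + by apply: cderN; apply: cderM; [exact: cder_expM|exact: cder_memory].
    + by apply: cderMl; exact: cder_tlap.
    + by apply: cderMl; apply: cder_comp (is_derive_opp_shift t' v) (cder_tlap _ _).
  rewrite !mulNr !opprK !cexpNV cexp_lin rmorphN rmorph1; field.
  by rewrite !cexp_neq0.
Qed.

Definition Rcov (v w : R) : R := (phi v + phi w - phi (v - w)) / 2.

(** The covariance of two relaxations of a fractional Brownian motion, at times t
    and t'; see relaxed_cov. *)
Definition relax2 a b (t t' : R) : C := relax a (fun v => relax b (fun w => (Rcov v w)%:C) t') t.

Lemma relax_Rcov b v t' : relax b (fun w => (Rcov v w)%:C) t' =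
  2^-1 * (cexp (b * t'%:C) * (phi v)%:C + relax b (fun w => (phi w)%:C) t' * 1
     - ((phi (t' - v))%:C + b * memory b t' v)).
Proof.
have -> : (fun w => (Rcov v w)%:C) = (fun w => 2^-1 * (phi v)%:C * 1 +
    (2^-1 * (phi w)%:C + (- 2^-1) * (phi (v - w))%:C)).
  apply/funext => w; rewrite /Rcov rmorphM rmorphB rmorphD fmorphV rmorph_nat; ring.
have cs := ccont_phi_opp (t:=v).
have c1 := ccontM (@ccont_cst R 2^-1) ccont_phi.
have c2 := ccontM (@ccont_cst R (- 2^-1)) cs.
have c0 := @ccont_cst R (2^-1 * (phi v)%:C).
have c3 := @ccont_cst R 1.
rewrite (relaxD b t' (ccontM c0 c3) (ccontD c1 c2)) (relaxD b t' c1 c2).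
rewrite (relaxZ b _ t' c3) (relaxZ b _ t' ccont_phi) (relaxZ b _ t' cs).
rewrite relax1 relax_phi -(phiN (t' - v)) opprB /memory; ring.
Qed.

Lemma ccont_relax_Rcov b t' : ccont (fun v => relax b (fun w => (Rcov v w)%:C) t').
Proof.
under [fun _ => relax _ _ _]funext do rewrite relax_Rcov.
apply: ccontM; first exact: ccont_cst.
apply: ccontD; first apply: ccontD.
- by apply: ccontM; [exact: ccont_cst|exact: ccont_phi].
- exact: ccont_cst.
- under [fun _ => - _]funext do rewrite -mulN1r.
  apply: ccontM; first exact: ccont_cst.
  apply: ccontD; first exact: ccont_phi_opp.
  by apply: ccontM; [exact: ccont_cst|exact: ccont_memory].
Qed.

(** By linearity the double relaxation splits along the three terms of Rcov. The
    first two separate the times; the one in v - w couples them, through the memory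
    and its integral cprim_memory. *)
Lemma relax2E a b (t t' : R) : a + b != 0 ->
  relax2 a b t t' = 2^-1 * (cexp (b * t'%:C) * relax a (fun v => (phi v)%:C) t
     + relax b (fun w => (phi w)%:C) t' * cexp (a * t%:C)
     - ((phi (t' - t))%:C + b * memory b t' t
        + a * (cexp (a * t%:C) * cexp (- a * t'%:C) * (tlap (- a) t' - tlap (- a) (t' - t)))
        + a * b / (a + b) * (cexp (a * t%:C) * memory b t' 0 - memory b t' t
            + cexp (b * t'%:C) * (cexp (a * t%:C) * tlap a t)
            - cexp (a * t%:C) * cexp (- a * t'%:C) * (tlap (- a) t' - tlap (- a) (t' - t))))).
Proof.
move=> ab0; rewrite /relax2.
have -> : (fun v => relax b (fun w => (Rcov v w)%:C) t') =
  (fun v => 2^-1 * cexp (b * t'%:C) * (phi v)%:C +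
     (2^-1 * relax b (fun w => (phi w)%:C) t' * 1 +
      (- 2^-1 * (phi (t' - v))%:C + - (2^-1 * b) * memory b t' v))).
  by apply/funext => v; rewrite relax_Rcov; ring.
have c1 := ccontM (@ccont_cst R (2^-1 * cexp (b * t'%:C))) ccont_phi.
have c2 := ccontM (@ccont_cst R (2^-1 * relax b (fun w => (phi w)%:C) t')) (@ccont_cst R 1).
have c3 := ccontM (@ccont_cst R (- 2^-1)) (ccont_phi_opp (t:=t')).
have c4 := ccontM (@ccont_cst R (- (2^-1 * b))) (@ccont_memory b t').
rewrite (relaxD a t c1 (ccontD c2 (ccontD c3 c4))) (relaxD a t c2 (ccontD c3 c4)).
rewrite (relaxD a t c3 c4) (relaxZ a _ t ccont_phi) (relaxZ a _ t (ccont_phi_opp (t:=t'))).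
rewrite (relaxZ a _ t (@ccont_memory b t')) (relaxZ a _ t (@ccont_cst R 1)).
rewrite relax1 (relax_phi a t').
have -> : relax a (memory b t') t = memory b t' t + a * cexp (a * t%:C) / (a + b) *
  ((a + b) * cprim (fun v => cexp (- a * v%:C) * memory b t' v) t).
  by rewrite /relax; field.
rewrite cprim_memory.
have -> : tlap a (t - t') = - tlap (- a) (t' - t) by rewrite -tlapN opprB.
rewrite !mulNr !cexpNV; field.
by rewrite !cexp_neq0 ab0.
Qed.

End FractionalKernel.

Local Transparent tlap phi cprim.

(** * Decay and Laplace transforms *)

Section Decay.
Variable R : realType.
Local Notation C := R[i].
Notation mu := (@lebesgue_measure R).

(** Half of the exponential rate absorbs a polynomial growth. The degree 3 covers
    phi s and v phi s v for s <= 2. *)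
Lemma cubic_le_expR (a v : R) : 0 < a -> 0 <= v ->
  (1 + v) ^+ 3 * expR (- a * v) <= (1 + 6 / a) ^+ 3 * expR (- (a / 2) * v).
Proof.
move=> a0 v0.
have h6 : 0 <= 6 / a by rewrite divr_ge0// ltW.
have h7 : 0 <= a / 6 * v by rewrite mulr_ge0// divr_ge0// ltW.
have h1 : 1 + v <= (1 + 6 / a) * expR (a / 6 * v).
  apply: (@le_trans _ _ ((1 + 6 / a) * (1 + a / 6 * v))).
    rewrite -subr_ge0 (_ : _ - _ = 6 / a + a / 6 * v); last by field; rewrite gt_eqF.
    exact: addr_ge0.
  by rewrite ler_wpM2l ?expR_ge1Dx// addr_ge0.
have -> : expR (- (a / 2) * v) = expR (a / 6 * v) ^+ 3 * expR (- a * v).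
  by rewrite -expRM_natl -expRD; congr expR; field.
rewrite mulrA ler_wpM2r ?expR_ge0// -exprMn lerXn2r// ?nnegrE ?addr_ge0//.
by rewrite (le_trans _ h1)// addr_ge0.
Qed.

Lemma expR_decay (a : R) : 0 < a -> expR (- a * t) @[t --> +oo] --> (0 : R).
Proof.
move=> a0.
have -> : (fun t => expR (- a * t)) = (fun x => expR (- x)) \o (fun t : R => a * t).
  by apply/funext => t /=; rewrite mulNr.
apply: cvg_comp; last exact: cvgr_expR.
exact: gt0_cvgMry.
Qed.

Lemma cubic_decay (a : R) : 0 < a ->
  (1 + t) ^+ 3 * expR (- a * t) @[t --> +oo] --> (0 : R).
Proof.
move=> a0.
have a20 : 0 < a / 2 by rewrite divr_gt0.
have h : (1 + 6 / a) ^+ 3 * expR (- (a / 2) * t) @[t --> +oo] --> (0 : R).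
  by rewrite -[X in _ --> X](mulr0 ((1 + 6 / a) ^+ 3)); apply: cvgMr (expR_decay a20).
apply: (squeeze_cvgr _ (cvg_cst 0) h); near=> t.
have t0 : 0 <= t by near: t; exact: nbhs_pinfty_ge.
by rewrite cubic_le_expR// andbT mulr_ge0 ?expR_ge0// exprn_ge0// addr_ge0.
Unshelve. all: by end_near. Qed.

Lemma squeeze_cabs (f : R -> C) (g : R -> R) :
  (forall t, 0 <= t -> cabs (f t) <= g t) -> g t @[t --> +oo] --> (0 : R) ->
  (f t : C^o) @[t --> +oo] --> (0 : C^o).
Proof.
move=> fg g0; apply/cvgC_cabs.
apply: (squeeze_cvgr _ (cvg_cst 0) g0); near=> t.
have t0 : 0 <= t by near: t; exact: nbhs_pinfty_ge.
by rewrite subr0 cabs_ge0 fg.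
Unshelve. all: by end_near. Qed.

Lemma integrable_expR (K a x : R) : 0 < a -> 0 <= K ->
  mu.-integrable `[x, +oo[ (EFin \o (fun v => K * expR (- a * v))) /\
  \int[mu]_(v in `[x, +oo[) (K * expR (- a * v)) = K / a * expR (- a * x).
Proof.
move=> a0 K0.
pose F v := - (K / a) * expR (- a * v).
have dF v : is_derive v (1 : R) F (K * expR (- a * v)).
  have h := is_derive_affine (- a) 0 v.
  rewrite /F; under [fun _ => _ * expR _]funext do rewrite -[X in expR X]addr0.
  apply: (is_derive_val (is_deriveM_eq (is_derive_cst (- (K / a)) v 1)
    (@is_derive1_comp R expR (fun t => - a * t + 0) v _ _ (is_derive_expR _) h))).
  by rewrite /cst/= mulr0 !addr0; field; rewrite gt_eqF.
have cf : continuous (fun v => K * expR (- a * v)).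
  move=> v; apply: cvgM; first exact: cvg_cst.
  apply: continuous_comp; last exact: continuous_expR.
  by apply: cvgM; [exact: cvg_cst|exact: cvg_id].
have E : (\int[mu]_(v in `[x, +oo[) (K * expR (- a * v))%:E = 0%:E - (F x)%:E)%E.
  apply: ge0_continuous_FTC2y.
  - by move=> v _; rewrite mulr_ge0 ?expR_ge0.
  - exact: continuous_subspaceT.
  - rewrite /F -[X in _ --> X](mulr0 (- (K / a))); apply: cvgMr; exact: expR_decay.
  - by move=> v _; have [] := dF v.
  - by apply: cvg_at_right_filter; exact: is_derive_continuous (dF x).
  - by move=> v _; rewrite derive1E; have [] := dF v.
split; last by rewrite /Rintegral E /= /F; ring.
apply/integrableP; split.
  by apply/measurable_EFinP; apply: measurable_funTS; apply: continuous_measurable_fun.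
under eq_integral do rewrite /= ger0_norm ?mulr_ge0 ?expR_ge0//.
by rewrite E -EFinB ltry.
Qed.

(** The remainder of the integral after time t is at most the integral of
    K e^(-av) over [t, +oo[. *)
Lemma exp_dominated (f : R -> R) (K a : R) : continuous f -> 0 < a -> 0 <= K ->
  (forall v, 0 <= v -> `|f v| <= K * expR (- a * v)) ->
  mu.-integrable `[0, +oo[ (EFin \o f) /\
  prim f t @[t --> +oo] --> \int[mu]_(v in `[0, +oo[) f v.
Proof.
move=> cf a0 K0 fle.
have int0 x : 0 <= x -> mu.-integrable `[x, +oo[ (EFin \o f).
  move=> x0; have [iK _] := integrable_expR x a0 K0.
  apply: le_integrable iK => //.
    by apply/measurable_EFinP; apply: measurable_funTS; apply: continuous_measurable_fun.
  move=> v /=; rewrite in_itv/= andbT => xv; rewrite lee_fin.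
  by rewrite (le_trans (fle _ (le_trans x0 xv)))// ler_norm.
split; first exact: int0.
have h : K / a * expR (- a * t) @[t --> +oo] --> (0 : R).
  by rewrite -[X in _ --> X](mulr0 (K / a)); apply: cvgMr (expR_decay a0).
apply/cvgrPdist_lt => e e0.
move/cvgr0Pnorm_lt : h => /(_ _ e0) h.
near=> t.
have t0 : 0 <= t by near: t; exact: nbhs_pinfty_ge.
apply: (@le_lt_trans _ _ `|K / a * expR (- a * t)|); last by near: t.
rewrite /prim t0.
rewrite (@Rintegral_itvB R f (BLeft 0) (BInfty _ false) t) ?bnd_simp ?int0//.
have iot : mu.-integrable `]t, +oo[ (EFin \o f).
  by apply: integrableS (int0 _ t0) => //; by move=> v /=; rewrite !in_itv/= !andbT; exact: ltW.
rewrite Rintegral_itv_obnd_cbnd//.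
apply: (le_trans (le_normr_Rintegral _ (int0 _ t0))) => //.
have [iK IK] := integrable_expR t a0 K0.
rewrite -IK (le_trans _ (ler_norm _))//; apply: le_Rintegral => //.
- exact: integrable_norm (int0 _ t0).
- move=> v /=; rewrite in_itv/= andbT => tv; exact: fle (le_trans t0 tv).
Unshelve. all: by end_near. Qed.

Lemma prim_le (f : R -> R) (t M : R) : 0 <= t -> continuous f ->
  (forall x, 0 <= x <= t -> `|f x| <= M) -> `|prim f t| <= M * t.
Proof.
move=> t0 cf fM; rewrite /prim t0.
have cI := continuous_integrable 0 t cf.
apply: (le_trans (le_normr_Rintegral _ cI)) => //.
have -> : M * t = \int[mu]_(x in `[0, t]) M.
  rewrite Rintegral_cst//= lebesgue_measure_itv /= lte_fin.
  case: ltgtP t0 => // [_ _|<-] /=; first by rewrite oppr0 addr0.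
  by rewrite mulr0.
apply: le_Rintegral => //.
- exact: integrable_norm cI.
- by apply: continuous_integrable; exact: cst_continuous.
Qed.

Lemma cprim_le (f : R -> C) (t M : R) : 0 <= t -> ccont f ->
  (forall x, 0 <= x <= t -> cabs (f x) <= M) -> cabs (cprim f t) <= 2 * M * t.
Proof.
move=> t0 cf fM; rewrite (le_trans (ler_cabs _))//= -mulrA mulr_natl mulr2n.
apply: lerD; apply: prim_le => //.
- exact: ccont_Re.
- by move=> x xt; rewrite (le_trans (ler_Re_cabs _))// fM.
- exact: ccont_Im.
- by move=> x xt; rewrite (le_trans (ler_Im_cabs _))// fM.
Qed.

End Decay.

Local Opaque cprim.

Section Laplace.
Variable R : realType.
Local Notation C := R[i].
Notation mu := (@lebesgue_measure R).
Variable s : R.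
Hypotheses (s_gt0 : 0 < s) (s_le3 : s <= 3).
Local Notation phi := (phi s).
Local Notation tlap := (tlap s).

Lemma phi_le_pow (n : nat) (v : R) : s <= n%:R -> 0 <= v -> phi v <= (1 + v) ^+ n.
Proof.
move=> sn v0; rewrite phiE ger0_norm//.
apply: (@le_trans _ _ ((1 + v) `^ s)).
  by rewrite ge0_ler_powR ?nnegrE// ?addr_ge0// ?lerDr// ltW.
rewrite -powR_mulrn ?addr_ge0//.
by apply: ler_powR => //; rewrite lerDl.
Qed.

Lemma phi_le_cube (v : R) : 0 <= v -> phi v <= (1 + v) ^+ 3.
Proof. exact: phi_le_pow. Qed.

Definition lap (p : C) : C :=
  cintegral mu `[0, +oo[ (fun v => cexp (- p * v%:C) * (phi v)%:C).

Lemma cabs_laplace (p : C) (v : R) :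
  cabs (cexp (- p * v%:C) * (phi v)%:C) = expR (- Re p * v) * phi v.
Proof.
rewrite cabsM cabs_cexp cabs_real ger0_norm ?phi_ge0//; congr (expR _ * _).
by rewrite !ReImE /=; ring.
Qed.

Lemma laplace_le (p : C) (v : R) : 0 < Re p -> 0 <= v ->
  cabs (cexp (- p * v%:C) * (phi v)%:C) <= (1 + 6 / Re p) ^+ 3 * expR (- (Re p / 2) * v).
Proof.
move=> p0 v0; rewrite cabs_laplace; apply: le_trans (cubic_le_expR p0 v0).
by rewrite mulrC ler_wpM2r ?expR_ge0// phi_le_cube.
Qed.

Lemma cvg_tlap (p : C) : 0 < Re p -> (tlap p t : C^o) @[t --> +oo] --> (lap p : C^o).
Proof.
move=> p0.
have cf := @ccont_expm R p _ (ccont_phi s_gt0).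
have p20 : 0 < Re p / 2 by rewrite divr_gt0.
have K0 : 0 <= (1 + 6 / Re p) ^+ 3 by rewrite exprn_ge0// addr_ge0// divr_ge0// ltW.
apply/cvgC_parts; split.
- have [|_ h] := exp_dominated (ccont_Re cf) p20 K0; last exact: h.
  by move=> v v0; rewrite (le_trans (ler_Re_cabs _))// laplace_le.
- have [|_ h] := exp_dominated (ccont_Im cf) p20 K0; last exact: h.
  by move=> v v0; rewrite (le_trans (ler_Im_cabs _))// laplace_le.
Qed.

End Laplace.

Section LongTime.
Variable R : realType.
Local Notation C := R[i].
Notation mu := (@lebesgue_measure R).
Variable s : R.
Hypotheses (s_gt0 : 0 < s) (s_le2 : s <= 2).
Local Notation phi := (phi s).
Local Notation tlap := (tlap s).
Local Notation lap := (lap s).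

Let s_le3 : s <= 3. Proof. by apply: le_trans s_le2 _; rewrite ler_nat. Qed.

Lemma v_phi_le_cube (v : R) : 0 <= v -> v * phi v <= (1 + v) ^+ 3.
Proof.
move=> v0; rewrite exprS ler_pM// ?phi_ge0//; first by rewrite lerDr.
exact: phi_le_pow.
Qed.

(** For Re c < 0 the factor e^(ct) compensates the growth of e^(-cv) on [0, t], and
    only the growth of phi is left. *)
Lemma cabs_exp_tlap (c : C) (t : R) : Re c < 0 -> 0 <= t ->
  cabs (cexp (c * t%:C) * tlap c t) <= 2 * (1 + t) ^+ 3.
Proof.
move=> c0 t0.
have cf := @ccont_expm R c _ (ccont_phi s_gt0).
rewrite tlapE -cprimM//.
apply: (le_trans (@cprim_le R _ _ (phi t) t0 (ccontM (@ccont_cst R _) cf) _)).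
  move=> x /andP[x0 xt]; rewrite cabsM cabs_cexp cabs_laplace mulrA -expRD.
  rewrite -[leRHS]mul1r ler_pM ?phi_ge0 ?expR_ge0 ?phi_mono//.
  rewrite -expR0 ler_expR (_ : _ + _ = Re c * (t - x)); last by rewrite !ReImE /=; ring.
  by rewrite nmulr_rle0// subr_ge0.
by rewrite -mulrA (mulrC (phi t)) ler_wpM2l// v_phi_le_cube.
Qed.

Lemma cabs_relax_phi (c : C) (t : R) : Re c < 0 -> 0 <= t ->
  cabs (relax c (fun v => (phi v)%:C) t) <= (1 + cabs c * 2) * (1 + t) ^+ 3.
Proof.
move=> c0 t0; rewrite /relax (le_trans (cabsD _ _))// mulrDl mul1r lerD//.
  by rewrite cabs_real ger0_norm ?phi_ge0// phi_le_cube.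
rewrite -mulrA cabsM -mulrA ler_wpM2l ?cabs_ge0//.
exact: cabs_exp_tlap.
Qed.

Lemma cabs_cexp_real (c : C) (t : R) : cabs (cexp (c * t%:C)) = expR (Re c * t).
Proof. by rewrite cabs_cexp Re_M /= mulr0 subr0. Qed.

Lemma cube_shift (t tau : R) : 0 <= t -> 0 <= tau ->
  (1 + (t + tau)) ^+ 3 <= (1 + tau) ^+ 3 * (1 + t) ^+ 3.
Proof.
move=> t0 tau0; rewrite -exprMn lerXn2r ?nnegrE ?mulr_ge0 ?addr_ge0//.
by have := mulr_ge0 t0 tau0; lra.
Qed.

Variables (a b : C) (tau : R).
Hypotheses (a_lt0 : Re a < 0) (b_lt0 : Re b < 0) (tau_ge0 : 0 <= tau).

(** What is left of the memory integrals for large t, at a fixed lag tau. *)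
Definition Ilim (c : C) : C := cexp (- c * tau%:C) * (lap (- c) - tlap (- c) tau).
Definition Elim (c : C) : C := cexp (c * tau%:C) * (lap (- c) + tlap c tau).

Let Nb_cvg (c : C) : Re c < 0 -> (tlap (- c) t : C^o) @[t --> +oo] --> (lap (- c) : C^o).
Proof. by move=> c0; apply: (cvg_tlap s_gt0 s_le3); rewrite Re_N oppr_gt0. Qed.

Let decay (c : C) (f : R -> C) (K : R) : Re c < 0 ->
  (forall t, 0 <= t -> cabs (f t) <= K * ((1 + t) ^+ 3 * expR (Re c * t))) ->
  (f t : C^o) @[t --> +oo] --> (0 : C^o).
Proof.
move=> c0 h; apply: squeeze_cabs h _.
rewrite -[X in _ --> X](mulr0 K); apply: cvgMr.
by rewrite -[Re c]opprK; apply: cubic_decay; rewrite oppr_gt0.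
Qed.

Lemma cvg_shift (f : R -> C) (l : C) : (f t : C^o) @[t --> +oo] --> (l : C^o) ->
  (f (t + tau) : C^o) @[t --> +oo] --> (l : C^o).
Proof.
move=> h; apply: (cvg_comp (fun t => t + tau) f) h.
exact: cvg_addrr.
Qed.

(** In relax2E the terms that keep a factor e^(at) or e^(bt) decay, by the cubic
    bounds above; the memory terms depend on t through tlap only. *)
Lemma cvg_relax2 : (relax2 s a b t (t + tau) : C^o) @[t --> +oo] -->
  (2^-1 * (0 + 0 - ((phi tau)%:C + b * Elim b + a * Ilim a
      + a * b / (a + b) * (0 - Elim b + 0 - Ilim a))) : C^o).
Proof.
have ab0 : a + b != 0.
  apply/eqP => /(congr1 (@complex.Re R)) /=; rewrite Re_D => h.
  by move: a_lt0 b_lt0 h => ? ? /=; lra.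
have -> : (fun t => relax2 s a b t (t + tau) : C^o) = (fun t =>
   2^-1 * (cexp (b * (t + tau)%:C) * relax a (fun v => (phi v)%:C) t
     + relax b (fun w => (phi w)%:C) (t + tau) * cexp (a * t%:C)
     - ((phi tau)%:C + b * (cexp (b * tau%:C) * (tlap (- b) t + tlap b tau))
        + a * (cexp (- a * tau%:C) * (tlap (- a) (t + tau) - tlap (- a) tau))
        + a * b / (a + b) * (cexp (a * t%:C) * (cexp (b * (t + tau)%:C) * tlap b (t + tau))
            - (cexp (b * tau%:C) * (tlap (- b) t + tlap b tau))
            + cexp (b * (t + tau)%:C) * (cexp (a * t%:C) * tlap a t)
            - cexp (- a * tau%:C) * (tlap (- a) (t + tau) - tlap (- a) tau))))).
  apply/funext => t; rewrite (relax2E s_gt0 t (t + tau) ab0).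
  have -> : t + tau - t = tau by ring.
  have -> : memory s b (t + tau) t = cexp (b * tau%:C) * (tlap (- b) t + tlap b tau).
    rewrite /memory; have -> : t + tau - t = tau by ring.
    by rewrite -cexp_lin; have -> : t + tau - t = tau by ring.
  have -> : memory s b (t + tau) 0 = cexp (b * (t + tau)%:C) * tlap b (t + tau).
    by rewrite /memory mulr0 cexp0 divr1 tlap0 add0r subr0.
  have -> : cexp (a * t%:C) * cexp (- a * (t + tau)%:C) = cexp (- a * tau%:C).
    by rewrite -cexpD; congr cexp; rewrite real_complexD; ring.
  by [].
have E_cvg : ((cexp (b * tau%:C) * (tlap (- b) t + tlap b tau)) : C^o) @[t --> +oo] -->
    (Elim b : C^o).
  apply: cvgCMl; apply: cvgCD; first exact: Nb_cvg.
  exact: cvgC_cst.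
have I_cvg : ((cexp (- a * tau%:C) * (tlap (- a) (t + tau) - tlap (- a) tau)) : C^o)
    @[t --> +oo] --> (Ilim a : C^o).
  apply: cvgCMl; apply: cvgCB; last exact: cvgC_cst.
  by apply: cvg_shift; exact: Nb_cvg.
have expR_le1 (c : C) (t : R) : Re c < 0 -> 0 <= t -> expR (Re c * t) <= 1.
  by move=> c0 t0; rewrite -expR0 ler_expR nmulr_rle0.
have X1 : ((cexp (b * (t + tau)%:C) * relax a (fun v => (phi v)%:C) t) : C^o) @[t --> +oo]
    --> (0 : C^o).
  apply: (@decay b _ (1 + cabs a * 2) b_lt0) => t t0.
  rewrite cabsM cabs_cexp_real [leLHS]mulrC [leRHS]mulrA.
  rewrite ler_pM ?cabs_ge0 ?expR_ge0//; first exact: cabs_relax_phi.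
  by rewrite mulrDr expRD -[leRHS]mulr1 ler_wpM2l ?expR_ge0// expR_le1.
have X2 : ((relax b (fun v => (phi v)%:C) (t + tau) * cexp (a * t%:C)) : C^o) @[t --> +oo]
    --> (0 : C^o).
  apply: (@decay a _ ((1 + cabs b * 2) * (1 + tau) ^+ 3) a_lt0) => t t0.
  rewrite cabsM cabs_cexp_real mulrA ler_wpM2r ?expR_ge0//.
  apply: (le_trans (cabs_relax_phi b_lt0 (addr_ge0 t0 tau_ge0))).
  by rewrite -mulrA ler_wpM2l ?cube_shift// addr_ge0// mulr_ge0// cabs_ge0.
have X3 : ((cexp (a * t%:C) * (cexp (b * (t + tau)%:C) * tlap b (t + tau))) : C^o)
    @[t --> +oo] --> (0 : C^o).
  apply: (@decay a _ (2 * (1 + tau) ^+ 3) a_lt0) => t t0.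
  rewrite cabsM cabs_cexp_real [leRHS]mulrA [leLHS]mulrC ler_wpM2r ?expR_ge0//.
  apply: (le_trans (cabs_exp_tlap b_lt0 (addr_ge0 t0 tau_ge0))).
  by rewrite -mulrA ler_wpM2l ?cube_shift.
have X4 : ((cexp (b * (t + tau)%:C) * (cexp (a * t%:C) * tlap a t)) : C^o)
    @[t --> +oo] --> (0 : C^o).
  apply: (@decay b _ 2 b_lt0) => t t0.
  rewrite cabsM cabs_cexp_real [leLHS]mulrC [leRHS]mulrA ler_pM ?cabs_ge0 ?expR_ge0//.
    exact: cabs_exp_tlap.
  by rewrite mulrDr expRD -[leRHS]mulr1 ler_wpM2l ?expR_ge0// expR_le1.
apply: cvgCMl; apply: cvgCB; first exact: cvgCD X1 X2.
apply: cvgCD.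
  apply: cvgCD; last exact: cvgCMl I_cvg.
  by apply: cvgCD; [exact: cvgC_cst|exact: cvgCMl E_cvg].
by apply: cvgCMl; apply: cvgCB I_cvg; apply: cvgCD X4; exact: cvgCB X3 E_cvg.
Qed.

End LongTime.

(** * Complex powers *)

Section ComplexPowers.
Variable R : realType.
Local Notation C := R[i].
Implicit Types z : C.

Definition clog z : C := ln (cabs z) +i* carg z.

Lemma cpowE z q : cpow z q = cexp (q%:C * clog z).
Proof.
by rewrite /cpow; congr cexp; apply: complex_eq; rewrite !ReImE /=; ring.
Qed.

Lemma cpowD z (q r : R) : cpow z (q + r) = cpow z q * cpow z r.
Proof. by rewrite !cpowE -cexpD real_complexD mulrDl. Qed.

Lemma Re_quot_itv z : z != 0 -> -1 <= Re z / cabs z <= 1.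
Proof.
rewrite -cabs_gt0 => z0; rewrite -ler_norml normrM normfV (ger0_norm (cabs_ge0 z)).
by rewrite ler_pdivrMr// mul1r ler_Re_cabs.
Qed.

Lemma cos_carg z : z != 0 -> cos (carg z) = Re z / cabs z.
Proof.
move=> z0; rewrite /carg; case: ifP => _; rewrite ?cosN acosK// in_itv/= Re_quot_itv//.
Qed.

Lemma sin_carg z : z != 0 -> sin (carg z) = Im z / cabs z.
Proof.
move=> z0; have r0 : 0 < cabs z by rewrite cabs_gt0.
have E : Num.sqrt (1 - (Re z / cabs z) ^+ 2) = `|Im z| / cabs z.
  have -> : 1 - (Re z / cabs z) ^+ 2 = (`|Im z| / cabs z) ^+ 2.
    rewrite !exprMn real_normK ?num_real// exprVn cabs_sqr.
    have : Re z ^+ 2 + Im z ^+ 2 != 0 by rewrite -cabs_sqr sqrf_eq0 gt_eqF.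
    by move=> h; field.
  by rewrite sqrtr_sqr ger0_norm// divr_ge0// ltW.
rewrite /carg; case: ifPn => [i0|]; rewrite ?sinN sin_acos ?Re_quot_itv// E.
  by rewrite ger0_norm.
by rewrite -ltNge => i0; rewrite ltr0_norm// mulNr opprK.
Qed.

Lemma cexp_clog z : z != 0 -> cexp (clog z) = z.
Proof.
move=> z0; have r0 : 0 < cabs z by rewrite cabs_gt0.
apply: complex_eq; rewrite ?Re_cexp ?Im_cexp /= lnK ?posrE//.
  by rewrite cos_carg// mulrC divfK// gt_eqF.
by rewrite sin_carg// mulrC divfK// gt_eqF.
Qed.

Lemma cpow1 z : z != 0 -> cpow z 1 = z.
Proof. by move=> z0; rewrite cpowE mul1r cexp_clog. Qed.

Lemma cpow_scale (r : R) z q : 0 < r -> z != 0 ->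
  cpow (r%:C * z) q = (r `^ q)%:C * cpow z q.
Proof.
move=> r0 z0; have zr : 0 < cabs z by rewrite cabs_gt0.
have rz : cabs (r%:C * z) = r * cabs z by rewrite cabsM cabs_real gtr0_norm.
rewrite !cpowE /powR gt_eqF// -cexp_real -cexpD; congr cexp.
have -> : clog (r%:C * z) = (ln r)%:C + clog z.
  rewrite /clog rz lnM ?posrE//.
  have -> : carg (r%:C * z) = carg z.
    rewrite /carg rz Re_M Im_M /= !mul0r subr0 addr0 pmulr_rge0//.
    have -> : r * Re z / (r * cabs z) = Re z / cabs z by field; rewrite !gt_eqF.
    by [].
  by apply: complex_eq; rewrite !ReImE /= ?add0r.
by rewrite mulrDr real_complexM.
Qed.

Lemma cpow_real (r q : R) : 0 < r -> cpow r%:C q = (r `^ q)%:C.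
Proof.
move=> r0; rewrite -[r%:C]mulr1 cpow_scale ?oner_neq0//.
have -> : cpow (1 : C) q = 1; last by rewrite mulr1.
rewrite cpowE (_ : clog 1 = 0) ?mulr0 ?cexp0//.
have c1 : cabs (1 : C) = 1 by have := cabs_real (1 : R); rewrite normr1.
by rewrite /clog /carg c1 ln1 /= lexx divr1 acos1.
Qed.

(** Unlike acos, this expression of the argument in the right half plane is visibly
    differentiable across the real axis. *)
Lemma carg_atan z : 0 < Re z -> carg z = atan (Im z / Re z).
Proof.
move=> a0; set y := Im z / Re z.
have E : Re z / cabs z = cos (atan y).
  rewrite cos_atan cabsE.
  have -> : Re z ^+ 2 + Im z ^+ 2 = Re z ^+ 2 * (1 + y ^+ 2).
    by rewrite /y; field; rewrite gt_eqF.
  have h : 0 < Num.sqrt (1 + y ^+ 2) by rewrite sqrtr_gt0 ltr_pwDl// sqr_ge0.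
  rewrite sqrtrM ?sqr_ge0// sqrtr_sqr gtr0_norm//; field.
  by rewrite !gt_eqF.
rewrite /carg E; case: ifPn => [i0|]; last rewrite -ltNge => i0.
- rewrite cosK// in_itv/=.
  have y0 : 0 <= y by rewrite divr_ge0// ltW.
  rewrite (le_trans (ltW (atan_ltpi2 _))) ?andbT; last first.
    by rewrite ler_pdivrMr// ler_peMr ?pi_ge0// ler1n.
  by rewrite -atan0 le_atan.
- have y0 : y <= 0 by rewrite /y pmulr_lle0 ?invr_gt0// ltW.
  rewrite cosKN ?opprK//; apply/andP; split.
    rewrite (le_trans _ (ltW (atan_gtNpi2 _)))// lerN2.
    by rewrite ler_pdivrMr// ler_peMr ?pi_ge0// ler1n.
  by rewrite -atan0 le_atan.
Qed.

Lemma cder_clog_vert (a y : R) : 0 < a ->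
  cder (fun t => clog (a +i* t)) y ((0 +i* 1) / (a +i* y)).
Proof.
move=> a0.
have w0 : 0 < a ^+ 2 + y ^+ 2 by rewrite ltr_pwDl ?exprn_gt0// sqr_ge0.
split.
- have h : is_derive y (1 : R) (fun t => a ^+ 2 + t * t) (y + y).
    apply: (is_derive_val (is_deriveD (is_derive_cst (a ^+ 2) y 1)
      (is_deriveM_eq (is_derive_id y 1) (is_derive_id y 1)))).
    by rewrite /= add0r !mulr1.
  have s0 : 0 < Num.sqrt (a ^+ 2 + y * y) by rewrite sqrtr_gt0 -expr2.
  have -> : (fun t => Re (clog (a +i* t))) =
     (@ln R) \o (Num.sqrt \o (fun t => a ^+ 2 + t * t)).
    by apply/funext => t; rewrite /clog cabsE /= -expr2.
  have w0' : 0 < a ^+ 2 + y * y by rewrite -expr2.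
  have h1 := @is_derive1_comp R Num.sqrt _ y _ _ (is_derive1_sqrt w0') h.
  apply: (is_derive_val (@is_derive1_comp R (@ln R) _ y _ _ (is_derive1_ln s0) h1)).
  rewrite /= -!expr2 in s0 *.
  have := sqr_sqrtr (ltW w0); set q := Num.sqrt _ in s0 *.
  move=> qE.
  rewrite (_ : q^-1 * _ = y / q ^+ 2); last by field; rewrite gt_eqF.
  rewrite qE; field; rewrite gt_eqF//.
- have h := is_derive_affine (a^-1) 0 y.
  have -> : (fun t => Im (clog (a +i* t))) = (@atan R) \o (fun t => a^-1 * t + 0).
    by apply/funext => t; rewrite /= carg_atan//= addr0 mulrC.
  apply: (is_derive_val (@is_derive1_comp R (@atan R) _ y _ _ (is_derive1_atan _) h)).
  rewrite /= addr0; field; rewrite !gt_eqF//.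
Qed.

End ComplexPowers.

(** * Improper integrals *)

(** Integrals over a set D exhausted by segments [a_n, b_n], for a function that may
    be unbounded near the ends of D: the fundamental theorem of calculus holds on
    each segment, and the limit is taken under the integral. *)
Section Exhaustion.
Variable R : realType.
Notation mu := (@lebesgue_measure R).
Variables (D : set R) (a_ b_ : nat -> R) (f F : R -> R).
Hypotheses (mD : measurable D) (ab : forall n, a_ n < b_ n)
  (abD : forall n, `[a_ n, b_ n] `<=` D)
  (Dab : forall x, D x -> \forall n \near \oo, a_ n <= x <= b_ n)
  (dF : forall x, D x -> is_derive x (1 : R) F (f x))
  (cf : forall x, D x -> {for x, continuous f})
  (mf : measurable_fun D f).

Let f_ (n : nat) := (f \_ `[a_ n, b_ n]).

Let mf_ n : measurable_fun D (f_ n).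
Proof. by apply/measurable_restrict => //; apply: measurable_funS mf => // x []. Qed.

Let int_f_ n : (\int[mu]_(x in D) (f_ n x)%:E = (F (b_ n) - F (a_ n))%:E)%E.
Proof.
have -> : (fun x => (f_ n x)%:E) = (EFin \o f) \_ `[a_ n, b_ n].
  by rewrite restrict_EFin.
rewrite -integral_mkcondr (_ : D `&` _ = [set` `[a_ n, b_ n]]); last first.
  by apply/seteqP; split => [x []//|x xI]; split => //; exact: abD xI.
rewrite (@continuous_FTC2 R f F)//.
- apply: continuous_in_subspaceT => x; rewrite inE => /abD; exact: cf.
- split.
  + by move=> x /subset_itv_oo_cc /abD /dF[].
  + apply: cvg_at_right_filter; apply: is_derive_continuous (dF _).
    by apply: (@abD n); rewrite /= in_itv/= lexx ltW.
  + apply: cvg_at_left_filter; apply: is_derive_continuous (dF _).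
    by apply: (@abD n); rewrite /= in_itv/= lexx ltW.
- by move=> x /subset_itv_oo_cc /abD /dF h; rewrite derive1E; case: h.
Qed.

Let cvg_f_ x : D x -> (f_ n x)%:E @[n --> \oo] --> (f x)%:E.
Proof.
move=> Dx; apply: cvg_near_cst; have := Dab Dx; apply: filterS => n xab.
by rewrite /f_ patchE ifT// inE.
Qed.

Lemma exhaust_integral (L : R) : mu.-integrable D (EFin \o f) ->
  F (b_ n) - F (a_ n) @[n --> \oo] --> L -> \int[mu]_(x in D) f x = L.
Proof.
move=> intf cvgL.
have f_le x n : D x -> (`|(f_ n x)%:E| <= `|(f x)%:E|)%E.
  by move=> Dx; rewrite /f_ /= patchE lee_fin; case: ifP => // _; rewrite normr0.
have f_cvg : {ae mu, forall x, D x -> (EFin \o f_ n) x @[n --> \oo] --> (EFin \o f) x}.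
  by apply: aeW => x; exact: cvg_f_.
have f_dom : {ae mu, forall x n, D x -> (`|(EFin \o f_ n) x| <= (abse \o (EFin \o f)) x)%E}.
  by apply: aeW => x n; exact: f_le.
have [_ _ h] := @dominated_convergence _ _ _ mu D mD (fun n => EFin \o f_ n) (EFin \o f)
  (abse \o (EFin \o f))
  (fun n => (measurable_EFinP _ _).2 (mf_ n)) ((measurable_EFinP _ _).2 mf)
  f_cvg (integrable_abse intf) f_dom.
rewrite /Rintegral.
have -> : (\int[mu]_(x in D) (f x)%:E = L%:E)%E; last by [].
apply: (@cvg_unique _ _ (fmap (fun n => (F (b_ n) - F (a_ n))%:E) \oo)) => //.
- by move: h; under eq_fun do rewrite /= int_f_.
- by apply: cvg_EFin => //; exact: nearW.
Qed.

(** Fatou's lemma bounds the integral of a nonnegative function by the limit of the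
    increments of its primitive. *)
Lemma exhaust_integrable (L : R) : (forall x, D x -> 0 <= f x) ->
  F (b_ n) - F (a_ n) @[n --> \oo] --> L -> mu.-integrable D (EFin \o f).
Proof.
move=> f0 cvgL; apply/integrableP; split; first exact/measurable_EFinP.
have -> : (\int[mu]_(x in D) `|(EFin \o f) x| =
    \int[mu]_(x in D) limn_einf (fun n => (f_ n x)%:E))%E.
  apply: eq_integral => x; rewrite inE => Dx.
  rewrite is_cvg_limn_einfE; last by apply/cvg_ex; eexists; exact: cvg_f_.
  by rewrite (cvg_lim _ (cvg_f_ Dx))//= ger0_norm ?f0.
apply: le_lt_trans (fatou mu mD (fun n => (measurable_EFinP _ _).2 (mf_ n)) _) _.
  move=> n x Dx; rewrite /f_ /= patchE lee_fin; case: ifPn => // _; exact: f0.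
under eq_fun do rewrite /= int_f_.
have h : (F (b_ n) - F (a_ n))%:E @[n --> \oo] --> L%:E by apply: cvg_EFin => //; exact: nearW.
rewrite is_cvg_limn_einfE; last by apply/cvg_ex; eexists; exact: h.
by rewrite (cvg_lim _ h)// ltry.
Qed.

End Exhaustion.

(** * Integrals of complex functions *)

Section ComplexIntegral.
Context d (T : measurableType d) (R : realType) (mu : {measure set T -> \bar R}).
Variables (D : set T) (mD : measurable D).
Local Notation C := R[i].
Implicit Types f g : T -> C.

Definition cintegrable f : Prop :=
  mu.-integrable D (EFin \o (fun x => Re (f x))) /\
  mu.-integrable D (EFin \o (fun x => Im (f x))).

Lemma eq_cintegral f g : (forall x, D x -> f x = g x) ->
  cintegral mu D f = cintegral mu D g.
Proof.
move=> fg; rewrite /cintegral; congr (_ +i* _); apply: eq_Rintegral => x;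
  by rewrite inE => /fg ->.
Qed.

Lemma eq_cintegrable f g : (forall x, D x -> f x = g x) ->
  cintegrable f -> cintegrable g.
Proof.
move=> fg [h1 h2]; split.
- by apply: eq_integrable h1 => // x; rewrite inE /= => /fg ->.
- by apply: eq_integrable h2 => // x; rewrite inE /= => /fg ->.
Qed.

Lemma integrableMl_cst (k : R) (f : T -> R) : mu.-integrable D (EFin \o f) ->
  mu.-integrable D (EFin \o (fun x => k * f x)).
Proof. by move=> h; have := integrableZl mD k h. Qed.

Lemma integrable_subR (f g : T -> R) : mu.-integrable D (EFin \o f) ->
  mu.-integrable D (EFin \o g) -> mu.-integrable D (EFin \o (fun x => f x - g x)).
Proof. by move=> hf hg; have := integrableB mD hf hg. Qed.

Lemma integrable_addR (f g : T -> R) : mu.-integrable D (EFin \o f) ->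
  mu.-integrable D (EFin \o g) -> mu.-integrable D (EFin \o (fun x => f x + g x)).
Proof. by move=> hf hg; have := integrableD mD hf hg. Qed.

Lemma cintegrableZ (k : C) f : cintegrable f -> cintegrable (fun x => k * f x).
Proof.
move=> [f1 f2]; split.
- under [X in _ \o X]funext do rewrite Re_M.
  by apply: integrable_subR; exact: integrableMl_cst.
- under [X in _ \o X]funext do rewrite Im_M.
  by apply: integrable_addR; exact: integrableMl_cst.
Qed.

Lemma cintegralD f g : cintegrable f -> cintegrable g ->
  cintegral mu D (fun x => f x + g x) = cintegral mu D f + cintegral mu D g.
Proof.
move=> [f1 f2] [g1 g2]; apply: complex_eq; rewrite ?Re_D ?Im_D /=.
- by rewrite -RintegralD//; apply: eq_Rintegral => x _; rewrite Re_D.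
- by rewrite -RintegralD//; apply: eq_Rintegral => x _; rewrite Im_D.
Qed.

Lemma cintegralZ (k : C) f : cintegrable f ->
  cintegral mu D (fun x => k * f x) = k * cintegral mu D f.
Proof.
move=> [f1 f2]; apply: complex_eq; rewrite ?Re_M ?Im_M /=.
- rewrite -!RintegralZl// -RintegralB//; [|exact: integrableMl_cst..].
  by apply: eq_Rintegral => x _; rewrite Re_M.
- rewrite -!RintegralZl// -RintegralD//; [|exact: integrableMl_cst..].
  by apply: eq_Rintegral => x _; rewrite Im_M.
Qed.

Lemma cintegral0 : cintegral mu D (fun=> 0) = 0.
Proof. by rewrite /cintegral /= /Rintegral integral0. Qed.

Lemma cintegrable_le f (g : T -> R) :
  measurable_fun D (fun x => Re (f x)) -> measurable_fun D (fun x => Im (f x)) ->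
  mu.-integrable D (EFin \o g) -> (forall x, D x -> cabs (f x) <= g x) -> cintegrable f.
Proof.
move=> m1 m2 ig fg; split.
- apply: le_integrable ig => //; first exact/measurable_EFinP.
  move=> x Dx /=; rewrite lee_fin (le_trans (ler_Re_cabs _))//.
  by rewrite (le_trans (fg _ Dx))// ler_norm.
- apply: le_integrable ig => //; first exact/measurable_EFinP.
  move=> x Dx /=; rewrite lee_fin (le_trans (ler_Im_cabs _))//.
  by rewrite (le_trans (fg _ Dx))// ler_norm.
Qed.

End ComplexIntegral.

(** * Gamma functions *)

Section GammaForms.
Variable R : realType.
Local Notation C := R[i].
Notation mu := (@lebesgue_measure R).
Variable s : R.
Hypotheses (s_gt0 : 0 < s).
Local Notation phi := (phi s).
Local Notation tlap := (tlap s).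
Local Notation lap := (lap s).
Implicit Types p z : C.

(** Up to a power of p, this is s times the integrand of the gamma functions along
    the direction p; see gamma_form_gform. *)
Definition gform p (u : R) : C := (s * u `^ (s - 1))%:C * cexp (- p * u%:C).

(** A primitive of gform obtained by parts: the singular factor s u^(s-1) is
    integrated into phi, so that gform_prim is continuous at 0. *)
Definition gform_prim p (u : R) : C := cexp (- p * u%:C) * (phi u)%:C + p * tlap p u.

Lemma cder_gform_prim p u : 0 < u -> cder (gform_prim p) u (gform p u).
Proof.
move=> u0; rewrite /gform_prim /gform.
have h1 := cderM (cder_expM (- p) u) (cder_real (is_derive_phi s u0)).
have h2 := cderMl p (cder_tlap s_gt0 p u).
by apply: cder_eq (cderD h1 h2) _; ring.
Qed.

Lemma ccont_gform_prim p : ccont (gform_prim p).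
Proof.
apply: ccontD; first by apply: ccontM; [exact: ccont_expM|exact: ccont_phi].
by apply: ccontM; [exact: ccont_cst|exact: ccont_tlap].
Qed.

Lemma gform_prim0 p : gform_prim p 0 = 0.
Proof. by rewrite /gform_prim tlap0 phi0// !mulr0 addr0. Qed.

Lemma gform_cont p (u : R) : 0 < u -> (gform p t : C^o) @[t --> u] --> (gform p u : C^o).
Proof.
move=> u0; apply: cvgCM; last exact: ccont_expM.
apply: cvgC_real; apply: cvgM; first exact: cvg_cst.
exact: (is_derive_continuous (is_derive1_powR _ u0)).
Qed.

Lemma measurable_cont (f : R -> R) (D : set R) : continuous f -> measurable_fun D f.
Proof. by move=> cf; apply: measurable_funTS; exact: continuous_measurable_fun. Qed.

Lemma measurable_gform p (D : set R) :
  measurable_fun D (fun u => Re (gform p u)) /\ measurable_fun D (fun u => Im (gform p u)).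
Proof.
have h : measurable_fun D (fun u : R => s * u `^ (s - 1)).
  apply: measurable_funM; first exact: measurable_cst.
  by apply: measurable_funTS; exact: measurable_powR.
split.
- under eq_fun do rewrite Re_M /= mul0r subr0.
  apply: measurable_funM => //; apply: measurable_cont; exact/ccont_Re/ccont_expM.
- under eq_fun do rewrite Im_M /= mul0r addr0.
  apply: measurable_funM => //; apply: measurable_cont; exact/ccont_Im/ccont_expM.
Qed.

Lemma cabs_gform p (u : R) : cabs (gform p u) = s * u `^ (s - 1) * expR (- Re p * u).
Proof.
rewrite cabsM cabs_real cabs_cexp_real Re_N ger0_norm//.
by rewrite mulr_ge0 ?powR_ge0// ltW.
Qed.

Lemma gform_real (q u : R) :
  gform q%:C u = (s * u `^ (s - 1) * expR (- q * u))%:C.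
Proof.
rewrite /gform [RHS]real_complexM -cexp_real; congr (_ * cexp _).
by rewrite real_complexM rmorphN.
Qed.

Section Exhausted.
Variables (D : set R) (a_ b_ : nat -> R).
Hypotheses (mD : measurable D) (D0 : D `<=` `]0, +oo[) (ab : forall n, a_ n < b_ n)
  (abD : forall n, `[a_ n, b_ n] `<=` D)
  (Dab : forall x, D x -> \forall n \near \oo, a_ n <= x <= b_ n).

Let D_gt0 x : D x -> 0 < x.
Proof. by move=> /D0; rewrite /= in_itv/= andbT. Qed.

(** The modulus of gform p is gform (Re p), a nonnegative function: its
    integrability is read on the primitive. *)
Lemma gform_integrable (q : R) (L : C) :
  (gform_prim q%:C (b_ n) - gform_prim q%:C (a_ n) : C^o) @[n --> \oo] --> (L : C^o) ->
  mu.-integrable D (EFin \o (fun u => s * u `^ (s - 1) * expR (- q * u))).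
Proof.
move=> /cvgC_parts[h _].
have -> : (fun u => s * u `^ (s - 1) * expR (- q * u)) = (fun u => Re (gform q%:C u)).
  by apply/funext => u; rewrite gform_real.
have dF x : D x -> is_derive x (1 : R) (fun u => Re (gform_prim q%:C u)) (Re (gform q%:C x)).
  by move=> /D_gt0 x0; have [] := cder_gform_prim q%:C x0.
have cf x : D x -> {for x, continuous (fun u => Re (gform q%:C u))}.
  by move=> /D_gt0 x0; have /cvgC_parts[] := @gform_cont q%:C x x0.
have [mf _] := measurable_gform q%:C D.
have f0 x : D x -> 0 <= Re (gform q%:C x).
  move=> /D_gt0 x0; rewrite gform_real /=.
  by apply: mulr_ge0; [apply: mulr_ge0; [exact: ltW|exact: powR_ge0]|exact: expR_ge0].
have hL : Re (gform_prim q%:C (b_ n)) - Re (gform_prim q%:C (a_ n)) @[n --> \oo] --> Re L.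
  by under eq_cvg do rewrite -Re_B.
exact: (exhaust_integrable mD ab abD Dab dF cf mf f0 hL).
Qed.

Lemma gform_cintegral p (L : C) (g : R -> R) : mu.-integrable D (EFin \o g) ->
  (forall u, D u -> cabs (gform p u) <= g u) ->
  (gform_prim p (b_ n) - gform_prim p (a_ n) : C^o) @[n --> \oo] --> (L : C^o) ->
  cintegrable mu D (gform p) /\ cintegral mu D (gform p) = L.
Proof.
move=> ig le_g hL; have [m1 m2] := measurable_gform p D.
have ip : cintegrable mu D (gform p) by apply: cintegrable_le ig le_g.
split=> //; have [i1 i2] := ip; have /cvgC_parts[h1 h2] := hL.
apply: complex_eq.
- have dF x : D x -> is_derive x (1 : R) (fun u => Re (gform_prim p u)) (Re (gform p x)).
    by move=> /D_gt0 x0; have [] := cder_gform_prim p x0.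
  have cf x : D x -> {for x, continuous (fun u => Re (gform p u))}.
    by move=> /D_gt0 x0; have /cvgC_parts[] := @gform_cont p x x0.
  have hL' : Re (gform_prim p (b_ n)) - Re (gform_prim p (a_ n)) @[n --> \oo] --> Re L.
    by under eq_cvg do rewrite -Re_B.
  exact: (exhaust_integral mD ab abD Dab dF cf m1 i1 hL').
- have dF x : D x -> is_derive x (1 : R) (fun u => Im (gform_prim p u)) (Im (gform p x)).
    by move=> /D_gt0 x0; have [] := cder_gform_prim p x0.
  have cf x : D x -> {for x, continuous (fun u => Im (gform p u))}.
    by move=> /D_gt0 x0; have /cvgC_parts[] := @gform_cont p x x0.
  have hL' : Im (gform_prim p (b_ n)) - Im (gform_prim p (a_ n)) @[n --> \oo] --> Im L.
    by under eq_cvg do rewrite -Im_B.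
  exact: (exhaust_integral mD ab abD Dab dF cf m2 i2 hL').
Qed.

End Exhausted.

Lemma cvg_harm2 : (n.+2%:R^-1 : R) @[n --> \oo] --> (0 : R).
Proof.
have := @cvg_harmonic R; rewrite -(@cvg_shiftS _ (@harmonic R)).
by [].
Qed.

Lemma cvg_nat2 : (n.+2%:R : R) @[n --> \oo] --> +oo.
Proof.
have := @cvgr_idn R; rewrite -(@cvg_shiftn 2) => h.
have -> : (fun n => n.+2%:R : R) = (fun n => (n + 2)%:R) by apply/funext => n; rewrite addn2.
exact: h.
Qed.

Lemma inv_le_nat2 n : (n.+2%:R^-1 : R) < n.+2%:R.
Proof.
rewrite -[ltLHS]mul1r ltr_pdivrMr// (lt_le_trans (_ : _ < 2%:R * 2%:R))//.
  by rewrite -natrM ltr1n.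
by rewrite ler_pM// ler_nat.
Qed.

Lemma gform_prim_cvg0 p : (gform_prim p n.+2%:R^-1 : C^o) @[n --> \oo] --> (0 : C^o).
Proof.
rewrite -(gform_prim0 p); apply: (cvg_comp (fun n => n.+2%:R^-1) (gform_prim p) cvg_harm2).
exact: ccont_gform_prim.
Qed.

Section Intervals.
Hypothesis s_le3 : s <= 3.

Lemma gform_prim_cvgy p : 0 < Re p -> (gform_prim p n.+2%:R : C^o) @[n --> \oo] --> (p * lap p : C^o).
Proof.
move=> p0; rewrite -[p * lap p]add0r.
apply: (cvg_comp (fun n => n.+2%:R) (gform_prim p) cvg_nat2).
apply: cvgCD; last by apply: cvgCMl; exact: cvg_tlap.
have p20 : 0 < Re p / 2 by rewrite divr_gt0.
apply: (@squeeze_cabs _ _ (fun t => (1 + 6 / Re p) ^+ 3 * expR (- (Re p / 2) * t))).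
  by move=> t t0; exact: laplace_le.
rewrite -[X in _ --> X](mulr0 ((1 + 6 / Re p) ^+ 3)).
by apply: cvgMr; exact: expR_decay.
Qed.

Let near_ge (x : R) : \forall n \near \oo, x <= n.+2%:R.
Proof. by move/cvgryPge : cvg_nat2; apply. Qed.

Let near_le (x : R) : 0 < x -> \forall n \near \oo, n.+2%:R^-1 <= x.
Proof.
move=> x0; have /cvgrPdist_lt/(_ x x0) := cvg_harm2.
apply: filterS => n; rewrite sub0r normrN ger0_norm//; exact: ltW.
Qed.

Lemma gform_full_dom (q : R) : 0 < q ->
  mu.-integrable `]0, +oo[ (EFin \o (fun u => s * u `^ (s - 1) * expR (- q * u))).
Proof.
move=> q0.
apply: (@gform_integrable `]0, +oo[ (fun n => n.+2%:R^-1) (fun n => n.+2%:R) _ _ _ _ _ _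
  (q%:C * lap q%:C - 0)) => //.
- exact: inv_le_nat2.
- move=> n x /=; rewrite !in_itv/= andbT => /andP[+ _]; apply: lt_le_trans.
  by rewrite invr_gt0.
- move=> x /=; rewrite in_itv/= andbT => x0.
  by apply: filterS2 (near_ge x) (near_le x0) => n -> ->.
- by apply: cvgCB; [exact: gform_prim_cvgy|exact: gform_prim_cvg0].
Qed.

Lemma gform_full p : 0 < Re p ->
  cintegrable mu `]0, +oo[ (gform p) /\ cintegral mu `]0, +oo[ (gform p) = p * lap p.
Proof.
move=> p0.
apply: (@gform_cintegral `]0, +oo[ (fun n => n.+2%:R^-1) (fun n => n.+2%:R) _ _ _ _ _ _ _ _
  (gform_full_dom p0)) => //.
- exact: inv_le_nat2.
- move=> n x /=; rewrite !in_itv/= andbT => /andP[+ _]; apply: lt_le_trans.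
  by rewrite invr_gt0.
- move=> x /=; rewrite in_itv/= andbT => x0.
  by apply: filterS2 (near_ge x) (near_le x0) => n -> ->.
- by move=> u _; rewrite cabs_gform.
- rewrite -[p * lap p]subr0.
  by apply: cvgCB; [exact: gform_prim_cvgy|exact: gform_prim_cvg0].
Qed.

Lemma gform_tail p : 0 < Re p ->
  cintegrable mu `[1, +oo[ (gform p) /\
  cintegral mu `[1, +oo[ (gform p) = p * lap p - gform_prim p 1.
Proof.
move=> p0.
have sub : `[1, +oo[ `<=` `]0 : R, +oo[.
  by move=> x /=; rewrite !in_itv/= !andbT; apply: lt_le_trans.
have dom : mu.-integrable `[1, +oo[ (EFin \o (fun u => s * u `^ (s - 1) * expR (- Re p * u))).
  by apply: integrableS (gform_full_dom p0).
apply: (@gform_cintegral `[1, +oo[ (fun n => 1) (fun n => n.+2%:R) _ _ _ _ _ _ _ _ dom) => //.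
- by move=> n; rewrite ltr1n.
- by move=> n x /=; rewrite !in_itv/= andbT => /andP[].
- move=> x /=; rewrite in_itv/= andbT => x1.
  by apply: filterS (near_ge x) => n ->; rewrite x1.
- by move=> u _; rewrite cabs_gform.
- by apply: cvgCB; [exact: gform_prim_cvgy|exact: cvgC_cst].
Qed.

End Intervals.

Lemma gform_unit p :
  cintegrable mu `]0, 1] (gform p) /\ cintegral mu `]0, 1] (gform p) = gform_prim p 1.
Proof.
have near_le (x : R) : 0 < x -> \forall n \near \oo, n.+2%:R^-1 <= x.
  move=> x0; have /cvgrPdist_lt/(_ x x0) := cvg_harm2.
  by apply: filterS => n; rewrite sub0r normrN ger0_norm//; exact: ltW.
have sub : `]0, 1] `<=` `]0 : R, +oo[.
  by move=> x /=; rewrite !in_itv/= => /andP[->].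
have lt1 n : (n.+2%:R^-1 : R) < 1 by rewrite invf_lt1// ltr1n.
have inD n : `[n.+2%:R^-1, 1] `<=` `]0 : R, 1].
  move=> x /=; rewrite !in_itv/= => /andP[h ->]; rewrite andbT.
  by apply: lt_le_trans h; rewrite invr_gt0.
have nearD (x : R) : `]0, 1]%classic x -> \forall n \near \oo, n.+2%:R^-1 <= x <= 1.
  move=> /=; rewrite in_itv/= => /andP[x0 x1].
  by apply: filterS (near_le _ x0) => n ->.
(* on ]0, 1] the exponential is bounded and the modulus at p = 0 dominates *)
have dom : mu.-integrable `]0, 1] (EFin \o (fun u => s * u `^ (s - 1) * expR (- 0 * u))).
  apply: (@gform_integrable `]0, 1] (fun n => n.+2%:R^-1) (fun n => 1) _ sub lt1 inD nearD _
    (gform_prim (0 : R)%:C 1 - 0)) => //.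
  by apply: cvgCB; [exact: cvgC_cst|exact: gform_prim_cvg0].
apply: (@gform_cintegral `]0, 1] (fun n => n.+2%:R^-1) (fun n => 1) _ sub lt1 inD nearD _ _ _
  (integrableMl_cst _ (expR `|Re p|) dom)) => //.
- move=> u /=; rewrite in_itv/= => /andP[u0 u1].
  rewrite cabs_gform mulrC oppr0 mul0r expR0 mulr1 ler_wpM2r//.
    by rewrite mulr_ge0 ?powR_ge0// ltW.
  rewrite ler_expR (le_trans (ler_norm _))// normrM normrN.
  by rewrite ler_piMr// ger0_norm// ltW.
- have := cvgCB (@cvgC_cst R _ _ _ (gform_prim p 1)) (gform_prim_cvg0 p).
  by rewrite subr0; apply.
Qed.

End GammaForms.

Section LaplaceIdentities.
Variable R : realType.
Local Notation C := R[i].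
Notation mu := (@lebesgue_measure R).
Implicit Types p z : C.

Lemma powR_succ (r s : R) : 0 < r -> r `^ (s + 1) = r `^ s * r.
Proof.
by move=> r0; rewrite powRD ?(gt_eqF r0) ?implybT// powRr1// ltW.
Qed.

Lemma tlap_scale (s r x : R) z : 0 < s -> 0 < r ->
  tlap s z (r * x) = (r `^ (s + 1))%:C * tlap s (r%:C * z) x.
Proof.
move=> s0 r0.
have h := @cder0_cst R (fun x => tlap s z (r * x + 0) - (r `^ (s + 1))%:C * tlap s (r%:C * z) x) 0 x.
have : tlap s z (r * x + 0) - (r `^ (s + 1))%:C * tlap s (r%:C * z) x = 0.
  rewrite h; first by rewrite mulr0 addr0 !tlap0 mulr0 subr0.
  move=> y.
  have h1 := cder_comp (is_derive_affine r 0 y) (cder_tlap s0 z (r * y + 0)).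
  have h2 := cderMl (r `^ (s + 1))%:C (cder_tlap s0 (r%:C * z) y).
  apply: cder_eq (cderB h1 h2) _.
  have -> : phi s (r * y + 0) = r `^ s * phi s y.
    by rewrite addr0 /phi normrM gtr0_norm// powRM// ltW.
  have -> : r `^ (s + 1) = r `^ s * r.
    exact: powR_succ.
  have -> : - z * (r * y + 0)%:C = - (r%:C * z) * y%:C.
    by rewrite addr0 real_complexM; ring.
  by rewrite !real_complexM; ring.
by rewrite addr0 => /eqP; rewrite subr_eq0 => /eqP.
Qed.

(** The change of variable v = r w, in the limit of tlap_scale. *)
Lemma lap_scale (s r : R) z : 0 < s -> s <= 3 -> 0 < r -> 0 < Re z ->
  lap s z = (r `^ (s + 1))%:C * lap s (r%:C * z).
Proof.
move=> s0 s3 r0 z0.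
have h1 : (tlap s z (r * t) : C^o) @[t --> +oo] --> (lap s z : C^o).
  apply: (cvg_comp (fun t => r * t) (tlap s z)); last exact: cvg_tlap.
  exact: gt0_cvgMry.
have h2 : ((r `^ (s + 1))%:C * tlap s (r%:C * z) t : C^o) @[t --> +oo] -->
    ((r `^ (s + 1))%:C * lap s (r%:C * z) : C^o).
  by apply: cvgCMl; apply: cvg_tlap => //; rewrite Re_M /= mul0r subr0 mulr_gt0.
have E : (fun t => (r `^ (s + 1))%:C * tlap s (r%:C * z) t) = (fun t => tlap s z (r * t)).
  by apply/funext => t; rewrite tlap_scale.
move: h2; rewrite E => h2.
exact: (cvg_unique (@norm_hausdorff _ C^o) h1 h2).
Qed.

(** Integration by parts, in the form of gform_full at p = 1. *)
Lemma Gamma_lap (s : R) : 0 < s -> s <= 3 -> (s * Gamma s)%:C = lap s 1.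
Proof.
move=> s0 s3.
have p0 : 0 < Re (1 : C) by [].
have [[i1 _]] := gform_full s0 s3 p0.
have E u : gform s 1 u = (s * (u `^ (s - 1) * expR (- u)))%:C.
  by rewrite (gform_real s 1 u) mulN1r mulrA.
rewrite mul1r => <-; apply: complex_eq => /=.
- have h : mu.-integrable `]0, +oo[ (EFin \o (fun w => w `^ (s - 1) * expR (- w))).
    apply: eq_integrable (integrableMl_cst _ s^-1 i1) => //= u _.
    by rewrite E /= mulKf// gt_eqF.
  rewrite /Gamma -RintegralZl//.
  by apply: eq_Rintegral => u _; rewrite E.
- rewrite (_ : (fun x : R => Im (gform s 1 x)) = fun=> 0).
    by rewrite /Rintegral integral0.
  by apply/funext => u; rewrite E.
Qed.

(** Integration by parts again: gform with exponent s + 1 is (s + 1) times the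
    integrand of lap s. *)
Lemma lap_succ (s : R) p : 0 < s -> s <= 2 -> 0 < Re p ->
  (s + 1)%:C * lap s p = p * lap (s + 1) p.
Proof.
move=> s0 s2 p0.
have s10 : 0 < s + 1 by rewrite addr_gt0.
have s13 : s + 1 <= 3 by move: s2; lra.
have [_ <-] := gform_full s10 s13 p0.
have E u : 0 < u -> gform (s + 1) p u = (s + 1)%:C * (cexp (- p * u%:C) * (phi s u)%:C).
  by move=> u0; rewrite /gform addrK /phi gtr0_norm// real_complexM; ring.
have -> : cintegral mu `]0, +oo[ (gform (s + 1) p) = cintegral mu `]0, +oo[
    (fun u => (s + 1)%:C * (cexp (- p * u%:C) * (phi s u)%:C)).
  by apply: eq_cintegral => u /=; rewrite in_itv/= andbT => /E.
have p20 : 0 < Re p / 2 by rewrite divr_gt0.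
have K0 : 0 <= (1 + 6 / Re p) ^+ 3 by rewrite exprn_ge0// addr_ge0// divr_ge0// ltW.
have s3 : s <= 3 by move: s2; lra.
have cf := @ccont_expm R p _ (ccont_phi s0).
have [iK _] := integrable_expR 0 p20 K0.
have cI : cintegrable mu `[0, +oo[ (fun u => cexp (- p * u%:C) * (phi s u)%:C).
  apply: cintegrable_le iK _ => //.
  - exact: (measurable_cont (ccont_Re cf)).
  - exact: (measurable_cont (ccont_Im cf)).
  - by move=> u /=; rewrite in_itv/= andbT => u0; exact: laplace_le.
have cI' : cintegrable mu `]0, +oo[ (fun u => cexp (- p * u%:C) * (phi s u)%:C).
  have [h1 h2] := cI; split.
  - by apply: integrableS h1 => // u /=; rewrite !in_itv/= !andbT; exact: ltW.
  - by apply: integrableS h2 => // u /=; rewrite !in_itv/= !andbT; exact: ltW.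
rewrite cintegralZ//; congr (_ * _); rewrite /lap /cintegral.
by have [h1 h2] := cI'; rewrite -!Rintegral_itv_obnd_cbnd.
Qed.

(** Differentiation under the integral sign. On a vertical line the modulus of the
    integrand does not depend on the imaginary part of p, which provides the
    dominating function. *)
Lemma cder_lap_vert (s a y : R) : 0 < s -> s <= 2 -> 0 < a ->
  cder (fun t => lap s (a +i* t)) y (- (0 +i* 1) * lap (s + 1) (a +i* y)).
Proof.
move=> s0 s2 a0.
have s10 : 0 < s + 1 by rewrite addr_gt0.
have s13 : s + 1 <= 3 by move: s2; lra.
have s3 : s <= 3 by move: s2; lra.
pose g (t v : R) : C := cexp (- (a +i* t) * v%:C) * (phi s v)%:C.
pose dg (t v : R) : C := - (0 +i* 1) * (cexp (- (a +i* t) * v%:C) * (phi (s + 1) v)%:C).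
have dgP (t v : R) : 0 <= v -> cder (fun t => g t v) t (dg t v).
  move=> v0; rewrite /g /dg.
  have h0 : cder (fun t : R => (a +i* t)) t (0 +i* 1).
    by split => /=; [exact: is_derive_cst|exact: is_derive_id].
  have h1 := cder_cexp (cderM (cderN h0) (cder_cst v%:C t)).
  apply: cder_eq (cderM h1 (cder_cst (phi s v)%:C t)) _.
  have -> : phi (s + 1) v = v * phi s v.
    by rewrite /phi (ger0_norm v0) -mulr_powRB1// addrK.
  by rewrite real_complexM; ring.
have a20 : 0 < a / 2 by rewrite divr_gt0.
have K0 : 0 <= (1 + 6 / a) ^+ 3 by rewrite exprn_ge0// addr_ge0// divr_ge0// ltW.
have [iK _] := integrable_expR 0 a20 K0.
have gle (t v : R) : 0 <= v -> cabs (g t v) <= (1 + 6 / a) ^+ 3 * expR (- (a / 2) * v).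
  by move=> v0; exact: (@laplace_le R s s0 s3 (a +i* t)).
have dgle (t v : R) : 0 <= v -> cabs (dg t v) <= (1 + 6 / a) ^+ 3 * expR (- (a / 2) * v).
  move=> v0; rewrite /dg cabsM (_ : cabs (- (0 +i* 1) : C) = 1) ?mul1r; last first.
    by rewrite cabsE /= oppr0 expr0n sqrrN expr1n add0r sqrtr1.
  exact: (@laplace_le R (s + 1) s10 s13 (a +i* t)).
have gI t : cintegrable mu `[0, +oo[ (g t).
  have cf := @ccont_expm R (a +i* t) _ (ccont_phi s0).
  apply: cintegrable_le iK _ => //.
  - exact: (measurable_cont (ccont_Re cf)).
  - exact: (measurable_cont (ccont_Im cf)).
  - by move=> u /=; rewrite in_itv/= andbT => u0; exact: gle.
have dgI t : cintegrable mu `[0, +oo[ (fun v => cexp (- (a +i* t) * v%:C) * (phi (s + 1) v)%:C).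
  have cf := @ccont_expm R (a +i* t) _ (ccont_phi s10).
  apply: cintegrable_le iK _ => //.
  - exact: (measurable_cont (ccont_Re cf)).
  - exact: (measurable_cont (ccont_Im cf)).
  - move=> u /=; rewrite in_itv/= andbT => u0.
    exact: (@laplace_le R (s + 1) s10 s13 (a +i* t)).
have yI : `](y - 1), (y + 1)[%classic y by rewrite /= in_itv/= ltrDl ltrBlDr ltrDl ltr01.
have G0 v : 0 <= (1 + 6 / a) ^+ 3 * expR (- (a / 2) * v) by rewrite mulr_ge0 ?expR_ge0.
have main (P : C -> R) :
    (forall z, `|P z| <= cabs z) ->
    (forall t, mu.-integrable `[0, +oo[ (EFin \o (fun v => P (g t v)))) ->
    (forall t v, 0 <= v -> is_derive t (1 : R) (fun t => P (g t v)) (P (dg t v))) ->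
    is_derive y (1 : R) (fun t => \int[mu]_(v in `[0, +oo[) P (g t v))
      (\int[mu]_(v in `[0, +oo[) P (dg y v)).
  move=> Ple intP dP.
  pose f t v := P (g t v).
  have d1 t v : `[0, +oo[%classic v -> partial1of2 f t v = P (dg t v).
    rewrite /= in_itv/= andbT => v0.
    by rewrite partial1of2E; have [_ <-] := dP t v v0.
  have derf1 t v : `](y - 1), (y + 1)[%classic t -> `[0, +oo[%classic v ->
      derivable (f ^~ v) t 1.
    by rewrite /= !in_itv/= andbT => _ v0; have [] := dP t v v0.
  have G_ub t v : `](y - 1), (y + 1)[%classic t -> `[0, +oo[%classic v ->
      `|partial1of2 f t v| <= (1 + 6 / a) ^+ 3 * expR (- (a / 2) * v).
    move=> _ Dv; rewrite d1// (le_trans (Ple _))// dgle//.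
    by move: Dv; rewrite /= in_itv/= andbT.
  have mD : measurable (`[0, +oo[ : set R) by [].
  have D := @derivable_under_integral R _ _ mu f _ mD y _ _ yI (fun t _ => intP t) derf1 _
    G0 iK G_ub.
  have V := @differentiation_under_integral R _ _ mu f _ mD y _ _ yI (fun t _ => intP t) derf1 _
    G0 iK G_ub.
  apply: DeriveDef => //.
  rewrite -derive1E V; apply: eq_Rintegral => v; rewrite inE => Dv; exact: d1.
split.
- have h := main (@complex.Re R) (@ler_Re_cabs R) (fun t => (gI t).1) (fun t v v0 => (dgP t v v0).1).
  apply: (is_derive_val h).
  by rewrite -(cintegralZ _ _ (dgI y)).
- have h := main (@complex.Im R) (@ler_Im_cabs R) (fun t => (gI t).2) (fun t v v0 => (dgP t v v0).2).
  apply: (is_derive_val h).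
  by rewrite -(cintegralZ _ _ (dgI y)).
Qed.

(** The function p^(s+1) lap(p) is constant: on the positive half line by scaling,
    and on vertical lines because its derivative vanishes by lap_succ. This does the
    work of Cauchy's theorem when the ray of integration is rotated. *)
Lemma lap_rotation (s : R) p : 0 < s -> s <= 2 -> 0 < Re p ->
  cpow p (s + 1) * lap s p = lap s 1.
Proof.
move=> s0 s2; case: p => a y /= a0.
have s3 : s <= 3 by move: s2; lra.
have -> : lap s 1 = cpow (a +i* 0) (s + 1) * lap s (a +i* 0).
  have z1 : 0 < Re (1 : C) by [].
  by rewrite (lap_scale s0 s3 a0 z1) mulr1 complexr0 cpow_real.
have nz t : (a +i* t) != 0.
  by apply/eqP => /(congr1 (@complex.Re R)) /= h; rewrite h ltxx in a0.
apply: (@cder0_cst R (fun t => cpow (a +i* t) (s + 1) * lap s (a +i* t))) => t.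
have h1 := cder_cexp (cderMl (s + 1)%:C (cder_clog_vert t a0)).
under [fun t => cpow _ _ * _]funext do rewrite cpowE.
apply: cder_eq (cderM h1 (cder_lap_vert t s0 s2 a0)) _.
have := @lap_succ s (a +i* t) s0 s2 a0.
set G1 := lap (s + 1) _; set G := lap s _; set E := cexp _ => h.
have -> : (s + 1)%:C * ((0 +i* 1) / (a +i* t)) * E * G =
    (0 +i* 1) / (a +i* t) * E * ((s + 1)%:C * G) by ring.
rewrite h; field; exact: nz.
Qed.

(** This lemma, upper_term and lower_term express the three gamma functions of Pcov,
    multiplied by s z^(1-s), through phi, lap and tlap. The powers combine without a
    change of branch, as z^(1-s) (tau z)^s = tau^s z for tau > 0. *)
Lemma Gamma_term (s : R) z : 0 < s -> s <= 2 -> 0 < Re z ->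
  s%:C * (cpow z (1 - s) * (Gamma s)%:C) = z ^+ 2 * lap s z.
Proof.
move=> s0 s2 z0.
have s3 : s <= 3 by move: s2; lra.
have nz : z != 0 by apply/eqP => h; move: z0; rewrite h ltxx.
rewrite mulrCA -real_complexM Gamma_lap// -(lap_rotation s0 s2 z0) mulrA -cpowD.
have -> : 1 - s + (s + 1) = 1 + 1 by ring.
by rewrite cpowD cpow1.
Qed.

Lemma gamma_form_gform (s : R) z u : z != 0 -> 0 < u ->
  s%:C * gamma_form s z u = cpow z s * gform s z u.
Proof.
move=> nz u0; rewrite /gamma_form /gform cpow_scale//.
have -> : cpow z s = cpow z (s - 1) * z by rewrite -[X in _ * X]cpow1// -cpowD subrK.
have -> : - (u%:C * z) = - z * u%:C by ring.
by rewrite real_complexM; ring.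
Qed.

Lemma upper_term (s tau : R) z : 0 < s -> s <= 2 -> 0 <= tau -> 0 < Re z ->
  s%:C * (cpow z (1 - s) * upper_Gamma s (z * tau%:C)) =
  - z * (phi s tau)%:C * cexp (- z * tau%:C) + z ^+ 2 * (lap s z - tlap s z tau).
Proof.
move=> s0 s2 tau0 z0.
have s3 : s <= 3 by move: s2; lra.
have nz : z != 0 by apply/eqP => h; move: z0; rewrite h ltxx.
move: tau0; rewrite le_eqVlt => /predU1P[<-|tau0].
  rewrite mulr0 /upper_Gamma eqxx Gamma_term// phi0// tlap0; ring.
have tn0 : tau%:C != 0 by rewrite (inj_eq (@complexI R)) gt_eqF.
have w0 : z * tau%:C != 0 by rewrite mulf_neq0.
have rw0 : 0 < Re (z * tau%:C) by rewrite Re_M /= mulr0 subr0 mulr_gt0.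
have [cI I] := gform_tail s0 s3 rw0.
have sn0 : s%:C != 0 by rewrite (inj_eq (@complexI R)) gt_eqF.
have -> : upper_Gamma s (z * tau%:C) = s%:C^-1 * cpow (z * tau%:C) s *
    (z * tau%:C * lap s (z * tau%:C) - gform_prim s (z * tau%:C) 1).
  rewrite /upper_Gamma (negbTE w0) -I -cintegralZ//; apply: eq_cintegral => u.
  rewrite /= in_itv/= andbT => u1; have u0 : 0 < u by rewrite (lt_le_trans _ u1).
  by rewrite -mulrA -gamma_form_gform// mulKf.
have E : cpow z (1 - s) * cpow (z * tau%:C) s = (tau `^ s)%:C * z.
  by rewrite (mulrC z) cpow_scale// mulrCA -cpowD subrK cpow1.
have N1 : (tau `^ (s + 1))%:C * tlap s (z * tau%:C) 1 = tlap s z tau.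
  by rewrite (mulrC z) -tlap_scale// mulr1.
have G1 : (tau `^ (s + 1))%:C * lap s (z * tau%:C) = lap s z.
  by rewrite (mulrC z) -lap_scale.
have -> : s%:C * (cpow z (1 - s) * (s%:C^-1 * cpow (z * tau%:C) s *
    (z * tau%:C * lap s (z * tau%:C) - gform_prim s (z * tau%:C) 1))) =
  (cpow z (1 - s) * cpow (z * tau%:C) s) *
    (z * tau%:C * lap s (z * tau%:C) - gform_prim s (z * tau%:C) 1) by field.
have T : (tau `^ (s + 1))%:C = (tau `^ s)%:C * tau%:C.
  by rewrite -real_complexM powR_succ.
rewrite E /gform_prim -G1 -N1 T.
have -> : phi s 1 = 1 by rewrite /phi normr1 powR1.
have -> : phi s tau = tau `^ s by rewrite /phi gtr0_norm.
have -> : - (z * tau%:C) * 1%:C = - z * tau%:C by rewrite rmorph1; ring.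
by rewrite rmorph1; ring.
Qed.

Lemma lower_term (s tau : R) z : 0 < s -> 0 <= tau -> z != 0 ->
  s%:C * (cpow z (1 - s) * lower_gamma s (z * tau%:C)) =
  z * (phi s tau)%:C * cexp (- z * tau%:C) + z ^+ 2 * tlap s z tau.
Proof.
move=> s0 tau0 nz.
move: tau0; rewrite le_eqVlt => /predU1P[<-|tau0].
  rewrite phi0// tlap0 mulr0 (_ : lower_gamma s 0 = 0); first by ring.
  rewrite /lower_gamma (_ : gamma_form s 0 = fun=> 0) ?cintegral0//.
  by apply/funext => u; rewrite /gamma_form mulr0.
have tn0 : tau%:C != 0 by rewrite (inj_eq (@complexI R)) gt_eqF.
have w0 : z * tau%:C != 0 by rewrite mulf_neq0.
have [cI I] := gform_unit s0 (z * tau%:C).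
have sn0 : s%:C != 0 by rewrite (inj_eq (@complexI R)) gt_eqF.
have E0 u : `]0, 1]%classic u ->
    s%:C^-1 * cpow (z * tau%:C) s * gform s (z * tau%:C) u = gamma_form s (z * tau%:C) u.
  by rewrite /= in_itv/= => /andP[u0 _]; rewrite -mulrA -gamma_form_gform// mulKf.
have -> : lower_gamma s (z * tau%:C) = s%:C^-1 * cpow (z * tau%:C) s *
    gform_prim s (z * tau%:C) 1.
  have cI2 : cintegrable mu `]0, 1]
      (fun u => s%:C^-1 * cpow (z * tau%:C) s * gform s (z * tau%:C) u).
    exact: cintegrableZ.
  have [h1 h2] : cintegrable mu `]0, 1] (gamma_form s (z * tau%:C)).
    by apply: eq_cintegrable cI2.
  rewrite /lower_gamma /cintegral -!Rintegral_itv_obnd_cbnd//.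
  rewrite -/(cintegral mu `]0, 1] _) -I -cintegralZ//; apply: eq_cintegral => u Du.
  by rewrite E0.
have E : cpow z (1 - s) * cpow (z * tau%:C) s = (tau `^ s)%:C * z.
  by rewrite (mulrC z) cpow_scale// mulrCA -cpowD subrK cpow1.
have N1 : (tau `^ (s + 1))%:C * tlap s (z * tau%:C) 1 = tlap s z tau.
  by rewrite (mulrC z) -tlap_scale// mulr1.
have -> : s%:C * (cpow z (1 - s) * (s%:C^-1 * cpow (z * tau%:C) s *
    gform_prim s (z * tau%:C) 1)) =
  (cpow z (1 - s) * cpow (z * tau%:C) s) * gform_prim s (z * tau%:C) 1 by field.
have T : (tau `^ (s + 1))%:C = (tau `^ s)%:C * tau%:C.
  by rewrite -real_complexM powR_succ.
rewrite E /gform_prim -N1 T.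
have -> : phi s 1 = 1 by rewrite /phi normr1 powR1.
have -> : phi s tau = tau `^ s by rewrite /phi gtr0_norm.
have -> : - (z * tau%:C) * 1%:C = - z * tau%:C by rewrite rmorph1; ring.
by rewrite rmorph1; ring.
Qed.

Lemma PcovE (H tau : R) (alpha beta : C) : 0 < H -> H <= 1 -> 0 <= tau ->
  Re alpha < 0 -> Re beta < 0 ->
  (2 * H)%:C * Pcov alpha beta H tau =
  (alpha + conjc beta) * (phi (2 * H) tau)%:C
  + conjc beta ^+ 2 * Elim (2 * H) tau (conjc beta)
  + alpha ^+ 2 * Ilim (2 * H) tau alpha.
Proof.
move=> H0 H1 tau0 a0 b0; set b := conjc beta; set s := 2 * H.
have rb : Re b < 0 by rewrite /b Re_conj.
have s0 : 0 < s by rewrite mulr_gt0.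
have s2 : s <= 2 by rewrite /s; move: H1; lra.
have bn0 : b != 0 by apply/eqP => h; move: rb; rewrite h ltxx.
have ra : 0 < Re (- alpha) by rewrite Re_N oppr_gt0.
have rb' : 0 < Re (- b) by rewrite Re_N oppr_gt0.
have T1 := Gamma_term s0 s2 rb'.
have T2 := upper_term s0 s2 tau0 ra.
have T3 := lower_term s0 tau0 bn0.
rewrite /Pcov -/b -/s (_ : - 2 * H + 1 = 1 - s); last by rewrite /s; ring.
have -> : s%:C * (cexp (b * tau%:C) * cpow (- b) (1 - s) * (Gamma s)%:C
   + cexp (- alpha * tau%:C) * cpow (- alpha) (1 - s) * upper_Gamma s (- alpha * tau%:C)
   + cexp (b * tau%:C) * cpow b (1 - s) * lower_gamma s (b * tau%:C)) =
   cexp (b * tau%:C) * (s%:C * (cpow (- b) (1 - s) * (Gamma s)%:C))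
   + cexp (- alpha * tau%:C) * (s%:C * (cpow (- alpha) (1 - s) * upper_Gamma s (- alpha * tau%:C)))
   + cexp (b * tau%:C) * (s%:C * (cpow b (1 - s) * lower_gamma s (b * tau%:C))) by ring.
rewrite T1 T2 T3 /Elim /Ilim opprK.
have -> : cexp (alpha * tau%:C) = (cexp (- alpha * tau%:C))^-1.
  by rewrite -cexpNV; congr cexp; ring.
have -> : cexp (- b * tau%:C) = (cexp (b * tau%:C))^-1.
  by rewrite -cexpNV; congr cexp; ring.
field; by rewrite !cexp_neq0.
Qed.

(** After PcovE this is an identity between rational functions of alpha and of the
    conjugate of beta. *)
Lemma cvg_relax2_Pcov (H tau : R) (alpha beta : C) : 0 < H -> H <= 1 -> 0 <= tau ->
  Re alpha < 0 -> Re beta < 0 ->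
  (relax2 (2 * H) alpha (conjc beta) t (t + tau) : C^o) @[t --> +oo] -->
  ((- alpha - conjc beta)^-1 * H%:C * Pcov alpha beta H tau : C^o).
Proof.
move=> H0 H1 tau0 a0 b0.
have rb : Re (conjc beta) < 0 by rewrite Re_conj.
have s0 : 0 < 2 * H by rewrite mulr_gt0.
have s2 : 2 * H <= 2 by move: H1; lra.
have := cvg_relax2 s0 s2 a0 rb tau0.
have P := PcovE H0 H1 tau0 a0 b0.
move: P; set b := conjc beta in rb *; set PP := Pcov _ _ _ _.
set EE := Elim _ _ _; set II := Ilim _ _ _; set ph := (phi _ _)%:C => P.
have ab0 : alpha + b != 0.
  by apply/eqP => /(congr1 (@complex.Re R)) /=; rewrite Re_D => h; move: a0 rb h => ? ? /=; lra.
have nab0 : - alpha - b != 0 by rewrite -opprD oppr_eq0.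
have -> : (- alpha - b)^-1 * H%:C * PP = (2 * (- alpha - b))^-1 * ((2 * H)%:C * PP).
  by rewrite real_complexM rmorph_nat; field.
rewrite P.
suff -> : 2^-1 * (0 + 0 - (ph + b * EE + alpha * II +
    alpha * b / (alpha + b) * (0 - EE + 0 - II))) =
  (2 * (- alpha - b))^-1 * ((alpha + b) * ph + b ^+ 2 * EE + alpha ^+ 2 * II) by [].
by field; rewrite ab0 nab0.
Qed.

End LaplaceIdentities.

(** * Square-integrable random variables and processes *)

Lemma integral_EFin d (T : measurableType d) (R : realType) (mu : {measure set T -> \bar R})
  (D : set T) (f : T -> R) : measurable D -> mu.-integrable D (EFin \o f) ->
  (\int[mu]_(x in D) (f x)%:E)%E = (\int[mu]_(x in D) f x)%:E.
Proof. by move=> mD fi; rewrite fineK//; exact: integrable_fin_num. Qed.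

Section SquareIntegrable.
Context d (T : measurableType d) (R : realType) (P : probability T R).
Implicit Types X Y : T -> R.

Definition L2 X : Prop := measurable_fun [set: T] X /\
  P.-integrable [set: T] (EFin \o (fun w => X w ^+ 2)).

Lemma L2_mul_integrable X Y : L2 X -> L2 Y ->
  P.-integrable [set: T] (EFin \o (fun w => X w * Y w)).
Proof.
move=> [mX iX] [mY iY].
apply: (le_integrable measurableT _ _ (integrable_addR measurableT iX iY)).
  by apply/measurable_EFinP; exact: measurable_funM.
move=> w _ /=; rewrite lee_fin [leRHS]ger0_norm ?addr_ge0 ?sqr_ge0// ler_norml.
by apply/andP; split; nra.
Qed.

Lemma L2_cst (c : R) : L2 (fun=> c).
Proof.
split; first exact: measurable_cst.
exact: finite_measure_integrable_cst.
Qed.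

Lemma L2_integrable X : L2 X -> P.-integrable [set: T] (EFin \o X).
Proof.
move=> hX; have := L2_mul_integrable hX (L2_cst 1).
by under [X in EFin \o X]funext do rewrite mulr1.
Qed.

Lemma L2D X Y : L2 X -> L2 Y -> L2 (fun w => X w + Y w).
Proof.
move=> hX hY; have hXY := L2_mul_integrable hX hY.
have [mX iX] := hX; have [mY iY] := hY.
split; first exact: measurable_funD.
have -> : (fun w => (X w + Y w) ^+ 2) = (fun w => (X w ^+ 2 + Y w ^+ 2) + 2 * (X w * Y w)).
  by apply/funext => w; ring.
apply: integrable_addR => //; first exact: integrable_addR.
exact: integrableMl_cst.
Qed.

Lemma L2Z (k : R) X : L2 X -> L2 (fun w => k * X w).
Proof.
move=> [mX iX]; split; first by apply: measurable_funM => //; exact: measurable_cst.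
under [X in EFin \o X]funext do rewrite exprMn.
exact: integrableMl_cst.
Qed.

Lemma L2B X Y : L2 X -> L2 Y -> L2 (fun w => X w - Y w).
Proof.
move=> hX hY; under eq_fun do rewrite -mulN1r; exact: L2D hX (L2Z (-1) hY).
Qed.

Local Notation C := R[i].

Definition cL2 (X : T -> C) : Prop := L2 (fun w => Re (X w)) /\ L2 (fun w => Im (X w)).

Lemma cL2_real X : L2 X -> cL2 (fun w => (X w)%:C).
Proof. by move=> hX; split => //=; exact: L2_cst. Qed.

Lemma cL2_cst (c : C) : cL2 (fun=> c). Proof. by split; exact: L2_cst. Qed.

Lemma cL2D (X Y : T -> C) : cL2 X -> cL2 Y -> cL2 (fun w => X w + Y w).
Proof.
move=> [X1 X2] [Y1 Y2]; split.
- by under eq_fun do rewrite Re_D; exact: L2D.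
- by under eq_fun do rewrite Im_D; exact: L2D.
Qed.

Lemma cL2Z (k : C) (X : T -> C) : cL2 X -> cL2 (fun w => k * X w).
Proof.
move=> [X1 X2]; split.
- by under eq_fun do rewrite Re_M; apply: L2B; exact: L2Z.
- by under eq_fun do rewrite Im_M; apply: L2D; exact: L2Z.
Qed.

Lemma cL2_sum (I : Type) (r : seq I) (X : I -> T -> C) :
  (forall i, cL2 (X i)) -> cL2 (fun w => \sum_(i <- r) X i w).
Proof.
move=> h; elim: r => [|i r ih].
  by under eq_fun do rewrite big_nil; exact: cL2_cst.
by under eq_fun do rewrite big_cons; exact: cL2D.
Qed.

Lemma cL2_mul (X Y : T -> C) : cL2 X -> cL2 Y ->
  cintegrable P [set: T] (fun w => X w * Y w).
Proof.
move=> [X1 X2] [Y1 Y2]; split.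
- under [X in EFin \o X]funext do rewrite Re_M.
  by apply: integrable_subR => //; exact: L2_mul_integrable.
- under [X in EFin \o X]funext do rewrite Im_M.
  by apply: integrable_addR => //; exact: L2_mul_integrable.
Qed.

Lemma cL2_cintegrable (X : T -> C) : cL2 X -> cintegrable P [set: T] X.
Proof. by move=> [X1 X2]; split; exact: L2_integrable. Qed.

Lemma cexpectationE (X : T -> C) : cexpectation P X = cintegral P [set: T] X.
Proof. by rewrite /cexpectation unlock. Qed.

End SquareIntegrable.

Lemma continuous_sqr (R : realType) (f : R -> R) : continuous f ->
  continuous (fun s => f s ^+ 2).
Proof. by move=> cf s; exact: (cvgM (cf s) (cf s)). Qed.

(** Cauchy-Schwarz: the integral of (f - c)^2 is nonnegative, with c the mean of f. *)
Lemma sqr_integral_le (R : realType) (f : R -> R) (t : R) : 0 <= t -> continuous f ->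
  (\int[@lebesgue_measure R]_(s in `[0, t]) f s) ^+ 2 <=
  t * \int[@lebesgue_measure R]_(s in `[0, t]) (f s ^+ 2).
Proof.
move=> t0 cf; set Z := \int[_]_(_ in _) f _; set V := \int[_]_(_ in _) _.
have cf2 := continuous_sqr cf.
have if1 := continuous_integrable 0 t cf.
have if2 := continuous_integrable 0 t cf2.
have ic (c : R) : (@lebesgue_measure R).-integrable `[0, t] (EFin \o (fun=> c)).
  by apply: continuous_integrable; exact: cst_continuous.
have [t00|tn0] := eqVneq t 0.
  by rewrite /Z t00 set_itv1 Rintegral_set1 expr0n mul0r.
have tp : 0 < t by rewrite lt_def tn0.
have h c : 0 <= V - 2 * c * Z + c ^+ 2 * t.
  have -> : V - 2 * c * Z + c ^+ 2 * t =
      \int[@lebesgue_measure R]_(s in `[0, t]) ((f s ^+ 2 - 2 * c * f s) + c ^+ 2).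
    have c3 : continuous (fun s => 2 * c * f s).
      by move=> s; apply: cvgM; [exact: cvg_cst|exact: cf].
    have c4 : continuous (fun s => f s ^+ 2 - 2 * c * f s).
      by move=> s; apply: cvgB; [exact: cf2|exact: c3].
    have i3 := continuous_integrable 0 t c3.
    have i4 := continuous_integrable 0 t c4.
    rewrite RintegralD// RintegralB// RintegralZl//; congr (_ + _).
    by rewrite Rintegral_cst//= lebesgue_measure_itv /= lte_fin tp /= subr0.
  by apply: Rintegral_ge0 => s _; rewrite (_ : _ + _ = (f s - c) ^+ 2) ?sqr_ge0//; ring.
have := h (Z / t).
have -> : V - 2 * (Z / t) * Z + (Z / t) ^+ 2 * t = V - Z ^+ 2 / t by field.
by rewrite subr_ge0 ler_pdivrMr// mulrC.
Qed.

Section ContinuousProcess.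
Context d (T : measurableType d) (R : realType) (P : probability T R).
Notation mu := (@lebesgue_measure R).
Variables (g : R -> T -> R) (m : R -> R).
Hypotheses (g_meas : forall s, measurable_fun [set: T] (g s))
  (g_cont : forall w, continuous (fun s => g s w))
  (g_neg : forall s w, g s w = g (Num.max s 0) w)
  (g_sqr : forall s, P.-integrable [set: T] (EFin \o (fun w => g s w ^+ 2)))
  (g_var : forall s, 0 <= s -> \int[P]_w (g s w ^+ 2) = m s)
  (m_cont : continuous m).

Let grid (n : nat) (s : R) : R := (Num.truncn (s * n.+1%:R))%:R / n.+1%:R.

Lemma grid_cvg (s : R) : 0 <= s -> grid n s @[n --> \oo] --> s.
Proof.
move=> s0; apply/cvgrPdist_le => e e0.
have := @cvg_harmonic R => /cvgrPdist_le/(_ _ e0); apply: filterS => n.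
rewrite sub0r normrN /harmonic /= ger0_norm ?invr_ge0// => ne.
rewrite (le_trans _ ne)// /grid.
have n0 : 0 < n.+1%:R :> R by rewrite ltr0n.
have /andP[h1 h2] := truncn_itv (mulr_ge0 s0 (ltW n0)).
rewrite ger0_norm ?subr_ge0 ?ler_pdivrMr//.
rewrite lerBlDr -[X in X + _]div1r -mulrDl ler_pdivlMr// addrC natr1; exact: ltW.
Qed.

(** The process is the limit of the processes frozen on the grids of mesh 1/(n+1),
    and each of those is measurable as a countable union of products. *)
Lemma measurable_process : measurable_fun [set: T * R] (fun z => g z.2 z.1).
Proof.
have hn n : measurable_fun [set: T * R] (fun z => g (grid n z.2) z.1).
  move=> _ A mA; rewrite setTI.
  have -> : (fun z : T * R => g (grid n z.2) z.1) @^-1` A =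
     \bigcup_k ((g (k%:R / n.+1%:R) @^-1` A) `*`
       ((fun s : R => (Num.truncn (s * n.+1%:R))%:R : R) @^-1` [set k%:R])).
    apply/seteqP; split => [[w s] /= h|[w s] [k _ [/= h1 h2]]].
      by exists (Num.truncn (s * n.+1%:R)).
    by rewrite /grid h2.
  apply: bigcupT_measurable => k; apply: measurableX.
    by rewrite -[X in measurable X]setTI; exact: g_meas.
  rewrite -[X in measurable X]setTI; apply: nondecreasing_measurable => //.
  move=> x y xy; rewrite ler_nat; apply: le_truncn.
  by rewrite ler_wpM2r.
apply: (measurable_fun_cvg (h := fun n z => g (grid n z.2) z.1)) => // -[w s] _ /=.
rewrite (g_neg s w).
have -> : (fun n => g (grid n s) w) = (fun n => g (grid n (Num.max s 0)) w).
  apply/funext => n; have [s0|s0] := lerP 0 s; first by [].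
  congr (g _ w); rewrite /grid mul0r truncn0.
  have -> : Num.truncn (s * n.+1%:R) = 0%N; last by [].
  by apply/eqP; rewrite -leqn0 truncn_le_nat (lt_trans _ ltr01)// pmulr_llt0.
apply: (cvg_comp (fun n => grid n (Num.max s 0)) (fun s => g s w)).
  by apply: grid_cvg; rewrite le_max lexx orbT.
exact: g_cont.
Qed.

Variables (t : R) (k : R -> R).
Hypotheses (t_ge0 : 0 <= t) (k_cont : continuous k).

Let kt : R -> R := k \_ `[0, t].

Let kt_meas : measurable_fun [set: R] kt.
Proof.
apply/measurable_restrict => //; rewrite ?setTI.
by apply: measurable_funTS; exact: continuous_measurable_fun.
Qed.

Lemma L2_process s : L2 P (g s). Proof. by split. Qed.

Section FubiniProduct.
Variable Y : T -> R.
Hypothesis L2Y : L2 P Y.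

Let F (z : T * R) : R := Y z.1 * (kt z.2 * g z.2 z.1).

Let mF : measurable_fun [set: T * R] (EFin \o F).
Proof.
apply/measurable_EFinP; apply: measurable_funM.
  exact: measurableT_comp L2Y.1 measurable_fst.
apply: measurable_funM; last exact: measurable_process.
exact: measurableT_comp kt_meas measurable_snd.
Qed.

(** 2 |Y g| <= Y^2 + g^2, and the second moment m of g is bounded on [0, t]. *)
Let iF : (P \x mu)%E.-integrable [set: T * R] (EFin \o F).
Proof.
apply/integrable21ltyP => //.
pose cY := \int[P]_w (Y w ^+ 2).
have cM : continuous (fun s => `|k s| * (cY + m s)).
  move=> s; apply: cvgM; first by apply: cvg_norm; exact: k_cont.
  by apply: cvgD; [exact: cvg_cst|exact: m_cont].
have fin : (\int[mu]_(s in `[0%R, t]) (`|k s| * (cY + m s))%:E < +oo)%E.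
  have := continuous_integrable 0 t cM.
  by move=> /integrable_lty; apply.
apply: le_lt_trans fin; rewrite [leRHS]integral_mkcond; apply: ge0_le_integral => //.
- by move=> s _; exact: integral_ge0.
- apply: (measurable_fun_fubini_tonelli_G (abse \o (EFin \o F))).
    exact: measurableT_comp.
  by move=> z; exact: abse_ge0.
- rewrite (restrict_EFin (fun s => `|k s| * (cY + m s))); apply/measurable_EFinP.
  apply/measurable_restrict => //; rewrite ?setTI.
  by apply: measurable_funTS; exact: continuous_measurable_fun.
- move=> s _; rewrite patchE /F /kt; case: ifPn => [|sI]; last first.
    by rewrite integral0_eq// => w _ /=; rewrite patchE (negbTE sI) mul0r mulr0 normr0.
  rewrite inE /= in_itv/= => /andP[s0 st].
  have i2 := integrable_addR measurableT L2Y.2 (g_sqr s).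
  have i3 := integrableMl_cst measurableT `|k s| i2.
  apply: (@le_trans _ _ (\int[P]_w (`|k s| * (Y w ^+ 2 + g s w ^+ 2))%:E)%E).
    apply: ge0_le_integral => //.
    + apply/measurable_EFinP; apply: measurableT_comp => //.
      apply: measurable_funM; first exact: L2Y.1.
      by apply: measurable_funM => //; exact: measurable_cst.
    + by have /measurable_int := i3.
    + move=> w _ /=; rewrite patchE ifT; last by rewrite inE /= in_itv/= s0 st.
      rewrite lee_fin mulrCA normrM ler_wpM2l// ler_norml.
      by apply/andP; split; nra.
  rewrite (integral_EFin measurableT i3) lee_fin RintegralZl// RintegralD//; last exact: L2Y.2.
  by rewrite g_var.
Qed.

Lemma path_integrable (w : T) : mu.-integrable `[0, t] (EFin \o (fun s => k s * g s w)).
Proof.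
by apply: continuous_integrable => s; apply: cvgM; [exact: k_cont|exact: g_cont].
Qed.

Let F_inner (w : T) :
  (\int[mu]_s (F (w, s))%:E = (Y w * \int[mu]_(s in `[0%R, t]) (k s * g s w))%:E)%E.
Proof.
have iw := path_integrable w.
have -> : (fun s => (F (w, s))%:E) = (EFin \o (fun s => Y w * (k s * g s w))) \_ `[0, t].
  rewrite restrict_EFin; apply/funext => s; rewrite /F /= /kt !patchE.
  by case: ifP => // _; rewrite mul0r mulr0.
rewrite -integral_mkcond integral_EFin//; last exact: integrableMl_cst.
by rewrite RintegralZl.
Qed.

Lemma expectation_path_integral :
  \int[P]_w (Y w * \int[mu]_(s in `[0, t]) (k s * g s w)) =
  \int[mu]_(s in `[0, t]) (k s * \int[P]_w (Y w * g s w)).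
Proof.
rewrite /Rintegral; congr fine.
under eq_integral do rewrite -F_inner.
rewrite (@Fubini _ _ _ _ _ P mu (EFin \o F) iF) [RHS]integral_mkcond.
apply: eq_integral => s _ /=; rewrite patchE /F /= /kt patchE; case: ifP => sI; last first.
  by rewrite integral0_eq// => w _; rewrite mul0r mulr0.
have i1 := L2_mul_integrable L2Y (L2_process s).
under eq_integral do rewrite mulrCA.
by rewrite integral_EFin// ?RintegralZl//; exact: integrableMl_cst.
Qed.

Lemma measurable_path_integral_mul :
  measurable_fun [set: T] (fun w => Y w * \int[mu]_(s in `[0, t]) (k s * g s w)).
Proof.
apply/measurable_EFinP; have := measurable_fubini_F iF; rewrite /fubini_F /=.
by under [X in measurable_fun _ X -> _]funext do rewrite F_inner.
Qed.

End FubiniProduct.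

(** By Cauchy-Schwarz the square of the integral is at most t times the integral of
    the square, whose expectation is the integral of k^2 m. *)
Lemma L2_path_integral : L2 P (fun w => \int[mu]_(s in `[0, t]) (k s * g s w)).
Proof.
have mZ : measurable_fun [set: T] (fun w => \int[mu]_(s in `[0, t]) (k s * g s w)).
  have := measurable_path_integral_mul (L2_cst P 1).
  by under [X in measurable_fun _ X -> _]funext do rewrite mul1r.
split => //.
pose F2 (z : T * R) : R := (kt z.2 * g z.2 z.1) ^+ 2.
have mF2 : measurable_fun [set: T * R] (EFin \o F2).
  apply/measurable_EFinP; rewrite /F2; under eq_fun do rewrite expr2.
  have mm : measurable_fun [set: T * R] (fun z => kt z.2 * g z.2 z.1).
    apply: measurable_funM; last exact: measurable_process.
    exact: measurableT_comp kt_meas measurable_snd.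
  exact: measurable_funM.
have F20 z : (0 <= (EFin \o F2) z)%E by rewrite lee_fin sqr_ge0.
have ck2 w : continuous (fun s => (k s * g s w) ^+ 2).
  by apply: continuous_sqr => s; apply: cvgM; [exact: k_cont|exact: g_cont].
pose V w := \int[mu]_(s in `[0, t]) ((k s * g s w) ^+ 2).
have VE w : (\int[mu]_s (EFin \o F2) (w, s) = (V w)%:E)%E.
  have -> : (fun s => (EFin \o F2) (w, s)) = (EFin \o (fun s => (k s * g s w) ^+ 2)) \_ `[0, t].
    rewrite restrict_EFin; apply/funext => s; rewrite /F2 /= /kt !patchE.
    by case: ifP => // _; rewrite mul0r expr0n.
  by rewrite -integral_mkcond integral_EFin//; exact: continuous_integrable.
have mV : measurable_fun [set: T] V.
  apply/measurable_EFinP; have := @measurable_fun_fubini_tonelli_F _ _ _ _ _ mu (EFin \o F2) mF2 F20.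
  by rewrite /fubini_F; under [X in measurable_fun _ X -> _]funext do rewrite VE.
have V0 w : 0 <= V w by apply: Rintegral_ge0 => s _; exact: sqr_ge0.
have iV : P.-integrable [set: T] (EFin \o V).
  apply/integrableP; split; first exact/measurable_EFinP.
  under eq_integral do rewrite /= (ger0_norm (V0 _)) -VE.
  rewrite (@fubini_tonelli _ _ _ _ _ P mu (EFin \o F2) mF2 F20).
  have cM : continuous (fun s => k s ^+ 2 * m s).
    by move=> s; apply: cvgM; [exact: continuous_sqr|exact: m_cont].
  have -> : (\int[mu]_s \int[P]_w (EFin \o F2) (w, s) =
      \int[mu]_(s in `[0%R, t]) (k s ^+ 2 * m s)%:E)%E.
    rewrite [RHS]integral_mkcond; apply: eq_integral => s _.
    rewrite patchE /F2 /= /kt patchE; case: ifP => sI; last first.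
      by rewrite integral0_eq// => w _; rewrite mul0r expr0n.
    under eq_integral do rewrite exprMn.
    have s0 : 0 <= s by move: sI; rewrite inE /= in_itv/= => /andP[].
    rewrite integral_EFin// ?RintegralZl// ?g_var//; exact: integrableMl_cst.
  have := continuous_integrable 0 t cM.
  by move=> /integrable_lty; apply.
apply: (le_integrable measurableT _ _ (integrableMl_cst measurableT t iV)).
  by apply/measurable_EFinP; under eq_fun do rewrite expr2; exact: measurable_funM.
move=> w _ /=; rewrite lee_fin ger0_norm ?sqr_ge0// ger0_norm ?mulr_ge0//.
apply: sqr_integral_le => // s; apply: cvgM; [exact: k_cont|exact: g_cont].
Qed.

End ContinuousProcess.

Local Transparent cprim.

(** * Relaxation of a random path *)

Section RelaxedProcess.
Context d (T : measurableType d) (R : realType) (P : probability T R).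
Local Notation C := R[i].
Notation mu := (@lebesgue_measure R).
Variables (g : R -> T -> R) (m : R -> R).
Hypotheses (g_meas : forall s, measurable_fun [set: T] (g s))
  (g_cont : forall w, continuous (fun s => g s w))
  (g_neg : forall s w, g s w = g (Num.max s 0) w)
  (g_sqr : forall s, P.-integrable [set: T] (EFin \o (fun w => g s w ^+ 2)))
  (g_var : forall s, 0 <= s -> \int[P]_w (g s w ^+ 2) = m s)
  (m_cont : continuous m).
Variables (t : R) (c : C).
Hypothesis (t_ge0 : 0 <= t).

Let ec (v : R) : C := cexp (- c * v%:C).
Let ec_cont : ccont ec. Proof. exact: ccont_expM. Qed.
Let kR := fun v => Re (ec v).
Let kI := fun v => Im (ec v).
Let kR_cont : continuous kR. Proof. exact: ccont_Re. Qed.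
Let kI_cont : continuous kI. Proof. exact: ccont_Im. Qed.

Definition relaxed (w : T) : C := relax c (fun s => (g s w)%:C) t.

Let Z (k : R -> R) (w : T) : R := \int[mu]_(s in `[0, t]) (k s * g s w).

Let cprim_relaxed (w : T) :
  cprim (fun v => cexp (- c * v%:C) * (g v w)%:C) t = Z kR w +i* Z kI w.
Proof.
rewrite cprimE// /cintegral /Z /kR /kI; congr (_ +i* _); apply: eq_Rintegral => v _.
  by rewrite Re_M /= mulr0 subr0.
by rewrite Im_M /= mulr0 add0r.
Qed.

Let L2_Z k : continuous k -> L2 P (Z k).
Proof. by move=> ck; exact: (L2_path_integral g_meas g_cont g_neg g_sqr g_var m_cont t_ge0 ck). Qed.

Let cL2_Z : cL2 P (fun w => Z kR w +i* Z kI w).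
Proof. by split; exact: L2_Z. Qed.

Let relaxedE (w : T) :
  relaxed w = (g t w)%:C + c * cexp (c * t%:C) * (Z kR w +i* Z kI w).
Proof. by rewrite /relaxed /relax cprim_relaxed. Qed.

Let cL2_g s : cL2 P (fun w => (g s w)%:C).
Proof. by apply: cL2_real; split. Qed.

Lemma cL2_relaxed : cL2 P relaxed.
Proof.
have -> : relaxed = (fun w => (g t w)%:C + c * cexp (c * t%:C) * (Z kR w +i* Z kI w)).
  by apply/funext; exact: relaxedE.
by apply: cL2D => //; exact: cL2Z.
Qed.

(** The expectation against a fixed Y commutes with relax, by Fubini. *)
Lemma expectation_relaxed (Y : T -> C) (r : R -> C) : cL2 P Y -> ccont r ->
  (forall v, 0 <= v <= t -> cintegral P [set: T] (fun w => Y w * (g v w)%:C) = r v) ->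
  cintegral P [set: T] (fun w => Y w * relaxed w) = relax c r t.
Proof.
move=> hY cr hr.
have YZ : cintegral P [set: T] (fun w => Y w * (Z kR w +i* Z kI w)) =
    cprim (fun v => ec v * r v) t.
  have [Y1 Y2] := hY.
  have E1 (X : T -> R) k : L2 P X -> continuous k ->
    \int[P]_w (X w * Z k w) = \int[mu]_(s in `[0, t]) (k s * \int[P]_w (X w * g s w)).
    by move=> hX ck; exact: (expectation_path_integral g_meas g_cont g_neg g_sqr g_var m_cont t ck hX).
  have rR s : 0 <= s <= t -> \int[P]_w (Re (Y w) * g s w) = Re (r s).
    move=> st; rewrite -(hr _ st) /=; apply: eq_Rintegral => w _.
    by rewrite Re_M /= mulr0 subr0.
  have rI s : 0 <= s <= t -> \int[P]_w (Im (Y w) * g s w) = Im (r s).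
    move=> st; rewrite -(hr _ st) /=; apply: eq_Rintegral => w _.
    by rewrite Im_M /= mulr0 add0r.
  have cI (k f : R -> R) : continuous k -> continuous f ->
      mu.-integrable `[0, t] (EFin \o (fun s => k s * f s)).
    by move=> ck cf; apply: continuous_integrable => s; exact: (cvgM (ck s) (cf s)).
  have cR := ccont_Re cr; have cIm := ccont_Im cr.
  have E2 k : \int[mu]_(s in `[0, t]) (k s * \int[P]_w (Re (Y w) * g s w)) =
      \int[mu]_(s in `[0, t]) (k s * Re (r s)).
    by apply: eq_Rintegral => s; rewrite inE /= in_itv/= => st; rewrite rR.
  have E3 k : \int[mu]_(s in `[0, t]) (k s * \int[P]_w (Im (Y w) * g s w)) =
      \int[mu]_(s in `[0, t]) (k s * Im (r s)).
    by apply: eq_Rintegral => s; rewrite inE /= in_itv/= => st; rewrite rI.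
  have [ZR ZI] := cL2_Z.
  rewrite cprimE//; apply: complex_eq => /=.
  - under eq_Rintegral do rewrite Re_M /=.
    rewrite RintegralB//; [|exact: L2_mul_integrable..].
    rewrite !E1// E2 E3 -RintegralB//; [|exact: cI..].
    by apply: eq_Rintegral => s _; rewrite Re_M.
  - under eq_Rintegral do rewrite Im_M /=.
    rewrite RintegralD//; [|exact: L2_mul_integrable..].
    rewrite !E1// E2 E3 addrC -RintegralD//; [|exact: cI..].
    by apply: eq_Rintegral => s _; rewrite Im_M addrC.
have i1 := cL2_mul hY (cL2_g t).
have i2 := cL2_mul hY cL2_Z.
have -> : (fun w => Y w * relaxed w) = (fun w => Y w * (g t w)%:C +
    c * cexp (c * t%:C) * (Y w * (Z kR w +i* Z kI w))).
  by apply/funext => w; rewrite relaxedE; ring.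
rewrite cintegralD//; last exact: cintegrableZ.
by rewrite cintegralZ// YZ hr ?lexx ?t_ge0.
Qed.

End RelaxedProcess.

(** * Paths of the Langevin equation *)

Lemma sum2E (V : nmodType) (F : 'I_2 -> V) : \sum_i F i = F 0 + F 1.
Proof.
by rewrite !big_ord_recl big_ord0 addr0; congr (F _ + F _); exact: val_inj.
Qed.

Section HermitianPairing.
Variable R : realType.
Local Notation C := R[i].
Implicit Types u v w : 'cV[C]_2.

Lemma cdotE (n : nat) (u v : 'cV[C]_n) : cdot u v = \sum_i u i 0 * conjc (v i 0).
Proof. by rewrite /cdot mxE; apply: eq_bigr => i _; rewrite !mxE. Qed.

Lemma cdotDl u v w : cdot (u + v) w = cdot u w + cdot v w.
Proof. by rewrite !cdotE -big_split; apply: eq_bigr => i _; rewrite mxE mulrDl. Qed.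

Lemma cdotZr c u w : cdot u (c *: w) = conjc c * cdot u w.
Proof.
rewrite !cdotE mulr_sumr; apply: eq_bigr => i _.
by rewrite mxE rmorphM mulrCA.
Qed.

Lemma cdot_adj (M : 'M[C]_2) u w : cdot (M *m u) w = cdot u ((map_mx conjc M)^T *m w).
Proof.
rewrite !cdotE; under eq_bigr do rewrite mxE mulr_suml.
rewrite exchange_big; apply: eq_bigr => j _.
rewrite mxE rmorph_sum mulr_sumr; apply: eq_bigr => i _.
by rewrite !mxE rmorphM /= conjcK mulrCA mulrA.
Qed.

Lemma mxC_real (m n : nat) (A : 'M[R]_(m, n)) : map_mx conjc (mxC A) = mxC A.
Proof. by apply/matrixP => i j; rewrite !mxE conjc_real. Qed.

Lemma mxCM (m n p : nat) (A : 'M[R]_(m, n)) (B : 'M[R]_(n, p)) : mxC (A *m B) = mxC A *m mxC B.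
Proof. exact: map_mxM. Qed.

Lemma mxCD (m n : nat) (A B : 'M[R]_(m, n)) : mxC (A + B) = mxC A + mxC B.
Proof. exact: map_mxD. Qed.

(** An eigenvector of the transpose turns the drift into a multiplication. *)
Lemma cdot_eigen (M : 'M[R]_2) (z : C) (v : 'cV[C]_2) (x : 'cV[R]_2) :
  (mxC M)^T *m v = conjc z *: v -> cdot (mxC (M *m x)) v = z * cdot (mxC x) v.
Proof. by move=> h; rewrite mxCM cdot_adj mxC_real h cdotZr conjcK. Qed.

End HermitianPairing.

Section MaxContinuity.
Variable R : realType.

Lemma max0_continuous (A : set R) (f : R -> R) (s : R) : {within A, continuous f} ->
  (\forall r \near s, A (Num.max (r : R) 0)) ->
  {for s, continuous (fun r : R => f (Num.max r 0))}.
Proof.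
move=> /subspace_continuousP cf As.
have As0 : A (Num.max s 0) by exact: nbhs_singleton As.
apply: cvg_comp (cf _ As0) => U /= hU.
have cm : {for s, continuous (fun r : R => Num.max r 0)}.
  have -> : (fun r : R => Num.max r 0) = (fun r => (r + `|r|) / 2).
    by apply/funext => r; rewrite maxr_absE subr0 addr0.
  apply: cvgM; last exact: cvg_cst.
  by apply: cvgD; [exact: cvg_id|exact: norm_continuous].
have := cm _ hU; rewrite !nbhs_simpl /= => h.
by apply: filterS2 h As => r; apply.
Qed.

End MaxContinuity.

Section LangevinPath.
Variable R : realType.
Local Notation C := R[i].
Notation mu := (@lebesgue_measure R).
Variables (M S : 'M[R]_2) (x0 : 'cV[R]_2) (x w : R -> 'cV[R]_2).
Hypothesis w_cont : forall i, continuous (fun s => w s i 0).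
Hypothesis x_int : forall t, 0 <= t -> forall i,
  mu.-integrable `[0, t] (EFin \o (fun s : R => (M *m x s) i 0)).
Hypothesis x_eq : forall t, 0 <= t ->
  x t = x0 + \col_i (\int[mu]_(s in `[0, t]) ((M *m x s) i 0)) + S *m w t.

Let y i (t : R) : R := \int[mu]_(s in `[0, t]) ((M *m x s) i 0).

Let y_cont i : continuous (fun s : R => y i (Num.max s 0)).
Proof.
move=> s; have T0 : 0 <= `|s| + 1 by rewrite addr_ge0.
apply: (@max0_continuous _ `[0, `|s| + 1]).
  exact: parameterized_integral_continuous (x_int T0 i).
have : \forall r \near s, r < `|s| + 1.
  by apply: lt_nbhsl; rewrite (le_lt_trans (ler_norm s))// ltrDl.
by apply: filterS => r rs; rewrite /= in_itv/= le_max lexx orbT/= ge_max T0 ltW.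
Qed.

(** The path, extended continuously to negative times. *)
Let xt (s : R) : 'cV[R]_2 := x0 + \col_i (y i (Num.max s 0)) + S *m w s.

Let xtE s : 0 <= s -> x s = xt s.
Proof.
move=> s0; rewrite (x_eq s0) /xt; congr (_ + _ + _).
by apply/matrixP => i j; rewrite !mxE (max_l s0).
Qed.

Let lin_cont (A : 'M[R]_2) (h : R -> 'cV[R]_2) : (forall i, continuous (fun s => h s i 0)) ->
  forall i, continuous (fun s => (A *m h s) i 0).
Proof.
move=> ch i; under [X in continuous X]funext do rewrite mxE.
under [X in continuous X]funext do rewrite sum2E.
by move=> s; apply: cvgD; apply: cvgM; [exact: cvg_cst|exact: ch|exact: cvg_cst|exact: ch].
Qed.

Let xt_cont i : continuous (fun s => xt s i 0).
Proof.
have -> : (fun s => xt s i 0) = (fun s => x0 i 0 + y i (Num.max s 0) + (S *m w s) i 0).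
  by apply/funext => s; rewrite /xt !mxE.
move=> s; apply: cvgD; last exact: (lin_cont (A := S) w_cont).
by apply: cvgD; [exact: cvg_cst|exact: y_cont].
Qed.

Let f i (s : R) : R := (M *m xt s) i 0.

Let f_cont i : continuous (f i). Proof. exact: lin_cont. Qed.

Let y_prim i t : 0 <= t -> y i t = prim (f i) t.
Proof.
move=> t0; rewrite /y /prim t0; apply: eq_Rintegral => s.
by rewrite inE /= in_itv/= => /andP[s0 _]; rewrite /f -xtE.
Qed.

(** Variation of constants: the drift part yv of the solution satisfies
    yv' = z (u0 + yv + om), where om is the component of the noise along v, hence
    e^(-zs) yv(s) is the primitive of z e^(-zs) (u0 + om(s)). *)
Lemma langevin_path (z : C) (v : 'cV[C]_2) t : (mxC M)^T *m v = conjc z *: v -> 0 <= t ->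
  cdot (mxC (x t)) v = cexp (z * t%:C) * cdot (mxC x0) v
    + relax z (fun s => cdot (mxC (S *m w s)) v) t.
Proof.
move=> hv t0.
pose om s := cdot (mxC (S *m w s)) v.
pose u0 := cdot (mxC x0) v.
pose yv s := \sum_i (prim (f i) s)%:C * conjc (v i 0).
have om_cont : ccont om.
  have c i : ccont (fun s => ((S *m w s) i 0)%:C).
    by apply: ccont_real; exact: lin_cont.
  have -> : om = (fun s => ((S *m w s) 0 0)%:C * conjc (v 0 0)
      + ((S *m w s) 1 0)%:C * conjc (v 1 0)).
    by apply/funext => s; rewrite /om cdotE sum2E !mxE.
  exact: (ccontD (ccontM (c 0) (@ccont_cst R _)) (ccontM (c 1) (@ccont_cst R _))).
have xE s : 0 <= s -> cdot (mxC (x s)) v = u0 + yv s + om s.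
  move=> s0; rewrite x_eq// !mxCD !cdotDl; congr (_ + _ + _).
  rewrite cdotE; apply: eq_bigr => i _; rewrite !mxE; congr (_%:C * _).
  exact: y_prim.
have dyv s : 0 <= s -> cder yv s (z * (u0 + yv s + om s)).
  move=> s0; rewrite -xE// -(cdot_eigen _ hv) (xtE s0) cdotE.
  have -> : yv = (fun s => (prim (f 0) s)%:C * conjc (v 0 0) + (prim (f 1) s)%:C * conjc (v 1 0)).
    by apply/funext => r; rewrite /yv sum2E.
  have d i : cder (fun s => (prim (f i) s)%:C * conjc (v i 0)) s ((f i s)%:C * conjc (v i 0)).
    apply: cder_eq (cderM (cder_real (is_derive_prim s (@f_cont i))) (cder_cst (conjc (v i 0)) s)) _.
    by rewrite mulr0 addr0.
  apply: cder_eq (cderD (d 0) (d 1)) _.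
  by rewrite sum2E !mxE /f !mxE.
have yv0 : yv 0 = 0 by rewrite /yv big1// => i _; rewrite prim0 mul0r.
have uc : ccont (fun s => u0 * 1 + om s).
  by apply: ccontD; [apply: ccontM; exact: ccont_cst|exact: om_cont].
have E : z * cprim (fun s => cexp (- z * s%:C) * (u0 * 1 + om s)) t = cexp (- z * t%:C) * yv t.
  have ce := @ccont_expm R z _ uc.
  rewrite -cprimM; last exact: ce.
  have dF r : 0 <= r <= t -> cder (fun s => cexp (- z * s%:C) * yv s) r
      (z * (cexp (- z * r%:C) * (u0 * 1 + om r))).
    move=> /andP[r0 _].
    apply: cder_eq (cderM (cder_expM (- z) r) (dyv r r0)) _.
    by ring.
  rewrite (cprim_unique (ccontM (@ccont_cst R z) ce) t0 dF).
  by rewrite yv0 mulr0 subr0.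
rewrite (xE t t0).
(* the constant u0 is relaxed together with the noise, and split off by relax1 *)
have L : relax z (fun s => u0 * 1 + om s) t = u0 + yv t + om t.
  have -> : relax z (fun s => u0 * 1 + om s) t = u0 * 1 + om t + cexp (z * t%:C) *
      (z * cprim (fun s => cexp (- z * s%:C) * (u0 * 1 + om s)) t) by rewrite /relax; ring.
  by rewrite E mulNr cexpNV; field; rewrite cexp_neq0.
rewrite -L relaxD; [|exact: (ccontM (@ccont_cst R u0) (@ccont_cst R 1))|exact: om_cont].
rewrite relaxZ; last exact: ccont_cst.
by rewrite relax1 mulrC.
Qed.

End LangevinPath.

(** * Covariances of the relaxed noise *)

Section Covariance.
Context d (T : measurableType d) (R : realType) (P : probability T R).
Local Notation C := R[i].
Implicit Types X Y : T -> C.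

(** Bilinear: in Vt the conjugation is part of the second variable. *)
Definition ccov X Y : C := cintegral P [set: T] (fun w => X w * Y w) -
  cintegral P [set: T] X * cintegral P [set: T] Y.

Lemma ccovC X Y : ccov X Y = ccov Y X.
Proof.
rewrite /ccov mulrC; congr (_ - _); congr cintegral.
by apply/funext => w; rewrite mulrC.
Qed.

Lemma ccovDl X Y Z : cL2 P X -> cL2 P Y -> cL2 P Z ->
  ccov (fun w => X w + Y w) Z = ccov X Z + ccov Y Z.
Proof.
move=> hX hY hZ; rewrite /ccov cintegralD//; [|exact: cL2_cintegrable..].
have -> : (fun w => (X w + Y w) * Z w) = (fun w => X w * Z w + Y w * Z w).
  by apply/funext => w; rewrite mulrDl.
rewrite cintegralD//; [ring|exact: cL2_mul..].
Qed.

Lemma ccovZl (k : C) X Z : cL2 P X -> cL2 P Z -> ccov (fun w => k * X w) Z = k * ccov X Z.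
Proof.
move=> hX hZ; rewrite /ccov cintegralZ//; last exact: cL2_cintegrable.
have -> : (fun w => k * X w * Z w) = (fun w => k * (X w * Z w)).
  by apply/funext => w; rewrite mulrA.
rewrite cintegralZ//; [ring|exact: cL2_mul].
Qed.

Lemma cintegral_cst (c : C) : cintegral P [set: T] (fun=> c) = c.
Proof.
apply: complex_eq; rewrite /= Rintegral_cst//= probability_setT.
  by rewrite /= mulr1.
by rewrite /= mulr1.
Qed.

Lemma ccov_cstl (c : C) Z : cL2 P Z -> ccov (fun=> c) Z = 0.
Proof.
move=> hZ; rewrite /ccov cintegralZ//; last exact: cL2_cintegrable.
by rewrite cintegral_cst subrr.
Qed.

Lemma ccov_suml (I : Type) (r : seq I) (X : I -> T -> C) Z :
  (forall i, cL2 P (X i)) -> cL2 P Z ->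
  ccov (fun w => \sum_(i <- r) X i w) Z = \sum_(i <- r) ccov (X i) Z.
Proof.
move=> hX hZ; elim: r => [|i r ih].
  have -> : (fun w => \sum_(i <- [::]) X i w) = (fun=> 0) by apply/funext => w; rewrite big_nil.
  by rewrite big_nil ccov_cstl.
have -> : (fun w => \sum_(j <- i :: r) X j w) = (fun w => X i w + \sum_(j <- r) X j w).
  by apply/funext => w; rewrite big_cons.
by rewrite big_cons ccovDl ?ih//; exact: cL2_sum.
Qed.

Definition cmeasurable X : Prop := measurable_fun [set: T] (fun w => Re (X w)) /\
  measurable_fun [set: T] (fun w => Im (X w)).

Lemma cL2_cmeasurable X : cL2 P X -> cmeasurable X.
Proof. by move=> [[? _] [? _]]; split. Qed.

Lemma cmeasurableM X Y : cmeasurable X -> cmeasurable Y -> cmeasurable (fun w => X w * Y w).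
Proof.
move=> [X1 X2] [Y1 Y2]; split.
- have -> : (fun w => Re (X w * Y w)) = (fun w => Re (X w) * Re (Y w) - Im (X w) * Im (Y w)).
    by apply/funext => w; rewrite Re_M.
  by apply: measurable_funB; exact: measurable_funM.
- have -> : (fun w => Im (X w * Y w)) = (fun w => Re (X w) * Im (Y w) + Im (X w) * Re (Y w)).
    by apply/funext => w; rewrite Im_M.
  by apply: measurable_funD; exact: measurable_funM.
Qed.

Lemma ae_eq_Rintegral (f g : T -> R) : measurable_fun [set: T] f -> measurable_fun [set: T] g ->
  {ae P, forall w, f w = g w} -> \int[P]_w f w = \int[P]_w g w.
Proof.
move=> mf mg fg; rewrite /Rintegral; congr fine; apply: ae_eq_integral => //.
- exact/measurable_EFinP.
- exact/measurable_EFinP.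
- by apply: filterS fg => w /= -> _.
Qed.

Lemma ae_eq_cintegral X Y : cmeasurable X -> cmeasurable Y ->
  {ae P, forall w, X w = Y w} -> cintegral P [set: T] X = cintegral P [set: T] Y.
Proof.
move=> [X1 X2] [Y1 Y2] XY; rewrite /cintegral; congr (_ +i* _);
  by apply: ae_eq_Rintegral => //; apply: filterS XY => w ->.
Qed.

Lemma ae_eq_ccov X X' Y Y' : cmeasurable X -> cmeasurable X' ->
  cmeasurable Y -> cmeasurable Y' ->
  {ae P, forall w, X w = X' w} -> {ae P, forall w, Y w = Y' w} -> ccov X Y = ccov X' Y'.
Proof.
move=> mX mX' mY mY' XX' YY'; rewrite /ccov (ae_eq_cintegral mX mX' XX').
rewrite (ae_eq_cintegral mY mY' YY'); congr (_ - _).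
apply: ae_eq_cintegral; [exact: cmeasurableM..|].
by apply: filterS2 XX' YY' => w -> ->.
Qed.

Lemma Vt_ccov (x : R -> T -> 'cV[R]_2) (tau : R) (w1 w2 : 'cV[C]_2) (t : R) :
  Vt P x tau w1 w2 t = ccov (fun w => cdot (mxC (x t w)) w1)
    (fun w => conjc (cdot (mxC (x (t + tau) w)) w2)).
Proof. by rewrite /Vt !cexpectationE. Qed.

End Covariance.

Section RegularFBm.
Context d (T : measurableType d) (R : realType) (P : probability T R).
Local Notation C := R[i].
Notation mu := (@lebesgue_measure R).
Variable (H : R).
Hypotheses (H_gt0 : 0 < H).

(** A version of the driving noise all of whose paths are continuous, extended by
    its value at 0 to negative times: path integrals, joint measurability and
    Fubini's theorem then apply without exceptional sets. *)
Definition regular_fBm (g : 'I_2 -> R -> T -> R) : Prop :=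
  [/\ forall i s, measurable_fun [set: T] (g i s),
      forall i w, continuous (fun s => g i s w),
      forall i s w, g i s w = g i (Num.max s 0) w,
      forall i s, P.-integrable [set: T] (EFin \o (fun w => g i s w ^+ 2))
    & (forall i s, 0 <= s -> \int[P]_w (g i s w) = 0) /\
      forall i j s r, 0 <= s -> 0 <= r ->
        \int[P]_w (g i s w * g j r w) = (i == j)%:R * Rcov (2 * H) s r].

(** The paths are set to 0 on a null set outside of which all are continuous. *)
Lemma fBm_regular (W : R -> T -> 'cV[R]_2) : fBm P H W ->
  exists2 g, regular_fBm g &
    {ae P, forall w, forall (s : R) i, 0 <= s -> W s w i 0 = g i s w}.
Proof.
move=> [gauss mean cov [N [mN N0 subN]]].
have mW (s : R) i : 0 <= s -> measurable_fun [set: T] (fun w => W s w i 0).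
  move=> s0; have [+ _] := gauss 1%N (fun=> s) (fun _ j => (j == i)%:R) (fun=> s0).
  apply: eq_measurable_fun => w _; rewrite big_ord_recl big_ord0 addr0 (bigD1 i)//= eqxx mul1r.
  by rewrite big1 ?addr0// => j /negbTE ->; rewrite mul0r.
pose g i (s : R) w : R := W (Num.max s 0) w i 0 * \1_(~` N) w.
have max0 (s : R) : 0 <= Num.max s 0 by rewrite le_max lexx orbT.
have mg i s : measurable_fun [set: T] (g i s).
  apply: measurable_funM; first exact: mW.
  by apply: measurable_indic; exact: measurableC.
have gW : {ae P, forall w, forall (s : R) i, 0 <= s -> W s w i 0 = g i s w}.
  exists N; split => // w /=; apply: contra_notP => wN s i s0.
  by rewrite /g indicE mem_set// mulr1 max_l.
have covE i j (s r : R) : 0 <= s -> 0 <= r ->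
    (\int[P]_w (g i s w * g j r w)%:E = ((i == j)%:R * Rcov (2 * H) s r)%:E)%E.
  move=> s0 r0.
  have := cov s r i j s0 r0; rewrite unlock.
  have -> : ((((s `^ (2 * H) + r `^ (2 * H) - `|s - r| `^ (2 * H)) / 2)%:M : 'M[R]_2) i j) =
     (i == j)%:R * Rcov (2 * H) s r.
    rewrite mxE /Rcov /phi (ger0_norm s0) (ger0_norm r0).
    by case: (i == j); rewrite ?mulr1n ?mulr0n ?mul1r ?mul0r.
  move=> <-; apply: ae_eq_integral => //.
  - by apply/measurable_EFinP; exact: measurable_funM.
  - apply/measurable_EFinP.
    apply: (eq_measurable_fun (fun w => W s w i 0 * W r w j 0)).
      by move=> w _; rewrite mxE big_ord_recl big_ord0 addr0 mxE.
    by apply: measurable_funM; exact: mW.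
  - apply: filterS gW => w hw _.
    by rewrite mxE big_ord_recl big_ord0 addr0 mxE !hw.
exists g => //; split => //.
- move=> i w s; rewrite /g; have [wN|wN] := pselect (N w).
    have -> : (fun s : R => W (Num.max s 0) w i 0 * \1_(~` N) w) = (fun=> 0).
      by apply/funext => r; rewrite indicE memNset ?mulr0//=; apply.
    exact: cvg_cst.
  have cw : {within `[0, +oo[, continuous (fun t : R => W t w i 0)}.
    by have := contra_not (@subN w) wN => /contrapT; apply.
  apply: cvgM; last exact: cvg_cst.
  have near0 : \forall r \near s, `[0, +oo[%classic (Num.max (r : R) 0).
    apply: (@filterE _ (nbhs s) _) => r.
    by rewrite /= in_itv/= andbT max0.
  exact: (max0_continuous cw near0).
- by move=> i s w; rewrite /g (max_l (max0 s)).
- move=> i s; apply/integrableP; split.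
    by apply/measurable_EFinP; under eq_fun do rewrite expr2; exact: measurable_funM.
  under eq_integral do rewrite /= ger0_norm ?sqr_ge0// expr2.
  have -> : g i s = g i (Num.max s 0) by apply/funext => w; rewrite /g (max_l (max0 s)).
  by rewrite covE// ltry.
- split => [i s s0|i j s r s0 r0]; last by rewrite /Rintegral covE.
  have := mean s i s0; rewrite unlock => E.
  rewrite /Rintegral (_ : (\int[P]_w (g i s w)%:E)%E = 0%E)// -E.
  apply: ae_eq_integral => //.
  + exact/measurable_EFinP.
  + by apply/measurable_EFinP; exact: mW.
  + by apply: filterS gW => w hw _; rewrite hw.
Qed.

Variable g : 'I_2 -> R -> T -> R.
Hypothesis g_reg : regular_fBm g.

Let s2H : 0 < 2 * H. Proof. by rewrite mulr_gt0. Qed.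

Let g_var i s : 0 <= s -> \int[P]_w (g i s w ^+ 2) = phi (2 * H) s.
Proof.
move=> s0; have [_ _ _ _ [_ hc]] := g_reg.
under eq_Rintegral do rewrite expr2.
by rewrite hc// eqxx mul1r /Rcov subrr phi0// subr0; field.
Qed.

Lemma cL2_relaxed_fBm i c t : 0 <= t -> cL2 P (relaxed (g i) t c).
Proof.
move=> t0; have [h1 h2 h3 h4 _] := g_reg.
exact: (cL2_relaxed (h1 i) (h2 i) (h3 i) (h4 i) (g_var i) (phi_cont s2H) c t0).
Qed.

Let cL2_g i s : cL2 P (fun w => (g i s w)%:C).
Proof. by have [h1 _ _ h4 _] := g_reg; apply: cL2_real; split. Qed.

Lemma relaxed_mean i c t : 0 <= t -> cintegral P [set: T] (relaxed (g i) t c) = 0.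
Proof.
move=> t0; have [h1 h2 h3 h4 [h5 _]] := g_reg.
have := @expectation_relaxed _ _ _ _ _ _ (h1 i) (h2 i) (h3 i) (h4 i) (g_var i) (phi_cont s2H)
  t c t0 (fun=> 1) (fun=> 0) (cL2_cst P 1) (@ccont_cst R 0).
have -> : (fun w => 1 * relaxed (g i) t c w) = relaxed (g i) t c.
  by apply/funext => w; rewrite mul1r.
move=> ->.
  rewrite /relax add0r (_ : (fun v : R => cexp (- c * v%:C) * 0) = fun v => 0 * cexp (- c * v%:C)).
    by rewrite cprimM ?mul0r ?mulr0//; exact: ccont_expM.
  by apply/funext => v; rewrite mulr0 mul0r.
move=> v /andP[v0 _].
apply: complex_eq => /=.
  by rewrite -[RHS](h5 i v v0); apply: eq_Rintegral => w _; ring.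
by rewrite /Rintegral integral0_eq// => w _; congr _%:E; ring.
Qed.

(** expectation_relaxed is applied in each variable in turn. *)
Lemma relaxed_cov i j a b t t' : 0 <= t -> 0 <= t' ->
  cintegral P [set: T] (fun w => relaxed (g i) t a w * relaxed (g j) t' b w) =
  (i == j)%:R * relax2 (2 * H) a b t t'.
Proof.
move=> t0 t'0; have [h1 h2 h3 h4 [_ h6]] := g_reg.
pose delta : C := (i == j)%:R.
have cR v : ccont (fun r => (Rcov (2 * H) v r)%:C).
  apply: ccont_real => r; rewrite /Rcov; apply: cvgM; last exact: cvg_cst.
  apply: cvgB.
    by apply: cvgD; [exact: cvg_cst|exact: phi_cont].
  apply: (@continuous_comp _ _ _ (fun w => v - w) (phi (2 * H))); last exact: phi_cont.
  by apply: is_derive_continuous; exact: is_derive_opp_shift.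
have step1 v : 0 <= v ->
    cintegral P [set: T] (fun w => relaxed (g j) t' b w * (g i v w)%:C) =
    delta * relax b (fun r => (Rcov (2 * H) v r)%:C) t'.
  move=> v0.
  have := @expectation_relaxed _ _ _ _ _ _ (h1 j) (h2 j) (h3 j) (h4 j) (g_var j) (phi_cont s2H)
    t' b t'0 _ (fun r => delta * (Rcov (2 * H) v r)%:C) (cL2_g i v)
    (ccontM (@ccont_cst R delta) (cR v)).
  rewrite relaxZ; last exact: cR.
  have -> : (fun w => (g i v w)%:C * relaxed (g j) t' b w) =
      (fun w => relaxed (g j) t' b w * (g i v w)%:C) by apply/funext => w; rewrite mulrC.
  apply => r /andP[r0 _].
  apply: complex_eq => /=.
    have -> : Re (delta * (Rcov (2 * H) v r)%:C) = (i == j)%:R * Rcov (2 * H) v r.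
      by rewrite /delta; case: (i == j); rewrite Re_M /=; ring.
    by rewrite -h6//; apply: eq_Rintegral => w _; ring.
  have -> : Im (delta * (Rcov (2 * H) v r)%:C) = 0.
    by rewrite /delta; case: (i == j); rewrite Im_M /=; ring.
  by rewrite /Rintegral integral0_eq// => w _; congr _%:E; ring.
have := @expectation_relaxed _ _ _ _ _ _ (h1 i) (h2 i) (h3 i) (h4 i) (g_var i) (phi_cont s2H)
  t a t0 _ _ (cL2_relaxed_fBm j b t'0)
  (ccontM (@ccont_cst R delta) (@ccont_relax_Rcov R (2 * H) s2H b t')).
rewrite relaxZ; last exact: ccont_relax_Rcov.
rewrite -/(relax2 (2 * H) a b t t').
have -> : (fun w => relaxed (g j) t' b w * relaxed (g i) t a w) =
    (fun w => relaxed (g i) t a w * relaxed (g j) t' b w) by apply/funext => w; rewrite mulrC.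
by apply => v /andP[v0 _]; exact: step1.
Qed.

Lemma relaxed_ccov i j a b t t' : 0 <= t -> 0 <= t' ->
  ccov P (relaxed (g i) t a) (relaxed (g j) t' b) = (i == j)%:R * relax2 (2 * H) a b t t'.
Proof.
by move=> t0 t'0; rewrite /ccov relaxed_cov// relaxed_mean// mul0r subr0.
Qed.

End RegularFBm.

(** * Stationary covariance of the solution *)

Section ConjugateRelaxation.
Variable R : realType.
Local Notation C := R[i].

Lemma conjcD (a b : C) : conjc (a + b) = conjc a + conjc b. Proof. exact: rmorphD. Qed.
Lemma conjcM (a b : C) : conjc (a * b) = conjc a * conjc b. Proof. exact: rmorphM. Qed.
Lemma conjcN (a : C) : conjc (- a) = - conjc a. Proof. exact: rmorphN. Qed.
Lemma conjc_sum (I : Type) (r : seq I) (F : I -> C) :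
  conjc (\sum_(i <- r) F i) = \sum_(i <- r) conjc (F i).
Proof. exact: rmorph_sum. Qed.

Lemma cder_conj (f : R -> C) x (l : C) : cder f x l -> cder (fun t => conjc (f t)) x (conjc l).
Proof.
move=> [h1 h2]; split.
  have -> : (fun t => Re (conjc (f t))) = (fun t => Re (f t)) by apply/funext => t; rewrite Re_conj.
  by rewrite Re_conj.
have -> : (fun t => Im (conjc (f t))) = (- (fun t => Im (f t))).
  by apply/funext => t; rewrite Im_conj.
by rewrite Im_conj; exact: is_deriveN.
Qed.

(** The second factor of the covariance is conjugated: it is again a relaxation, with
    the conjugate rate. *)
Lemma conjc_relax (c : C) (h : R -> C) t : ccont h ->
  conjc (relax c h t) = relax (conjc c) (fun s => conjc (h s)) t.
Proof.
move=> ch; have ce := @ccont_expm R c _ ch.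
have cch : ccont (fun s => conjc (h s)) by move=> s; exact: (cvgC_conj (ch s)).
have E : cprim (fun v => cexp (- conjc c * v%:C) * conjc (h v)) t =
    conjc (cprim (fun v => cexp (- c * v%:C) * h v) t).
  rewrite (@cprim_uniqueT R _ (fun s => conjc (cprim (fun v => cexp (- c * v%:C) * h v) s))).
  - by rewrite cprim_0 rmorph0 subr0.
  - exact: ccont_expm.
  - move=> s.
    have -> : cexp (- conjc c * s%:C) * conjc (h s) = conjc (cexp (- c * s%:C) * h s).
      by rewrite conjcM -cexp_conj conjcM conjcN conjc_real.
    by apply: cder_conj; exact: (cder_cprim s ce).
by rewrite /relax E conjcD conjcM [conjc (c * _)]conjcM -cexp_conj conjcM conjc_real.
Qed.

End ConjugateRelaxation.

Section DualBasis.
Variable R : realType.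
Local Notation C := R[i].
Variables (e es : 'I_2 -> 'cV[C]_2).
Hypothesis e_es : forall j k, cdot (e j) (es k) = (j == k)%:R.

Lemma cdot_conj (u v : 'cV[C]_2) : conjc (cdot u v) = cdot v u.
Proof.
rewrite !cdotE rmorph_sum; apply: eq_bigr => i _.
by rewrite rmorphM /= conjcK mulrC.
Qed.

(** The matrices of e and es are inverse to each other on one side, hence on both. *)
Lemma cdot_dual_basis (v w : 'cV[C]_2) :
  cdot v w = \sum_j conjc (cdot w (e j)) * cdot v (es j).
Proof.
pose E : 'M[C]_2 := \matrix_(j, a) e j a 0.
pose F : 'M[C]_2 := \matrix_(a, k) conjc (es k a 0).
have EF : E *m F = 1%:M.
  apply/matrixP => j k; rewrite !mxE -e_es cdotE.
  by apply: eq_bigr => a _; rewrite !mxE.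
have FE := mulmx1C EF.
have D a b : \sum_j conjc (es j a 0) * e j b 0 = (a == b)%:R.
  have := congr1 (fun X : 'M[C]_2 => X a b) FE; rewrite !mxE => <-.
  by apply: eq_bigr => j _; rewrite !mxE.
have D00 := D 0 0; have D01 := D 0 1; have D10 := D 1 0; have D11 := D 1 1.
rewrite !sum2E /= in D00 D01 D10 D11.
rewrite sum2E !cdot_conj !cdotE !sum2E.
transitivity (v 0 0 * conjc (w 0 0) * (conjc (es 0 0 0) * e 0 0 0 + conjc (es 1 0 0) * e 1 0 0)
  + v 0 0 * conjc (w 1 0) * (conjc (es 0 0 0) * e 0 1 0 + conjc (es 1 0 0) * e 1 1 0)
  + v 1 0 * conjc (w 0 0) * (conjc (es 0 1 0) * e 0 0 0 + conjc (es 1 1 0) * e 1 0 0)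
  + v 1 0 * conjc (w 1 0) * (conjc (es 0 1 0) * e 0 1 0 + conjc (es 1 1 0) * e 1 1 0)).
  by rewrite D00 D01 D10 D11; ring.
by ring.
Qed.

End DualBasis.

Section StationaryCovariance.
Context d (T : measurableType d) (R : realType) (P : probability T R).
Local Notation C := R[i].
Variables (H : R) (M S : 'M[R]_2) (z : 'I_2 -> C) (e es : 'I_2 -> 'cV[C]_2).
Variables (W : R -> T -> 'cV[R]_2) (x0 : 'cV[R]_2) (x : R -> T -> 'cV[R]_2).
Hypotheses (H_gt0 : 0 < H)
  (MT_es : forall j, (mxC M)^T *m es j = conjc (z j) *: es j)
  (e_es : forall j k, cdot (e j) (es k) = (j == k)%:R)
  (x_sol : solution P M S W x0 x).

Let Q := mxC (S *m S^T).

Let cmx (t : R) (v : 'cV[C]_2) : 0 <= t -> cmeasurable (fun w => cdot (mxC (x t w)) v).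
Proof.
move=> t0; have [mx _] := x_sol; split.
  have -> : (fun w => Re (cdot (mxC (x t w)) v)) =
      (fun w => x t w 0 0 * Re (v 0 0) + x t w 1 0 * Re (v 1 0)).
    by apply/funext => w; rewrite cdotE sum2E Re_D !Re_M !mxE !Re_conj /=; ring.
  by apply: measurable_funD; apply: measurable_funM => //; exact: mx.
have -> : (fun w => Im (cdot (mxC (x t w)) v)) =
    (fun w => x t w 0 0 * - Im (v 0 0) + x t w 1 0 * - Im (v 1 0)).
  by apply/funext => w; rewrite cdotE sum2E Im_D !Im_M !mxE !Im_conj /=; ring.
by apply: measurable_funD; apply: measurable_funM => //; exact: mx.
Qed.

Let cmeasurable_conj (X : T -> C) : cmeasurable X -> cmeasurable (fun w => conjc (X w)).
Proof.
move=> [h1 h2]; split.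
  have -> // : (fun w => Re (conjc (X w))) = (fun w => Re (X w)).
  by apply/funext => w; rewrite Re_conj.
have -> : (fun w => Im (conjc (X w))) = (fun w => - Im (X w)).
  by apply/funext => w; rewrite Im_conj.
exact: measurable_funN.
Qed.

Variable g : 'I_2 -> R -> T -> R.
Hypotheses (g_reg : regular_fBm P H g)
  (Wg : {ae P, forall w, forall (s : R) i, 0 <= s -> W s w i 0 = g i s w}).

Let ka j i : C := \sum_a (S a i)%:C * conjc (es j a 0).
Let uc j t : C := cexp (z j * t%:C) * cdot (mxC x0) (es j).
Let U j t w : C := uc j t + \sum_i ka j i * relaxed (g i) t (z j) w.
Let Uc j t w : C := conjc (uc j t) + \sum_i conjc (ka j i) * relaxed (g i) t (conjc (z j)) w.

Let cL2_ua (t : R) c : 0 <= t -> forall k : 'I_2 -> C, forall u : C, cL2 P (fun w => u +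
  \sum_i k i * relaxed (g i) t c w).
Proof.
move=> t0 k u; apply: cL2D; first exact: cL2_cst.
by apply: cL2_sum => i; apply: cL2Z; exact: (cL2_relaxed_fBm H_gt0 g_reg).
Qed.

Let cg i w : ccont (fun s => (g i s w)%:C).
Proof. by apply: ccont_real; have [_ + _ _ _] := g_reg; apply. Qed.

Let UcE j t w : conjc (U j t w) = Uc j t w.
Proof.
rewrite /U /Uc conjcD conjc_sum; congr (_ + _); apply: eq_bigr => i _.
rewrite conjcM; congr (_ * _).
rewrite /relaxed conjc_relax; last exact: cg.
by congr relax; apply/funext => s; rewrite conjc_real.
Qed.

Let xU : {ae P, forall w, forall j (t : R), 0 <= t -> cdot (mxC (x t w)) (es j) = U j t w}.
Proof.
have [_ hx] := x_sol; apply: filterS2 hx Wg => w hx hW j t t0.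
pose wp s : 'cV[R]_2 := \col_i g i s w.
have wpc i : continuous (fun s => wp s i 0).
  have -> : (fun s => wp s i 0) = (fun s => g i s w) by apply/funext => s; rewrite mxE.
  by have [_ + _ _ _] := g_reg; apply.
have x_int s : 0 <= s -> forall i, lebesgue_measure.-integrable `[0, s]
    (EFin \o (fun r : R => (M *m x r w) i 0)) by move=> /hx[].
have x_eq s : 0 <= s -> x s w = x0
   + \col_i (\int[lebesgue_measure]_(r in `[0, s]) ((M *m x r w) i 0)) + S *m wp s.
  move=> s0; have [_ ->] := hx s s0; congr (_ + S *m _).
  by apply/matrixP => i k; rewrite ord1 hW// mxE.
rewrite (langevin_path wpc x_int x_eq (MT_es j) t0) /U; congr (_ + _).
have -> : (fun s => cdot (mxC (S *m wp s)) (es j)) =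
    (fun s => ka j 0 * (g 0 s w)%:C + ka j 1 * (g 1 s w)%:C).
  apply/funext => s; rewrite cdotE sum2E !mxE !sum2E !mxE /ka !sum2E.
  by rewrite !real_complexD !real_complexM; ring.
have ck i : ccont (fun s => ka j i * (g i s w)%:C).
  by apply: ccontM; [exact: ccont_cst|exact: cg].
by rewrite (relaxD _ _ (ck 0) (ck 1)) (relaxZ _ _ _ (@cg 0 w)) (relaxZ _ _ _ (@cg 1 w)) sum2E.
Qed.

Let kaQ j k : \sum_i ka j i * conjc (ka k i) = cdot (es k) (Q *m es j).
Proof.
rewrite /Q cdotE /ka.
do 12?rewrite ?sum2E ?mxE.
rewrite !(conjcD, conjcM, conjcK, conjc_real, real_complexD, real_complexM).
ring.
Qed.

Let ccov_U j k t t' : 0 <= t -> 0 <= t' -> ccov P (U j t) (Uc k t') =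
  cdot (es k) (Q *m es j) * relax2 (2 * H) (z j) (conjc (z k)) t t'.
Proof.
move=> t0 t'0.
have cR i c s : 0 <= s -> cL2 P (relaxed (g i) s c) by exact: (cL2_relaxed_fBm H_gt0 g_reg).
have cRk i c s (k0 : C) : 0 <= s -> cL2 P (fun w => k0 * relaxed (g i) s c w).
  by move=> s0; apply: cL2Z; exact: cR.
have drop (u : C) (X Y : T -> C) : cL2 P X -> cL2 P Y -> ccov P (fun w => u + X w) Y = ccov P X Y.
  by move=> hX hY; rewrite ccovDl ?ccov_cstl ?add0r//; exact: cL2_cst.
have cS (k0 : 'I_2 -> C) c s : 0 <= s -> cL2 P (fun w => \sum_i k0 i * relaxed (g i) s c w).
  by move=> s0; apply: cL2_sum => i; exact: cRk.
rewrite /U drop; [|exact: cS|exact: cL2_ua].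
rewrite ccovC /Uc drop; [|exact: (cS (fun i => conjc (ka k i)))|exact: (cS (ka j))].
rewrite ccovC ccov_suml; [|by move=> i; exact: cRk|exact: cS].
rewrite -kaQ mulr_suml; apply: eq_bigr => i _.
rewrite ccovZl; [|exact: cR|exact: cS].
rewrite ccovC ccov_suml; [|by move=> i'; exact: cRk|exact: cR].
rewrite (bigD1 i)//= [X in _ + X]big1 => [|i' /negbTE ii'].
  rewrite ccovZl; [|exact: cR|exact: cR].
  by rewrite ccovC (relaxed_ccov H_gt0 g_reg)// eqxx mul1r addr0 mulrA.
rewrite ccovZl; [|exact: cR|exact: cR].
by rewrite ccovC (relaxed_ccov H_gt0 g_reg)// eq_sym ii' mul0r mulr0.
Qed.

(** Both test vectors are expanded in the basis es. Along es j the solution is a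
    constant plus the relaxations of the two coordinates of the noise, with weights
    whose products sum up to the form of Q. *)
Lemma Vt_relax2 (tau : R) (w1 w2 : 'cV[C]_2) (t : R) : 0 <= tau -> 0 <= t ->
  Vt P x tau w1 w2 t = \sum_j \sum_k conjc (cdot w1 (e j)) * cdot w2 (e k)
     * (cdot (es k) (Q *m es j) * relax2 (2 * H) (z j) (conjc (z k)) t (t + tau)).
Proof.
move=> tau0 t0; have t'0 : 0 <= t + tau by exact: addr_ge0.
have cU j s : 0 <= s -> cL2 P (U j s) by move=> s0; exact: cL2_ua.
have cUc j s : 0 <= s -> cL2 P (Uc j s) by move=> s0; exact: cL2_ua.
have cUk j s (k0 : C) : 0 <= s -> cL2 P (fun w => k0 * U j s w) by move=> ?; exact/cL2Z/cU.
have cUck j s (k0 : C) : 0 <= s -> cL2 P (fun w => k0 * Uc j s w) by move=> ?; exact/cL2Z/cUc.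
have cS s (k0 : 'I_2 -> C) : 0 <= s -> cL2 P (fun w => \sum_j k0 j * U j s w).
  by move=> s0; apply: cL2_sum => i; exact: cUk.
have cSc s (k0 : 'I_2 -> C) : 0 <= s -> cL2 P (fun w => \sum_j k0 j * Uc j s w).
  by move=> s0; apply: cL2_sum => i; exact: cUck.
rewrite Vt_ccov (@ae_eq_ccov _ _ _ P _ (fun w => \sum_j conjc (cdot w1 (e j)) * U j t w)
  _ (fun w => \sum_j cdot w2 (e j) * Uc j (t + tau) w)).
- rewrite ccov_suml; [|by move=> i; exact: cUk|exact: cSc].
  apply: eq_bigr => j _; rewrite ccovZl; [|exact: cU|exact: cSc].
  rewrite ccovC ccov_suml; [|by move=> i; exact: cUck|exact: cU].
  rewrite mulr_sumr; apply: eq_bigr => k _; rewrite ccovZl; [|exact: cUc|exact: cU].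
  by rewrite ccovC ccov_U// mulrA.
- exact: cmx.
- by apply: cL2_cmeasurable; exact: cS.
- by apply: cmeasurable_conj; exact: cmx.
- by apply: cL2_cmeasurable; exact: cSc.
- apply: filterS xU => w h; rewrite (cdot_dual_basis e_es).
  by apply: eq_bigr => j _; rewrite h.
- apply: filterS xU => w h; rewrite (cdot_dual_basis e_es) conjc_sum.
  by apply: eq_bigr => j _; rewrite h// conjcM conjcK UcE.
Qed.

End StationaryCovariance.

Section StationaryLimit.
Context d (T : measurableType d) (R : realType) (P : probability T R).
Local Notation C := R[i].
Variables (H : R) (M S : 'M[R]_2) (z : 'I_2 -> C) (e es : 'I_2 -> 'cV[C]_2).
Variables (W : R -> T -> 'cV[R]_2) (x0 : 'cV[R]_2) (x : R -> T -> 'cV[R]_2).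
Hypotheses (H_gt0 : 0 < H) (H_le1 : H <= 1) (z_neg : forall j, Re (z j) < 0)
  (MT_es : forall j, (mxC M)^T *m es j = conjc (z j) *: es j)
  (e_es : forall j k, cdot (e j) (es k) = (j == k)%:R)
  (W_fBm : fBm P H W) (x_sol : solution P M S W x0 x).

Let Q := mxC (S *m S^T).

Lemma cvg_Vt (tau : R) (w1 w2 : 'cV[C]_2) : 0 <= tau ->
  (Vt P x tau w1 w2 t : C^o) @[t --> +oo] -->
  (\sum_j \sum_k conjc (cdot w1 (e j)) * cdot w2 (e k)
     * (cdot (es k) (Q *m es j) *
       ((- z j - conjc (z k))^-1 * H%:C * Pcov (z j) (z k) H tau)) : C^o).
Proof.
move=> tau0; have [g g_reg Wg] := fBm_regular W_fBm.
have L j k := cvg_relax2_Pcov H_gt0 H_le1 tau0 (z_neg j) (z_neg k).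
have FF : Filter (+oo : set_system R) by exact: _.
pose F j k t := conjc (cdot w1 (e j)) * cdot w2 (e k) *
  (cdot (es k) (Q *m es j) * relax2 (2 * H) (z j) (conjc (z k)) t (t + tau)).
have Lk j k : (F j k t : C^o) @[t --> +oo] --> (conjc (cdot w1 (e j)) * cdot w2 (e k) *
  (cdot (es k) (Q *m es j) * ((- z j - conjc (z k))^-1 * H%:C * Pcov (z j) (z k) H tau)) : C^o).
  by apply: cvgCMl; apply: cvgCMl; exact: L.
have LS : (\sum_j \sum_k F j k t : C^o) @[t --> +oo] --> (\sum_j \sum_k
    conjc (cdot w1 (e j)) * cdot w2 (e k) *
    (cdot (es k) (Q *m es j) * ((- z j - conjc (z k))^-1 * H%:C * Pcov (z j) (z k) H tau)) : C^o).
  have -> : (fun t => \sum_j \sum_k F j k t) = (fun t => F 0 0 t + F 0 1 t + (F 1 0 t + F 1 1 t)).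
    by apply/funext => t; rewrite sum2E; congr (_ + _); exact: sum2E.
  by rewrite !sum2E; apply: cvgCD; apply: cvgCD; exact: Lk.
apply: cvg_trans LS; apply: near_eq_cvg; near=> t.
have t0 : 0 <= t by near: t; exact: nbhs_pinfty_ge.
by rewrite (Vt_relax2 H_gt0 MT_es e_es x_sol g_reg Wg).
Unshelve. all: by end_near. Qed.

Lemma VinfE (tau : R) (w1 w2 : 'cV[C]_2) : 0 <= tau ->
  Vinf P x tau w1 w2 = \sum_j \sum_k conjc (cdot w1 (e j)) * cdot w2 (e k)
     * (cdot (es k) (Q *m es j) *
       ((- z j - conjc (z k))^-1 * H%:C * Pcov (z j) (z k) H tau)).
Proof. by move=> tau0; rewrite /Vinf; apply: (@cvg_lim C^o); [exact: norm_hausdorff|exact: cvg_Vt]. Qed.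

Lemma Vinf_dual (tau : R) j1 j2 : 0 <= tau ->
  Vinf P x tau (es j1) (es j2) = (- z j1 - conjc (z j2))^-1 * H%:C
    * cdot (es j2) (Q *m es j1) * Pcov (z j1) (z j2) H tau.
Proof.
move=> tau0; rewrite VinfE// (bigD1 j1)//= [X in _ + X]big1 => [|j /negbTE jj1]; last first.
  by apply: big1 => k _; rewrite cdot_conj e_es jj1 !mul0r.
rewrite (bigD1 j2)//= [X in _ + X + _]big1 => [|k /negbTE kj2]; last first.
  by rewrite -[cdot (es j2) _]cdot_conj e_es kj2 rmorph0 mulr0 mul0r.
by rewrite -[cdot (es j2) (e _)]cdot_conj cdot_conj !e_es !eqxx rmorph1; ring.
Qed.

End StationaryLimit.

(** * Behaviour at the critical parameter *)

Section OrderOfMagnitude.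
Variable R : realType.

Lemma asymp_left_cvg (ls L : R) (b1 b2 : R -> R) : 0 < L ->
  `| b1 l / b2 l | @[l --> ls^'-] --> L -> asymp_left ls b1 b2.
Proof.
move=> L0 cvgL; rewrite /asymp_left; set r := fun l => (`| b1 l / b2 l |)%:E.
have FF : ProperFilter (ls^'-) by exact: _.
split.
- rewrite limf_einfE; apply: (@lt_le_trans _ _ (L / 2)%:E).
    by rewrite lte_fin divr_gt0.
  apply: (@le_trans _ _ (ereal_inf (r @` [set l | L / 2 < `| b1 l / b2 l |]))).
    by apply: le_ereal_inf_tmp => _ /= [l h <-]; rewrite lee_fin ltW.
  apply: ereal_sup_ubound; exists [set l | L / 2 < `| b1 l / b2 l |] => //.
  by apply: (cvgr_gt _ cvgL); rewrite ltr_pdivrMr// ltr_pMr// ltr1n.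
- rewrite limf_einfE limf_esupE.
  apply: ge_ereal_sup => _ /= [V FV <-]; apply: le_ereal_inf_tmp => _ /= [V' FV' <-].
  have [l [Vl V'l]] := filter_ex (filterI FV FV').
  apply: (@le_trans _ _ (r l)).
    by apply: ereal_inf_lbound; exists l.
  by apply: ereal_sup_ubound; exists l.
- rewrite limf_esupE; apply: (@le_lt_trans _ _ (L + 1)%:E); last exact: ltry.
  apply: (@le_trans _ _ (ereal_sup (r @` [set l | `| b1 l / b2 l | < L + 1]))).
    apply: ereal_inf_lbound; exists [set l | `| b1 l / b2 l | < L + 1] => //.
    by apply: (cvgr_lt _ cvgL); rewrite ltrDl.
  by apply: ge_ereal_sup => _ /= [l h <-]; rewrite lee_fin ltW.
Qed.

Lemma within_cvg_left (U : topologicalType) (f : R -> U) (ls : R) :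
  {within `]-oo, ls], continuous f} -> f l @[l --> ls^'-] --> f ls.
Proof.
move=> /subspace_continuousP cf.
have := cf ls; rewrite /= in_itv/= lexx => /(_ isT) h.
apply: cvg_trans h; apply: cvg_app => A /=; rewrite /within /= => hA.
rewrite !nbhs_simpl /= in hA *; apply: filterS hA => l h ll; apply: h.
by rewrite in_itv/= ltW.
Qed.

End OrderOfMagnitude.

Section PowerLimits.
Variable R : realType.
Local Notation C := R[i].

(** Off the real axis the sign of the imaginary part is locally constant and the
    cosine of the argument stays away from -1 and 1, where acos is continuous. *)
Lemma cvg_carg (T : Type) (F : set_system T) (FF : Filter F) (f : T -> C) (z : C) :
  Im z != 0 -> (f t : C^o) @[t --> F] --> (z : C^o) -> carg (f t) @[t --> F] --> carg z.
Proof.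
move=> z0 fz; have /cvgC_parts[fR fI] := fz.
have nz : z != 0 by apply: contraNneq z0 => ->.
have cz : 0 < cabs z by rewrite cabs_gt0.
have qI : -1 < Re z / cabs z < 1.
  rewrite -ltr_norml normrM normfV (ger0_norm (cabs_ge0 z)) (ltr_pdivrMr _ _ cz) mul1r.
  rewrite -(@ltr_pXn2r _ 2)// ?nnegrE ?cabs_ge0// real_normK ?num_real// cabs_sqr ltrDl.
  by rewrite lt_neqAle sqr_ge0 andbT eq_sym sqrf_eq0.
have h : acos (Re (f t) / cabs (f t)) @[t --> F] --> acos (Re z / cabs z).
  apply: (continuous_cvg _ (continuous_acos qI)).
  by apply: cvgM => //; apply: cvgV; [rewrite gt_eqF|exact: cvgC_cabsE].
rewrite {2}/carg; case: ifPn => [Iz|]; last rewrite -ltNge => Iz.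
  have Iz' : 0 < Im z by rewrite lt_neqAle eq_sym z0.
  apply: cvg_trans h; apply: near_eq_cvg.
  have : \forall t \near F, 0 < Im (f t) by exact: (cvgr_gt _ fI).
  by apply: filterS => t ht; rewrite /carg ltW.
apply: cvg_trans (cvgN h); apply: near_eq_cvg.
have : \forall t \near F, Im (f t) < 0 by exact: (cvgr_lt _ fI).
by apply: filterS => t ht; rewrite /carg leNgt ht.
Qed.

Lemma cvg_cpow (T : Type) (F : set_system T) (FF : Filter F) (f : T -> C) (z : C) (q : R) :
  Im z != 0 -> (f t : C^o) @[t --> F] --> (z : C^o) ->
  (cpow (f t) q : C^o) @[t --> F] --> (cpow z q : C^o).
Proof.
move=> z0 fz.
have nz : z != 0 by apply: contraNneq z0 => ->.
have cz : 0 < cabs z by rewrite cabs_gt0.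
rewrite /cpow; apply: cvgC_cexp; apply/cvgC_parts; split => /=.
  apply: cvgM; first exact: cvg_cst.
  by apply: (continuous_cvg _ (continuous_ln cz)); exact: cvgC_cabsE.
by apply: cvgM; [exact: cvg_cst|exact: cvg_carg].
Qed.

(** The arguments of iy and - iy are pi/2 and - pi/2, in some order. *)
Lemma cpow_vertD (y q : R) : y != 0 ->
  cpow (0 +i* y) q + cpow (0 +i* (- y)) q = (2 * `|y| `^ q * cos (q * (pi / 2)))%:C.
Proof.
wlog y0 : y / 0 < y => [hw yn|_].
  case: (ltgtP y 0) yn => // [yn|yp] _; last by apply: hw => //; rewrite gt_eqF.
  have := hw (- y); rewrite opprK normrN addrC; apply; first by rewrite oppr_gt0.
  by rewrite oppr_eq0 lt_eqF.
have ny : (0 <= - y) = false by rewrite oppr_ge0 leNgt y0.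
have cy (x : R) : cabs (0 +i* x) = `|x| by rewrite cabsE /= expr0n add0r sqrtr_sqr.
rewrite /cpow /carg !cy /= normrN mul0r acos0 ny (ltW y0).
have -> : `|y| `^ q = expR (q * ln `|y|) by rewrite /powR normr_eq0 gt_eqF.
apply: complex_eq; rewrite ?Re_D ?Im_D ?Re_cexp ?Im_cexp /=.
  by rewrite mulrN cosN; ring.
by rewrite mulrN sinN; ring.
Qed.

End PowerLimits.

Section GammaPositive.
Variable R : realType.
Local Notation C := R[i].

(** s Gamma(s) is the limit of a nondecreasing primitive that is positive at 1. *)
Lemma Gamma_neq0 (s : R) : 0 < s -> s <= 3 -> Gamma s != 0.
Proof.
move=> s0 s3; apply/eqP => G0.
have := Gamma_lap s0 s3; rewrite G0 mulr0 => G1.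
pose f v := expR (- v) * phi s v.
have cf : continuous f.
  move=> v; apply: cvgM; last exact: phi_cont.
  by apply: continuous_comp; [exact: opp_continuous|exact: continuous_expR].
have fE : (fun v : R => Re (cexp (- 1 * v%:C) * (phi s v)%:C)) = f.
  apply/funext => v; rewrite Re_M /= Re_cexp Re_M Im_M /= !mulr0 subr0.
  have -> : 0 + - 0 * v = 0 by ring.
  rewrite cos0 mulr1 (_ : -1 * v - 0 = - v)//.
  by ring.
have f0 v : 0 <= f v by rewrite mulr_ge0 ?expR_ge0// phi_ge0.
have fpos v : 0 < v -> 0 < f v.
  by move=> v0; rewrite mulr_gt0 ?expR_gt0// /phi gtr0_norm// powR_gt0.
have mvt a b : a < b -> exists2 c, c \in `]a, b[ & prim f b - prim f a = f c * (b - a).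
  move=> ab; apply: (MVT ab) => [c _|]; first exact: is_derive_prim.
  by apply: continuous_subspaceT => c; apply: is_derive_continuous; exact: is_derive_prim.
have [c c1 E1] := mvt 0 1 ltr01.
have p1 : 0 < prim f 1.
  move: E1; rewrite prim0 !subr0 mulr1 => ->; apply: fpos.
  by move: c1; rewrite in_itv/= => /andP[].
have r1 : 0 < Re (1 : C) by exact: ltr01.
have /cvgC_parts[h _] := cvg_tlap s0 s3 r1.
have : \forall t \near +oo, prim f t < prim f 1.
  have h' : prim f t @[t --> +oo] --> Re (lap s 1) by rewrite -fE; exact: h.
  by apply: (cvgr_lt _ h'); rewrite -G1.
move=> /(filterI (nbhs_pinfty_gt (num_real (1 : R)))) /filter_ex[t [t1]]; apply/negP.
have [r _ E] := mvt 1 t t1.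
by rewrite -leNgt -subr_ge0 E mulr_ge0// subr_ge0 ltW.
Qed.

End GammaPositive.

Section ParameterLimits.
Variable R : realType.
Local Notation C := R[i].
Implicit Types (c z : C) (tau s H : R).

Lemma cabsN z : cabs (- z) = cabs z.
Proof. by rewrite !cabsE Re_N Im_N !sqrrN. Qed.

Lemma cabs_cexp_le z : cabs (cexp z) <= expR (cabs z).
Proof. by rewrite cabs_cexp ler_expR (le_trans (ler_norm _))// ler_Re_cabs. Qed.

Lemma cabs_cexpB1 c (t : R) : 0 <= t ->
  cabs (cexp (c * t%:C) - 1) <= 2 * t * cabs c * expR (cabs c * t).
Proof.
move=> t0.
have E : cexp (c * t%:C) - 1 = cprim (fun x => c * cexp (c * x%:C)) t.
  rewrite (@cprim_uniqueT R _ (fun x => cexp (c * x%:C))).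
  - by rewrite mulr0 cexp0.
  - exact: (ccontM (@ccont_cst R c) (@ccont_expM R c)).
  - by move=> x; exact: cder_expM.
rewrite E.
have -> : 2 * t * cabs c * expR (cabs c * t) = 2 * (cabs c * expR (cabs c * t)) * t by ring.
apply: cprim_le; [exact: t0|exact: (ccontM (@ccont_cst R c) (@ccont_expM R c))|].
move=> x /andP[x0 xt]; rewrite cabsM ler_wpM2l ?cabs_ge0//.
apply: (le_trans (cabs_cexp_le _)); rewrite ler_expR cabsM cabs_real ger0_norm//.
by rewrite ler_wpM2l ?cabs_ge0.
Qed.

(** |e^(-cv) - e^(-c'v)| = |e^(-c'v)| |e^(-(c-c')v) - 1| is small uniformly on
    [0, tau] when c is close to c'. *)
Lemma cabs_tlapB s c c0 tau : 0 < s -> 0 <= tau ->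
  cabs (tlap s c tau - tlap s c0 tau) <=
  2 * (expR (cabs c0 * tau) * (2 * tau * cabs (c - c0) * expR (cabs (c - c0) * tau)) * phi s tau) * tau.
Proof.
move=> s0 tau0.
have cf k := @ccont_expm R k _ (ccont_phi s0).
have cf1 : ccont (fun v => -1 * (cexp (- c0 * v%:C) * (phi s v)%:C)).
  exact: (ccontM (@ccont_cst R (-1)) (cf c0)).
have -> : tlap s c tau - tlap s c0 tau = cprim (fun v => cexp (- c * v%:C) * (phi s v)%:C
    + -1 * (cexp (- c0 * v%:C) * (phi s v)%:C)) tau.
  rewrite (cprimD _ (cf c) cf1) (cprimM _ _ (cf c0)) mulN1r.
  by [].
apply: cprim_le; [exact: tau0|exact: (ccontD (cf c) cf1)|].
move=> v /andP[v0 vt].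
have -> : cexp (- c * v%:C) * (phi s v)%:C + -1 * (cexp (- c0 * v%:C) * (phi s v)%:C) =
    cexp (- c0 * v%:C) * (cexp (- (c - c0) * v%:C) - 1) * (phi s v)%:C.
  have -> : - c * v%:C = - c0 * v%:C + - (c - c0) * v%:C by ring.
  by rewrite cexpD; ring.
rewrite (cabsM _ (phi s v)%:C) (cabsM (cexp _)) (cabs_real (phi s v)) (ger0_norm (phi_ge0 s v)).
apply: ler_pM; rewrite ?mulr_ge0 ?cabs_ge0 ?phi_ge0//; last exact: phi_mono.
apply: ler_pM; rewrite ?cabs_ge0//.
  apply: (le_trans (cabs_cexp_le _)); rewrite ler_expR cabsM cabs_real ger0_norm// cabsN.
  by rewrite ler_wpM2l ?cabs_ge0.
apply: (le_trans (cabs_cexpB1 _ v0)); rewrite cabsN.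
apply: ler_pM; rewrite ?mulr_ge0 ?cabs_ge0 ?expR_ge0//.
  by rewrite ler_wpM2r ?cabs_ge0// ler_wpM2l.
by rewrite ler_expR ler_wpM2l ?cabs_ge0.
Qed.

Lemma cvg_tlap_param (T : Type) (F : set_system T) (FF : Filter F) s tau (f : T -> C) c0 :
  0 < s -> 0 <= tau -> (f t : C^o) @[t --> F] --> (c0 : C^o) ->
  (tlap s (f t) tau : C^o) @[t --> F] --> (tlap s c0 tau : C^o).
Proof.
move=> s0 tau0 /cvgC_cabs h; apply/cvgC_cabs.
apply: (@squeeze_cvgr _ _ _ _ (fun=> 0) (fun t => 2 * (expR (cabs c0 * tau) *
  (2 * tau * cabs (f t - c0) * expR (cabs (f t - c0) * tau)) * phi s tau) * tau)).
- by apply: nearW => t; rewrite cabs_ge0/= cabs_tlapB.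
- exact: cvg_cst.
- have <- : 2 * (expR (cabs c0 * tau) * (2 * tau * 0 * expR (0 * tau)) * phi s tau) * tau = 0.
    by rewrite mulr0 !(mul0r, mulr0).
  apply: cvgM; last exact: cvg_cst.
  apply: cvgM; first exact: cvg_cst.
  apply: cvgM; last exact: cvg_cst.
  apply: cvgM; first exact: cvg_cst.
  apply: cvgM; first by apply: cvgM; [exact: cvg_cst|].
  apply: (continuous_cvg _ (@continuous_expR R (0 * tau))).
  by apply: cvgM; [|exact: cvg_cst].
Qed.

Lemma cvgCN (T : Type) (F : set_system T) (FF : Filter F) (f : T -> C) z :
  (f t : C^o) @[t --> F] --> (z : C^o) -> (- f t : C^o) @[t --> F] --> (- z : C^o).
Proof.
move=> /cvgC_parts[h1 h2]; apply/cvgC_parts; split.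
  by rewrite Re_N; under eq_fun do rewrite Re_N; exact: cvgN.
by rewrite Im_N; under eq_fun do rewrite Im_N; exact: cvgN.
Qed.

(** This form of Pcov extends continuously to the imaginary axis minus 0: the powers
    are continuous there, and tlap is continuous in its exponent. *)
Lemma Pcov_expand H tau alpha beta : 0 < H -> H <= 1 -> 0 <= tau ->
  Re alpha < 0 -> Re beta < 0 ->
  (2 * H)%:C * Pcov alpha beta H tau =
  (alpha + conjc beta) * (phi (2 * H) tau)%:C
  + cexp (conjc beta * tau%:C) * ((2 * H)%:C * (cpow (- conjc beta) (1 - 2 * H)
       * (Gamma (2 * H))%:C) + conjc beta ^+ 2 * tlap (2 * H) (conjc beta) tau)
  + cexp (- alpha * tau%:C) * ((2 * H)%:C * (cpow (- alpha) (1 - 2 * H)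
       * (Gamma (2 * H))%:C) - alpha ^+ 2 * tlap (2 * H) (- alpha) tau).
Proof.
move=> H0 H1 tau0 a0 b0; rewrite PcovE//.
have s0 : 0 < 2 * H by rewrite mulr_gt0.
have s2 : 2 * H <= 2 by move: H1; lra.
rewrite !Gamma_term//; [|by rewrite Re_N oppr_gt0|by rewrite Re_N Re_conj oppr_gt0].
by rewrite /Elim /Ilim; ring.
Qed.

Lemma cvg_Pcov (T : Type) (F : set_system T) (FF : Filter F) H tau (a b : T -> C) (a0 b0 : C) :
  0 < H -> H <= 1 -> 0 <= tau -> Im a0 != 0 -> Im b0 != 0 ->
  (\forall t \near F, Re (a t) < 0) -> (\forall t \near F, Re (b t) < 0) ->
  (a t : C^o) @[t --> F] --> (a0 : C^o) -> (b t : C^o) @[t --> F] --> (b0 : C^o) ->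
  ((2 * H)%:C * Pcov (a t) (b t) H tau : C^o) @[t --> F] -->
  ((a0 + conjc b0) * (phi (2 * H) tau)%:C
  + cexp (conjc b0 * tau%:C) * ((2 * H)%:C * (cpow (- conjc b0) (1 - 2 * H)
       * (Gamma (2 * H))%:C) + conjc b0 ^+ 2 * tlap (2 * H) (conjc b0) tau)
  + cexp (- a0 * tau%:C) * ((2 * H)%:C * (cpow (- a0) (1 - 2 * H)
       * (Gamma (2 * H))%:C) - a0 ^+ 2 * tlap (2 * H) (- a0) tau) : C^o).
Proof.
move=> H0 H1 tau0 ia ib na nb ca cb.
have s0 : 0 < 2 * H by rewrite mulr_gt0.
have cbc : (conjc (b t) : C^o) @[t --> F] --> (conjc b0 : C^o) by apply: cvgC_conj.
pose G t := (a t + conjc (b t)) * (phi (2 * H) tau)%:C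
  + cexp (conjc (b t) * tau%:C) * ((2 * H)%:C * (cpow (- conjc (b t)) (1 - 2 * H)
       * (Gamma (2 * H))%:C) + conjc (b t) * conjc (b t) * tlap (2 * H) (conjc (b t)) tau)
  + cexp (- a t * tau%:C) * ((2 * H)%:C * (cpow (- a t) (1 - 2 * H)
       * (Gamma (2 * H))%:C) - a t * a t * tlap (2 * H) (- a t) tau).
apply: (@cvg_trans _ (G t @[t --> F])).
  apply: near_eq_cvg; near=> t.
  by rewrite Pcov_expand ?expr2//; near: t.
rewrite !expr2 /G.
apply: cvgCD; first apply: cvgCD.
- by apply: cvgCM; [apply: cvgCD|exact: cvgC_cst].
- apply: cvgCM; first by apply: cvgC_cexp; apply: cvgCM; [exact: cbc|exact: cvgC_cst].
  apply: cvgCD.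
    apply: cvgCM; first exact: cvgC_cst.
    apply: cvgCM; last exact: cvgC_cst.
    by apply: cvg_cpow; [rewrite Im_N Im_conj opprK|exact: cvgCN].
  apply: cvgCM; first by apply: cvgCM; exact: cbc.
  exact: (cvg_tlap_param FF s0 tau0 cbc).
- apply: cvgCM; first by apply: cvgC_cexp; apply: cvgCM; [exact: cvgCN|exact: cvgC_cst].
  apply: cvgCB.
    apply: cvgCM; first exact: cvgC_cst.
    apply: cvgCM; last exact: cvgC_cst.
    by apply: cvg_cpow; [rewrite Im_N oppr_eq0|exact: cvgCN].
  apply: cvgCM; first by apply: cvgCM; exact: ca.
  exact: (cvg_tlap_param FF s0 tau0 (cvgCN FF ca)).
Unshelve. all: by end_near. Qed.

End ParameterLimits.

Lemma sum2_scaled (F : comRingType) (p q : 'I_2 -> F) (g c : 'I_2 -> 'I_2 -> F) (a : F) :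
  a * (\sum_j \sum_k p j * q k * (g j k * c j k)) =
  p 0 * q 0 * g 0 0 * (a * c 0 0) + p 0 * q 1 * g 0 1 * (a * c 0 1)
  + (p 1 * q 0 * g 1 0 * (a * c 1 0) + p 1 * q 1 * g 1 1 * (a * c 1 1)).
Proof. by rewrite !sum2E; ring. Qed.

Lemma sum2_diag (F : comRingType) (x : 'I_2 -> F) (w : 'I_2 -> 'I_2 -> F) (a : F) :
  a * (\sum_j w j j * x j) =
  w 0 0 * (a * x 0) + w 0 1 * 0 + (w 1 0 * 0 + w 1 1 * (a * x 1)).
Proof. by rewrite sum2E; ring. Qed.

Section Criticality.
Variable R : realType.
Local Notation C := R[i].
Variables (H tau ls : R) (A B : R -> R).
Hypotheses (H_gt0 : 0 < H) (H_lt1 : H < 1) (tau_ge0 : 0 <= tau).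
Hypotheses (A_cont : {within `]-oo, ls], continuous A})
  (B_cont : {within `]-oo, ls], continuous B})
  (A_lt0 : forall l, l < ls -> A l < 0) (A_ls : A ls = 0)
  (B_neq0 : forall l, l <= ls -> B l <> 0).

Let z l j := zeta A B l j.

Lemma zetaE l j : z l j = A l +i* (if j == 0 then B l else - B l).
Proof. by rewrite /z /zeta; case: (j == 0). Qed.

Let Ac : A l @[l --> ls^'-] --> (0 : R).
Proof. by rewrite -A_ls; exact: within_cvg_left. Qed.

Let zc j : (z l j : C^o) @[l --> ls^'-] --> (z ls j : C^o).
Proof.
apply/cvgC_parts; rewrite !zetaE /=; under eq_fun do rewrite zetaE.
under [X in _ /\ (X @ _ --> _)]eq_fun do rewrite zetaE.
split => /=; first exact: within_cvg_left.
by case: (j == 0); [|apply: cvgN]; exact: within_cvg_left.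
Qed.

Let near_left : \forall l \near ls^'-, l < ls.
Proof. by near=> l. Unshelve. all: by end_near. Qed.

Let z_neg l j : l < ls -> Re (z l j) < 0.
Proof. by move=> ll; rewrite zetaE /=; exact: A_lt0. Qed.

Let near_neg j : \forall l \near ls^'-, Re (z l j) < 0.
Proof. by apply: filterS near_left => l; exact: z_neg. Qed.

Let Im_z_ls j : Im (z ls j) != 0.
Proof.
by rewrite zetaE /=; case: (j == 0); rewrite ?oppr_eq0; apply/eqP; exact: B_neq0.
Qed.

Lemma conjc_zeta l j : conjc (z l j) = z l (if j == 0 then 1 else 0).
Proof.
by rewrite !zetaE; case: (j == 0); apply: complex_eq => //=; rewrite opprK.
Qed.

(** Up to a rotation, the limit of |A| times a diagonal coefficient. *)
Let K : R := (Gamma (2 * H) * (`|B ls| `^ (1 - 2 * H) * cos ((1 - 2 * H) * (pi / 2)))) * H.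

Let s_gt0 : 0 < 2 * H. Proof. by rewrite mulr_gt0. Qed.

(** 0 < H < 1 puts the argument of the cosine strictly between - pi/2 and pi/2. *)
Let K_neq0 : K != 0.
Proof.
have B0 : 0 < `|B ls| by rewrite normr_gt0; apply/eqP; exact: B_neq0.
have s3 : 2 * H <= 3 by move: H_lt1; lra.
rewrite /K !mulf_neq0 ?(Gamma_neq0 s_gt0 s3) ?(gt_eqF H_gt0) ?(gt_eqF (powR_gt0 _ B0))//.
rewrite gt_eqF//; apply: cos_gt0_pihalf; have := pi_gt0 R => p0.
have h : `|1 - 2 * H| < 1 by rewrite ltr_norml; move: H_gt0 H_lt1; lra.
rewrite -ltr_norml normrM (ger0_norm (x := pi / 2)); last by rewrite divr_ge0// ltW.
by rewrite gtr_pMl// divr_gt0.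
Qed.

(** For j = k the denominator is - 2 A, so that |A| cancels it. In the limit z is
    imaginary: the truncated transforms cancel each other and the powers of z and of
    its conjugate add up by cpow_vertD. *)
Let cvg_coef_diag j :
  (`|A l|%:C * ((- z l j - conjc (z l j))^-1 * H%:C * Pcov (z l j) (z l j) H tau) : C^o)
    @[l --> ls^'-] --> (K%:C * cexp (conjc (z ls j) * tau%:C) : C^o).
Proof.
have FF : Filter (ls^'- : set_system R) by exact: _.
have H1 := ltW H_lt1.
have h := cvg_Pcov FF H_gt0 H1 tau_ge0 (@Im_z_ls j) (@Im_z_ls j)
  (near_neg j) (near_neg j) (@zc j) (@zc j).
have E0 : - z ls j = conjc (z ls j).
  by rewrite conjc_zeta !zetaE A_ls; case: (j == 0); apply: complex_eq; rewrite /= ?oppr0 ?opprK.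
set L := (X in _ --> X) in h.
have -> : K%:C * cexp (conjc (z ls j) * tau%:C) = (2^-1 / 2)%:C * L.
  rewrite /L {L h}.
  pose y := if j == 0 then - B ls else B ls.
  have y0 : y != 0.
    by rewrite /y; case: (j == 0); rewrite ?oppr_eq0; apply/eqP; exact: B_neq0.
  have yE : `|y| = `|B ls| by rewrite /y; case: (j == 0); rewrite ?normrN.
  have E1 : conjc (z ls j) = 0 +i* y.
    by rewrite zetaE A_ls /y; case: (j == 0) => /=; rewrite ?opprK.
  have E2 : - conjc (z ls j) = 0 +i* (- y).
    by rewrite E1; apply: complex_eq => /=; rewrite ?oppr0.
  have P' : cpow (- conjc (z ls j)) (1 - 2 * H) + cpow (conjc (z ls j)) (1 - 2 * H) =
      (2 * `|B ls| `^ (1 - 2 * H) * cos ((1 - 2 * H) * (pi / 2)))%:C.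
    by rewrite E2 E1 addrC cpow_vertD// yE.
  have zE : z ls j = - conjc (z ls j) by rewrite -E0 opprK.
  rewrite [in RHS]zE conjcN conjcK -[in RHS]zE.
  set cp := conjc (z ls j) in P' *.
  have cpE : - z ls j = cp by exact: E0.
  rewrite -/cp zE -/cp opprK.
  set e := cexp _; set a := cpow _ _ in P' *; set b := cpow _ _ in P' *.
  set N := tlap _ _ _.
  transitivity ((2^-1 / 2)%:C * (2 * H)%:C * (Gamma (2 * H))%:C * (a + b) * e).
    rewrite P' -!real_complexM; congr (_%:C * _).
    by rewrite /K; field.
  ring.
have h' := @cvgCMl _ _ _ FF _ (2^-1 / 2)%:C _ h.
apply: cvg_trans h'; apply: near_eq_cvg; near=> l.
have ll : l < ls by near: l; exact: near_left.
have Al := A_lt0 ll.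
have -> : - z l j - conjc (z l j) = (- 2 * A l)%:C.
  by rewrite conjc_zeta !zetaE; case: (j == 0); apply: complex_eq => /=; ring.
rewrite (ltr0_norm Al) -(fmorphV (real_complex R)) /= !mulrA -!real_complexM.
congr (_%:C * _); field.
by rewrite lt_eqF.
Unshelve. all: by end_near. Qed.

(** For j <> k the denominator is - 2 z j, which does not vanish in the limit. *)
Let cvg_coef_off j k : j != k ->
  (`|A l|%:C * ((- z l j - conjc (z l k))^-1 * H%:C * Pcov (z l j) (z l k) H tau) : C^o)
    @[l --> ls^'-] --> (0 : C^o).
Proof.
move=> jk.
have FF : Filter (ls^'- : set_system R) by exact: _.
have H1 := ltW H_lt1.
have h := cvg_Pcov FF H_gt0 H1 tau_ge0 (@Im_z_ls j) (@Im_z_ls k)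
  (near_neg j) (near_neg k) (@zc j) (@zc k).
have E l : - z l j - conjc (z l k) = - 2 * z l j.
  have -> : conjc (z l k) = z l j.
    rewrite conjc_zeta; congr (z l _); move: jk; clear.
    by case: j => [[|[|[]]]//= ?]; case: k => [[|[|[]]]//= ?] _; exact: val_inj.
  by ring.
have zn0 : z ls j != 0 by apply: contraNneq (Im_z_ls j) => ->.
have hV : ((z l j)^-1 : C^o) @[l --> ls^'-] --> ((z ls j)^-1 : C^o).
  exact: (@cvgV C _ _ FF _ _ zn0 (@zc j)).
have h1 : ((`|A l|)%:C : C^o) @[l --> ls^'-] --> (0%:C : C^o).
  by apply: cvgC_real; rewrite -[X in _ --> X](normr0 R); apply: cvg_norm; exact: Ac.
have h2 := @cvgCM _ _ _ FF _ _ _ _ h1 (@cvgCM _ _ _ FF _ _ _ _ hV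
  (@cvgCMl _ _ _ FF _ (- 4^-1)%:C _ h)).
rewrite mul0r in h2.
apply: cvg_trans h2; apply: near_eq_cvg; near=> l.
rewrite E; congr (_ * _).
have -> : (2 * H)%:C = 2 * H%:C by rewrite real_complexM rmorph_nat.
have -> : (- 4^-1)%:C = - 4^-1 :> C by rewrite -(rmorph_nat (real_complex R) 4) -fmorphV -rmorphN.
field.
have zl : Re (z l j) < 0 by near: l; exact: near_neg.
by apply/eqP => h0; move: zl; rewrite h0 ltxx.
Unshelve. all: by end_near. Qed.

Variables (Q : 'M[C]_2) (e es : R -> 'I_2 -> 'cV[C]_2) (v1 v2 : 'cV[C]_2).
Hypotheses
  (e_cont : forall j k, {within `]-oo, ls], continuous (fun l => e l j k 0 : C^o)})
  (es_cont : forall j k, {within `]-oo, ls], continuous (fun l => es l j k 0 : C^o)}).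

Let FF : Filter (ls^'- : set_system R). Proof. exact: _. Qed.

Let cvg_cdot (f g : R -> 'cV[C]_2) (f0 g0 : 'cV[C]_2) :
  (forall i, (f l i 0 : C^o) @[l --> ls^'-] --> (f0 i 0 : C^o)) ->
  (forall i, (g l i 0 : C^o) @[l --> ls^'-] --> (g0 i 0 : C^o)) ->
  (cdot (f l) (g l) : C^o) @[l --> ls^'-] --> (cdot f0 g0 : C^o).
Proof.
move=> hf hg.
have hgc i : (conjc (g l i 0) : C^o) @[l --> ls^'-] --> (conjc (g0 i 0) : C^o).
  by apply: cvgC_conj; exact: hg.
have -> : (fun l => cdot (f l) (g l)) =
    (fun l => f l 0 0 * conjc (g l 0 0) + f l 1 0 * conjc (g l 1 0)).
  by apply/funext => l; rewrite cdotE sum2E.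
rewrite cdotE sum2E.
by apply: cvgCD; apply: cvgCM; [exact: hf|exact: hgc|exact: hf|exact: hgc].
Qed.

Let ec j i : (e l j i 0 : C^o) @[l --> ls^'-] --> (e ls j i 0 : C^o).
Proof. exact: (within_cvg_left (@e_cont j i)). Qed.

Let esc j i : (es l j i 0 : C^o) @[l --> ls^'-] --> (es ls j i 0 : C^o).
Proof. exact: (within_cvg_left (@es_cont j i)). Qed.

Let wt l j k := conjc (cdot v1 (e l j)) * cdot v2 (e l k) * cdot (es l k) (Q *m es l j).

Let wtc j k : (wt l j k : C^o) @[l --> ls^'-] --> (wt ls j k : C^o).
Proof.
apply: cvgCM; first apply: cvgCM.
- by apply: cvgC_conj; apply: cvg_cdot => i; [exact: cvgC_cst|exact: ec].
- by apply: cvg_cdot => i; [exact: cvgC_cst|exact: ec].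
- apply: cvg_cdot => i; first exact: esc.
  have -> : (fun l => (Q *m es l j) i 0) = (fun l => Q i 0 * es l j 0 0 + Q i 1 * es l j 1 0).
    by apply/funext => l; rewrite mxE sum2E.
  rewrite mxE sum2E.
  by apply: cvgCD; apply: cvgCMl; exact: esc.
Qed.

Let cf l j k := (- z l j - conjc (z l k))^-1 * H%:C * Pcov (z l j) (z l k) H tau.

Let dl j k : C := if j == k then K%:C * cexp (conjc (z ls j) * tau%:C) else 0.

Let cfc j k : (`|A l|%:C * cf l j k : C^o) @[l --> ls^'-] --> (dl j k : C^o).
Proof. by rewrite /dl; case: (eqVneq j k) => [<-|jk]; [exact: cvg_coef_diag|exact: cvg_coef_off]. Qed.

Lemma cvg_scaled_covariance :
  (`|A l|%:C * (\sum_j \sum_k conjc (cdot v1 (e l j)) * cdot v2 (e l k)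
     * (cdot (es l k) (Q *m es l j) * cf l j k)) : C^o) @[l --> ls^'-] -->
  (K%:C * (\sum_j wt ls j j * cexp (conjc (z ls j) * tau%:C)) : C^o).
Proof.
have h j k : (wt l j k * (`|A l|%:C * cf l j k) : C^o) @[l --> ls^'-] --> (wt ls j k * dl j k : C^o).
  by apply: cvgCM; [exact: wtc|exact: cfc].
have -> : (fun l => `|A l|%:C * (\sum_j \sum_k conjc (cdot v1 (e l j)) * cdot v2 (e l k)
     * (cdot (es l k) (Q *m es l j) * cf l j k))) = (fun l =>
     wt l 0 0 * (`|A l|%:C * cf l 0 0) + wt l 0 1 * (`|A l|%:C * cf l 0 1)
     + (wt l 1 0 * (`|A l|%:C * cf l 1 0) + wt l 1 1 * (`|A l|%:C * cf l 1 1))).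
  apply/funext => l; exact: (@sum2_scaled _ (fun j => conjc (cdot v1 (e l j)))
    (fun k => cdot v2 (e l k)) (fun j k => cdot (es l k) (Q *m es l j)) (cf l)).
have -> : K%:C * (\sum_j wt ls j j * cexp (conjc (z ls j) * tau%:C)) =
    wt ls 0 0 * dl 0 0 + wt ls 0 1 * dl 0 1 + (wt ls 1 0 * dl 1 0 + wt ls 1 1 * dl 1 1).
  have dE j : dl j j = K%:C * cexp (conjc (z ls j) * tau%:C) by rewrite /dl eqxx.
  rewrite !dE; exact: (@sum2_diag _ (fun j => cexp (conjc (z ls j) * tau%:C)) (wt ls) K%:C).
by apply: cvgCD; apply: cvgCD; exact: h.
Qed.

Lemma asymp_left_covariance (V : R -> C) :
  (forall l, l < ls -> V l = \sum_j \sum_k conjc (cdot v1 (e l j)) * cdot v2 (e l k)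
     * (cdot (es l k) (Q *m es l j) * cf l j k)) ->
  \sum_j wt ls j j * cexp (conjc (z ls j) * tau%:C) != 0 ->
  asymp_left ls (fun l => cabs (V l)) (fun l => `|A l|^-1).
Proof.
move=> VE n0; apply: (@asymp_left_cvg _ _ (cabs (K%:C * (\sum_j wt ls j j *
  cexp (conjc (z ls j) * tau%:C))))).
  rewrite cabs_gt0; apply: mulf_neq0; last exact: n0.
  by rewrite -cabs_gt0 cabs_real normr_gt0; exact: K_neq0.
have h := @cvgC_cabsE _ _ _ FF _ _ cvg_scaled_covariance.
apply: cvg_trans h; apply: near_eq_cvg; near=> l.
rewrite -VE; last by near: l; exact: near_left.
by rewrite cabsM cabs_real normr_id invrK normrM normr_id (ger0_norm (cabs_ge0 _)) mulrC.
Unshelve. all: by end_near. Qed.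

End Criticality.

Theorem theorem4p1 (R : realType) (d : measure_display) (T : measurableType d)
  (P : probability T R) (ls : R) (A B : R -> R)
  (A_cont : {within `]-oo, ls], continuous A})
  (B_cont : {within `]-oo, ls], continuous B})
  (A_lt0 : forall l, l < ls -> A l < 0) (A_ls : A ls = 0)
  (B_neq0 : forall l, l <= ls -> B l <> 0)
  (M : R -> 'M[R]_2) (e es : R -> 'I_2 -> 'cV[R[i]]_2)
  (e_cont : forall j k, {within `]-oo, ls], continuous (fun l => e l j k 0 : R[i]^o)})
  (es_cont : forall j k, {within `]-oo, ls], continuous (fun l => es l j k 0 : R[i]^o)})
  (M_e : forall l j, l <= ls -> mxC (M l) *m e l j = zeta A B l j *: e l j)
  (MT_es : forall l j, l <= ls ->
     (mxC (M l))^T *m es l j = conjc (zeta A B l j) *: es l j)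
  (e_es : forall l j k, l <= ls -> cdot (e l j) (es l k) = (j == k)%:R)
  (S : 'M[R]_2) (S_spec : forall z : R[i], eigenvalue (mxC S) z -> 0 <= z)
  (H : R) (H_gt0 : 0 < H) (H_lt1 : H < 1)
  (W : R -> T -> 'cV[R]_2) (W_fBm : fBm P H W)
  (x0 : R -> 'cV[R]_2) (x : R -> R -> T -> 'cV[R]_2)
  (x_sol : forall l, l < ls -> solution P (M l) S W (x0 l) (x l)) :
  let Q := mxC (S *m S^T) in
  (forall l tau : R, l < ls -> 0 <= tau ->
     (forall w1 w2, cvg ((Vt P (x l) tau w1 w2 t : R[i]^o) @[t --> +oo])) /\
     forall j1 j2 : 'I_2,
       Vinf P (x l) tau (es l j1) (es l j2) =
       (- zeta A B l j1 - conjc (zeta A B l j2))^-1 * H%:C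
       * cdot (es l j2) (Q *m es l j1)
       * Pcov (zeta A B l j1) (zeta A B l j2) H tau) /\
  (S <> 0 ->
   {ae lebesgue_measure, forall tau : R, 0 <= tau ->
      forall v1 v2 : 'cV[R]_2,
        cexp (0 -i* (B ls * tau)) * cdot (es ls 0) (Q *m es ls 0)
          * conjc (cdot (mxC v1) (e ls 0)) * cdot (mxC v2) (e ls 0)
        + cexp (0 +i* (B ls * tau)) * cdot (es ls 1) (Q *m es ls 1)
          * conjc (cdot (mxC v1) (e ls 1)) * cdot (mxC v2) (e ls 1) <> 0 ->
        asymp_left ls (fun l => cabs (Vinf P (x l) tau (mxC v1) (mxC v2)))
                      (fun l => `|A l|^-1)}).
Proof.
move=> Q.
have H1 := ltW H_lt1.
have z_neg l (ll : l < ls) j : complex.Re (zeta A B l j) < 0.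
  by rewrite /zeta; case: (j == 0) => /=; exact: A_lt0.
have MT l (ll : l < ls) j := MT_es l j (ltW ll).
have ee l (ll : l < ls) j k := e_es l j k (ltW ll).
split => [l tau ll tau0|_].
  split => [w1 w2|j1 j2].
    apply: cvgP.
    exact: (@cvg_Vt _ _ _ P _ _ _ _ _ _ _ _ _ H_gt0 H1 (z_neg l ll) (MT l ll) (ee l ll)
      W_fBm (x_sol l ll) tau w1 w2 tau0).
  exact: (@Vinf_dual _ _ _ P _ _ _ _ _ _ _ _ _ H_gt0 H1 (z_neg l ll) (MT l ll) (ee l ll)
    W_fBm (x_sol l ll) tau j1 j2 tau0).
apply: aeW => tau tau0 v1 v2 n0.
apply: (@asymp_left_covariance _ H tau ls A B H_gt0 H_lt1 tau0 A_cont B_cont A_lt0 A_ls B_neq0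
  Q e es (mxC v1) (mxC v2) e_cont es_cont).
  move=> l ll.
  exact: (@VinfE _ _ _ P _ _ _ _ _ _ _ _ _ H_gt0 H1 (z_neg l ll) (MT l ll) (ee l ll)
    W_fBm (x_sol l ll) tau _ _ tau0).
apply/eqP => E; apply: n0; rewrite -[RHS]E sum2E.
have E0 : conjc (zeta A B ls 0) * tau%:C = 0 -i* (B ls * tau).
  by rewrite /zeta /= A_ls; apply: complex_eq; rewrite ?Re_M ?Im_M /=; ring.
have E1 : conjc (zeta A B ls 1) * tau%:C = 0 +i* (B ls * tau).
  by rewrite /zeta /= A_ls; apply: complex_eq; rewrite ?Re_M ?Im_M /=; ring.
by rewrite E0 E1; ring.
Qed.
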